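(* Let $(P,Q,\{v_1,\ldots,v_h\})$ be a symplectic Prato's datum in dimension $d$. Let $n\geq h$ and let $P$ be given by $$P=\bigcap_{j=1}^{n}\{\mu\in(\mathbb{R}^d)^*\;|\;\langle\mu,v_j\rangle\geq l_j\},\qquad v_j\in\mathbb{R}^d,\ l_j\in\mathbb{R},$$ where the first $h$ vectors $v_1,\dots,v_h$ are those of the datum, and (1) $\mathrm{Span}_{\mathbb{Z}}\{v_1,\ldots,v_n\}=Q$; and, if $n>h$, (2) $P\subset\{\mu\in (\mathbb{R}^d)^*\;|\;\langle\mu,v_j\rangle>l_j\}$ for each $j=h+1,\ldots,n$. Let $V=(v_1,\ldots,v_n)$, let $\mathrm{N}=\exp(\mathrm{Rel}(V))\subset(S^1)^n$, and let $\Psi\colon\mathbb{C}^n\to(\mathrm{Rel}(V))^*$ be the moment mapping of the induced action of $\mathrm{N}$ on $\mathbb{C}^{n}$ (normalized as in the context). Then the reduced space $M=\Psi^{-1}(0)/\mathrm{N}$ is endowed with an effective Hamiltonian action of the quasitorus $\mathbb{R}^d/Q$, and the image of the corresponding moment mapping $\Phi$ is exactly $P$. Moreover, $M$ is equivariantly symplectomorphic to the symplectic quasifold (orbifold, when $Q$ is a lattice) determined by $(P,Q,\{v_1,\ldots,v_h\})$.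
   Context: **Data.** A quasilattice $Q$ in $\mathbb{R}^d$ is the $\mathbb{Z}$-span of a finite set of vectors generating $\mathbb{R}^d$ over $\mathbb{R}$; it need not be discrete. A polytope $P\subset(\mathbb{R}^d)^*$ is a bounded intersection of finitely many closed half-spaces, here of full dimension $d$; it is simple if exactly $d$ facets meet at each vertex. Its normal fan is the fan in $\mathbb{R}^d$ whose rays are normal to the facets and inward pointing. A symplectic Prato's datum $(P,Q,\{v_1,\ldots,v_h\})$ consists of a simple polytope $P\subset(\mathbb{R}^d)^*$ with $h$ facets, a quasilattice $Q\subset\mathbb{R}^d$, and vectors $v_1,\ldots,v_h\in Q$ generating the $h$ rays of the normal fan of $P$ (one vector per ray). Repetitions and zero vectors are allowed among $v_{h+1},\dots,v_n$. **Relations and exponential.** For a list $V=(v_1,\ldots,v_n)$ in $\mathbb{R}^d$, $\mathrm{Rel}(V)=\{a\in\mathbb{R}^n \mid \sum_j a_jv_j=0\}$. For every $k$, $\exp\colon\mathbb{R}^k\to(S^1)^k$ is $\exp(a_1,\ldots,a_k)=(e^{2\pi i a_1},\ldots,e^{2\pi i a_k})$. The group $\mathrm N=\exp(\mathrm{Rel}(V))$ need not be closed in $(S^1)^n$. **Moment map.** $\mathbb{C}^k$ carries the standard Kähler form, normalized by a constant factor (and with sign convention for moment maps) such that the standard $(S^1)^k$-action has moment map $\underline z\mapsto\sum_j|z_j|^2e_j^*$. With $i\colon\mathrm{Rel}(V)\hookrightarrow\mathbb{R}^n$ the inclusion, $\Psi(\underline z)=i^*\big(\sum_{j=1}^n(|z_j|^2+l_j)e_j^*\big)$.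 **The symplectic quasifold determined by $(P,Q,\{v_1,\ldots,v_h\})$ (generalized Delzant construction).** Write $P=\bigcap_{j=1}^{h}\{\langle\mu,v_j\rangle\geq l_j\}$ (with the same $l_j$, $j\le h$). Put $\mathrm{N}'=\exp\big(\{a\in\mathbb{R}^h \mid \sum_{j=1}^h a_jv_j\in Q\}\big)\subset(S^1)^h$, whose Lie algebra is $\mathrm{Rel}(v_1,\ldots,v_h)$. With $i'\colon\mathrm{Rel}(v_1,\dots,v_h)\hookrightarrow\mathbb{R}^h$ the inclusion, let $\Psi'(\underline z)=(i')^*\big(\sum_{j=1}^h(|z_j|^2+l_j)e_j^*\big)$ on $\mathbb{C}^h$. The symplectic quasifold is $M'=(\Psi')^{-1}(0)/\mathrm{N}'$, of dimension $2d$. When $Q$ is a lattice it is a symplectic orbifold. **Quasifolds.** A quasifold model is a quotient $\tilde U/\Gamma$ of a connected manifold $\tilde U$ by a smooth action of a finite or countable group $\Gamma$ such that the set of points where the action is not free is closed and has topological codimension at least $2$. A quasifold is a topological space (not necessarily Hausdorff) with an atlas of charts given by homeomorphisms from models, with transition maps that are diffeomorphisms of models, i.e. that lift to equivariant diffeomorphisms of (coverings of) the manifolds $\tilde U$. Smooth maps are maps that lift locally to smooth maps; differential forms (in particular symplectic forms) are given locally by $\Gamma$-invariant forms on the $\tilde U$, compatible with transition maps. A symplectomorphism is a diffeomorphism of quasifolds matching the symplectic forms. **Quasifold structure on the reduced spaces.** Let $(\Psi,\mathrm N)$ stand for $(\Psi,\mathrm N)$ on $\mathbb{C}^n$, or for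 $(\Psi',\mathrm N')$ on $\mathbb{C}^h$ (with $n$ replaced by $h$ below). The quotient $\Psi^{-1}(0)/\mathrm{N}$ has the quotient topology and the following charts, one for each vertex $\nu$ of $P$. Let $I\subset\{1,\ldots,h\}$ be the set of the $d$ indices of the facets through $\nu$. For $(z_i)_{i\in I}\in\mathbb{C}^I$ let $\mu\in(\mathbb{R}^d)^*$ be determined by $\langle\mu,v_i\rangle=|z_i|^2+l_i$ for $i\in I$. Let $\tilde U_I\subset\mathbb{C}^I$ be the open set where $\langle\mu,v_j\rangle>l_j$ for all $j\notin I$. Let $\Gamma_I=\{t\in\mathrm{N} \mid t_j=1\ \forall j\notin I\}$ act on $\tilde U_I$ by its $I$-components. The chart $\tilde U_I/\Gamma_I\to\Psi^{-1}(0)/\mathrm{N}$ is induced by setting $z_j=\sqrt{\langle\mu,v_j\rangle-l_j}$ for $j\notin I$. The symplectic form on the quotient is the reduced form (the one whose pullback to $\Psi^{-1}(0)$ is the restriction of the form on the ambient complex vector space). **Quasitorus action.** The quasitorus $\mathbb{R}^d/Q$ is the quotient group, with Lie algebra $\mathbb{R}^d$ and exponential map the projection $\mathbb{R}^d\to\mathbb{R}^d/Q$. It acts on $M$ through the isomorphism $(S^1)^n/\mathrm{N}\simeq\mathbb{R}^d/Q$ induced by $\mathbb{R}^n\to\mathbb{R}^d$, $e_j\mapsto v_j$, and on $M'$ through $(S^1)^h/\mathrm{N}'\simeq\mathbb{R}^d/Q$ induced by $\mathbb{R}^h\to\mathbb{R}^d$, $e_j\mapsto v_j$. The action is Hamiltonian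 if it is smooth, preserves the symplectic form, and there is an invariant smooth map $\Phi$ to $(\mathbb{R}^d)^*$ (the moment mapping) such that for each $\xi\in\mathbb{R}^d$ the function $\langle\Phi,\xi\rangle$ is a Hamiltonian for the vector field generated by $\xi$, with the sign convention for which the standard $(S^1)^k$-action on $\mathbb{C}^k$, with its normalized standard Kähler form, has moment map $\underline z\mapsto\sum_j|z_j|^2e_j^*$. *)

(* Defs.v *)
From HB Require Import structures.
From mathcomp Require Import all_boot all_order all_algebra.
From mathcomp Require Import all_classical all_reals all_analysis.
From mathcomp Require Import complex.

Set Implicit Arguments.
Unset Strict Implicit.
Unset Printing Implicit Defensive.

Import Order.TTheory GRing.Theory Num.Theory.
Import numFieldNormedType.Exports.

Local Open Scope classical_set_scope.
Local Open Scope ring_scope.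

(* Vectors of R^d are columns and elements of the dual (R^d)^* are rows. *)
Definition pairing (R : realType) (d : nat) (mu : 'rV[R]_d) (x : 'cV[R]_d) : R :=
  (mu *m x) 0 0.

Section Polytopes.
Context {R : realType} {d : nat}.
Implicit Types (P F : set 'rV[R]_d) (Q : set 'cV[R]_d).

Definition lincomb (k : nat) (w : 'I_k -> 'cV[R]_d) (a : 'cV[R]_k) : 'cV[R]_d :=
  \sum_j a j 0 *: w j.

Definition Rel (k : nat) (w : 'I_k -> 'cV[R]_d) : set 'cV[R]_k :=
  [set a | lincomb w a = 0].

Definition generates (k : nat) (w : 'I_k -> 'cV[R]_d) : Prop :=
  forall x, exists a, x = lincomb w a.

Definition zspan (k : nat) (w : 'I_k -> 'cV[R]_d) : set 'cV[R]_d :=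
  [set x | exists a : 'I_k -> int, x = \sum_j w j *~ a j].

Definition quasilattice Q : Prop :=
  exists k (w : 'I_k -> 'cV[R]_d), generates w /\ Q = zspan w.

Definition lattice Q : Prop :=
  exists w : 'I_d -> 'cV[R]_d, generates w /\ Q = zspan w.

Definition polyhedron (k : nat) (w : 'I_k -> 'cV[R]_d) (c : 'I_k -> R) :
    set 'rV[R]_d :=
  [set mu | forall j, c j <= pairing mu (w j)].

Definition affine_indep (k : nat) (p : 'I_k.+1 -> 'rV[R]_d) : Prop :=
  row_free (\matrix_(i < k) (p (lift ord0 i) - p ord0)).

Definition affine_dim F (k : nat) : Prop :=
  (exists p : 'I_k.+1 -> 'rV[R]_d, (forall i, F (p i)) /\ affine_indep p) /\
  (forall p : 'I_k.+2 -> 'rV[R]_d, (forall i, F (p i)) -> ~ affine_indep p).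

Definition polytope P : Prop :=
  [/\ exists k (w : 'I_k -> 'cV[R]_d) (c : 'I_k -> R),
        (forall j, w j <> 0) /\ P = polyhedron w c,
      bounded_set P & affine_dim P d].

Definition face P F : Prop :=
  exists (w : 'cV[R]_d) (c : R),
    P `<=` [set mu | c <= pairing mu w] /\
    F = P `&` [set mu | pairing mu w = c].

Definition facet P F : Prop :=
  face P F /\ exists k, k.+1 = d /\ affine_dim F k.

Definition vertex P (nu : 'rV[R]_d) : Prop := face P [set nu].

Definition simple_polytope P : Prop :=
  forall nu, vertex P nu -> ([set F | facet P F /\ F nu] #= `I_d)%card.

(* The cone of the normal fan attached to a face, with the inward convention:
   the vectors whose pairing with P is minimal along F. *)
Definition normal_cone P F : set 'cV[R]_d :=
  [set w | forall mu mu', F mu -> P mu' -> pairing mu w <= pairing mu' w].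

Definition ray (w : 'cV[R]_d) : set 'cV[R]_d :=
  [set x | exists2 t : R, 0 <= t & x = t *: w].

(* The last two clauses give a bijection between 'I_h and the facets of P, so
   that P has exactly h facets. *)
Definition prato_datum (h : nat) P Q (w : 'I_h -> 'cV[R]_d) : Prop :=
  [/\ polytope P /\ simple_polytope P,
      quasilattice Q,
      forall j, Q (w j),
      forall j, exists2 F, facet P F & normal_cone P F = ray (w j) &
      forall F, facet P F -> exists! j, normal_cone P F = ray (w j)].

End Polytopes.

Section Smoothness.
Context {R : realType}.

Definition iter_derive (V W : normedModType R) (us : seq V) (f : V -> W) : V -> W :=
  foldr (fun u g => 'D_u g) f us.

Definition smooth_on (V W : normedModType R) (U : set V) (f : V -> W) : Prop :=
  forall (us : seq V) (x : V), U x ->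
    {for x, continuous (iter_derive us f)} /\
    (forall u, derivable (iter_derive us f) x u).

Definition two_form (m : nat) : Type := 'rV[R]_m -> 'rV[R]_m -> 'rV[R]_m -> R.

Definition pullback_eq (m m' : nat) (O : set 'rV[R]_m)
    (f : 'rV[R]_m -> 'rV[R]_m') (w : two_form m) (w' : two_form m') : Prop :=
  forall x, O x -> forall u1 u2, w x u1 u2 = w' (f x) ('D_u1 f x) ('D_u2 f x).

Definition symplectic_form (m : nat) (U : set 'rV[R]_m) (w : two_form m) : Prop :=
  [/\ forall x, U x ->
        (forall a u1 u2 u3, w x (a *: u1 + u2) u3 = a * w x u1 u3 + w x u2 u3) /\
        (forall u, w x u u = 0) /\
        (forall u1 u2, w x u1 u2 = - w x u2 u1),
      forall u1 u2, smooth_on U (fun x => w x u1 u2),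
      forall x, U x -> forall u1 u2 u3,
        'D_u1 (fun y => w y u2 u3) x + 'D_u2 (fun y => w y u3 u1) x
        + 'D_u3 (fun y => w y u1 u2) x = 0 &
      forall x, U x -> forall u1, (forall u2, w x u1 u2 = 0) -> u1 = 0].

End Smoothness.

(* [dim_lt k A]: the (small inductive) topological dimension of A, with its
   subspace topology, is < k. The set [A `&` closure (A `&` W) `\` W] is the
   boundary relative to A of its relatively open subset [A `&` W]. *)
Fixpoint dim_lt (T : topologicalType) (k : nat) (A : set T) : Prop :=
  if k is k'.+1 then
    forall x U, A x -> open U -> U x ->
      exists W, [/\ open W, W x, W `<=` U &
        dim_lt k' (A `&` closure (A `&` W) `\` W)]
  else A = set0.

Section Coverings.
Context {V Y : topologicalType}.
Implicit Types (W : set V) (p : Y -> V) (G : set (V -> V)).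

Definition covering W p : Prop :=
  [/\ continuous p, range p = W &
      forall x, W x -> exists U : set V, [/\ open U, U x, U `<=` W &
        exists (J : Type) (S : J -> set Y),
          [/\ forall j, open (S j),
              forall i j y, S i y -> S j y -> i = j,
              p @^-1` U = \bigcup_j S j &
              forall j, [/\ {in S j &, injective p}, p @` S j = U &
                forall O, open O -> O `<=` S j -> open (p @` O)]]]].

Definition homeomorphism (g : Y -> Y) : Prop :=
  continuous g /\
  exists2 g' : Y -> Y, continuous g' & cancel g g' /\ cancel g' g.

(* The group of all lifts to Y of the elements of G. *)
Definition lifts G p : set (Y -> Y) :=
  [set g | homeomorphism g /\
           exists2 gam, G gam & forall y, p (g y) = gam (p y)].

(* A connected covering Y of W such that Y / lifts G p is W / G, i.e. two points
   of Y over the same G-orbit are exchanged by a lift. *)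
Definition model_covering W G p : Prop :=
  [/\ connected [set: Y], covering W p &
      forall y y', (exists2 gam, G gam & p y' = gam (p y)) ->
        exists2 g, lifts G p g & g y = y'].

End Coverings.

(* A chart of dimension m: the model is [dom / grp], with [dom] an open subset
   of R^m, and [par : dom -> X] is the projection onto [dom / grp] followed by
   the chart. Since the action of a model is free somewhere, its group is
   identified with a group of transformations of [dom]. Values outside [dom]
   are irrelevant. *)
Record chart (R : realType) (m : nat) (X : Type) : Type := Chart {
  dom : set 'rV[R]_m ;
  grp : set ('rV[R]_m -> 'rV[R]_m) ;
  par : 'rV[R]_m -> X }.

(* A space with a family of charts and a 2-form on each model; see
   [is_symplectic_quasifold] for the conditions. *)
Record quasifold_data (R : realType) (m : nat) : Type := QuasifoldData {
  space :> topologicalType ;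
  index : Type ;
  chart_of : index -> chart R m space ;
  form_of : index -> two_form (R := R) m }.

Section Quasifolds.
Context {R : realType} {m : nat}.
Implicit Types (X Y : quasifold_data R m).

Definition not_free (U : set 'rV[R]_m) (G : set ('rV[R]_m -> 'rV[R]_m)) :
    set 'rV[R]_m :=
  [set x | U x /\ exists gam, [/\ G gam, gam x = x &
                                  exists2 y, U y & gam y <> y]].

Definition is_model (U : set 'rV[R]_m) (G : set ('rV[R]_m -> 'rV[R]_m)) : Prop :=
  [/\ [/\ open U, U !=set0 & connected U],
      (forall gam, G gam -> smooth_on U gam /\ (forall x, U x -> U (gam x))),
      [/\ exists2 e, G e & forall x, U x -> e x = x,
          forall g1 g2, G g1 -> G g2 ->
            exists2 g3, G g3 & forall x, U x -> g3 x = g1 (g2 x) &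
          forall g1, G g1 ->
            exists2 g2, G g2 &
              forall x, U x -> g2 (g1 x) = x /\ g1 (g2 x) = x],
      countable G &
      (exists2 C, closed C & not_free U G = U `&` C) /\
      (* dimension <= m - 2 *)
      dim_lt m.-1 (not_free U G)].

(* [par] induces a homeomorphism from [dom / grp], with the quotient topology,
   onto an open subset of X. *)
Definition is_chart (X : topologicalType) (c : chart R m X) : Prop :=
  [/\ is_model (dom c) (grp c),
      forall x y, dom c x -> dom c y ->
        (par c x = par c y <-> exists2 gam, grp c gam & y = gam x),
      open (par c @` dom c) &
      forall O, O `<=` par c @` dom c ->
        (open O <-> open (dom c `&` par c @^-1` O))].

Definition overlap (X : topologicalType) (c1 c2 : chart R m X) : set 'rV[R]_m :=
  [set x | dom c1 x /\ (par c2 @` dom c2) (par c1 x)].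

(* The transition map from [overlap c1 c2 / grp c1] to [overlap c2 c1 / grp c2]
   is a diffeomorphism of models: it lifts to an equivariant diffeomorphism
   between coverings of the two overlaps. The two coverings are identified by
   this diffeomorphism, hence a single Y with two projections p1 and p2 which
   induce the same smooth structure on Y; equivariance says that both groups
   have the same lifts to Y. *)
Definition compatible_charts (X : topologicalType) (c1 c2 : chart R m X) : Prop :=
  exists (Y : topologicalType) (p1 p2 : Y -> 'rV[R]_m),
    [/\ model_covering (overlap c1 c2) (grp c1) p1,
        model_covering (overlap c2 c1) (grp c2) p2,
        forall y, par c1 (p1 y) = par c2 (p2 y),
        forall y, exists (O : set Y) (f1 f2 : 'rV[R]_m -> 'rV[R]_m),
          [/\ open O /\ O y,
              open (p1 @` O) /\ open (p2 @` O),
              smooth_on (p1 @` O) f1 /\ smooth_on (p2 @` O) f2 &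
              forall y', O y' -> p2 y' = f1 (p1 y') /\ p1 y' = f2 (p2 y')] &
        lifts (grp c1) p1 = lifts (grp c2) p2].

Definition is_quasifold X : Prop :=
  [/\ forall i, is_chart (chart_of (q := X) i),
      forall x : X, exists i, (par (chart_of i) @` dom (chart_of i)) x &
      forall i j : index X, overlap (chart_of i) (chart_of j) !=set0 ->
        compatible_charts (chart_of i) (chart_of j)].

Definition is_orbifold X : Prop :=
  [/\ is_quasifold X, hausdorff_space X &
      forall i : index X, finite_set (grp (chart_of i))].

Definition local_lift X Y (F : X -> Y) (i : index X) (j : index Y)
    (O : set 'rV[R]_m) (f : 'rV[R]_m -> 'rV[R]_m) : Prop :=
  [/\ open O, O `<=` dom (chart_of i), smooth_on O f &
      forall x, O x -> dom (chart_of j) (f x) /\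
                       par (chart_of j) (f x) = F (par (chart_of i) x)].

Definition smooth_map X Y (F : X -> Y) : Prop :=
  forall i x, dom (chart_of i) x ->
    exists j O f, O x /\ local_lift F i j O f.

Definition preserves_forms X Y (F : X -> Y) : Prop :=
  forall i j O f, local_lift F i j O f ->
    pullback_eq O f (form_of i) (form_of j).

(* The forms on the models are compatible with the transition maps, and in
   particular invariant, when they are preserved by all local lifts of the
   identity. *)
Definition is_symplectic_quasifold X : Prop :=
  [/\ is_quasifold X,
      forall i : index X, symplectic_form (dom (chart_of i)) (form_of i) &
      preserves_forms (X := X) (Y := X) id].

Definition symplectomorphism X Y (F : X -> Y) : Prop :=
  [/\ smooth_map F, preserves_forms F &
      exists2 G : Y -> X, smooth_map G & cancel F G /\ cancel G F].

End Quasifolds.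

(* An action of the quasitorus R^d/Q is given as an action of R^d for which Q
   acts trivially; [act xi] is the action of the class of xi, which is also the
   exponential of xi. *)
Section QuasitorusActions.
Context {R : realType} {m d : nat} (Q : set 'cV[R]_d) (X : quasifold_data R m).
Variable act : 'cV[R]_d -> X -> X.

Definition quasitorus_action : Prop :=
  [/\ forall x, act 0 x = x,
      forall xi eta x, act (xi + eta) x = act xi (act eta x) &
      forall xi, Q xi -> forall x, act xi x = x].

Definition effective_action : Prop :=
  forall xi, (forall x, act xi x = x) -> Q xi.

(* Smoothness of R^d/Q * X -> X, with R^d as the model of R^d/Q. *)
Definition smooth_action : Prop :=
  forall (i : index X) x xi, dom (chart_of i) x ->
    exists (j : index X) (O : set ('cV[R]_d * 'rV[R]_m))
           (f : 'cV[R]_d * 'rV[R]_m -> 'rV[R]_m),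
      [/\ open O, O (xi, x), smooth_on O f &
          forall eta y, O (eta, y) -> dom (chart_of i) y ->
            dom (chart_of j) (f (eta, y)) /\
            par (chart_of j) (f (eta, y)) = act eta (par (chart_of i) y)].

(* [u] is the value at x, in the chart i, of the vector field generated by xi:
   f is a local lift of (t, y) |-> exp(t xi) . y with f(0, .) = id. *)
Definition generated_vector (xi : 'cV[R]_d) (i : index X) (x u : 'rV[R]_m) : Prop :=
  exists (O : set (R^o * 'rV[R]_m)) (f : R^o * 'rV[R]_m -> 'rV[R]_m),
    [/\ open O /\ O (0, x), smooth_on O f,
        forall t y, O (t, y) -> dom (chart_of i) y ->
          dom (chart_of i) (f (t, y)) /\
          par (chart_of i) (f (t, y)) = act (t *: xi) (par (chart_of i) y),
        forall y, O (0, y) -> f (0, y) = y &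
        u = 'D_1 (fun t : R^o => f (t, x)) 0].

(* Hamiltonian functions H of a vector field Z are taken with the convention
   dH = omega(-, Z): see [std_form]. *)
Definition moment_map (Phi : X -> 'rV[R]_d) : Prop :=
  [/\ forall xi x, Phi (act xi x) = Phi x,
      forall i : index X,
        smooth_on (dom (chart_of i)) (fun x => Phi (par (chart_of i) x)) &
      forall xi (i : index X) x, dom (chart_of i) x ->
        exists2 u, generated_vector xi i x u &
          forall w, 'D_w (fun y => pairing (Phi (par (chart_of i) y)) xi) x
                    = form_of i x w u].

Definition hamiltonian_action (Phi : X -> 'rV[R]_d) : Prop :=
  [/\ quasitorus_action, smooth_action,
      forall xi, preserves_forms (act xi) & moment_map Phi].

End QuasitorusActions.

(* C^k is R^k * R^k: the row (x_1, .., x_k, y_1, .., y_k) has the complex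
   coordinates z_j = x_j + i y_j. *)
Section ComplexSpace.
Context {R : realType} {k : nat}.

Definition re (z : 'rV[R]_(k + k)) (j : 'I_k) : R := z 0 (lshift k j).
Definition im (z : 'rV[R]_(k + k)) (j : 'I_k) : R := z 0 (rshift k j).

Definition zcoord (z : 'rV[R]_(k + k)) (j : 'I_k) : R[i] := Complex (re z j) (im z j).

Definition of_zcoord (f : 'I_k -> R[i]) : 'rV[R]_(k + k) :=
  row_mx (\row_j complex.Re (f j)) (\row_j complex.Im (f j)).

Definition sqabs (z : 'rV[R]_(k + k)) (j : 'I_k) : R := re z j ^+ 2 + im z j ^+ 2.

(* exp : R^k -> (S^1)^k, a |-> (e^{2 pi i a_j})_j *)
Definition torus_exp (a : 'cV[R]_k) : 'cV[R[i]]_k :=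
  \col_j Complex (cos (2 * pi * a j 0)) (sin (2 * pi * a j 0)).

Definition torus_act (t : 'cV[R[i]]_k) (z : 'rV[R]_(k + k)) : 'rV[R]_(k + k) :=
  of_zcoord (fun j => t j 0 * zcoord z j).

(* The Kaehler form (1/pi) sum_j dx_j /\ dy_j. The vector field generated by e_j
   is Z = 2 pi (x_j d/dy_j - y_j d/dx_j), and d|z_j|^2 = omega(-, Z): hence, for
   the convention of [moment_map], the standard action has moment map
   z |-> sum_j |z_j|^2 e_j^*. *)
Definition std_form (u1 u2 : 'rV[R]_(k + k)) : R :=
  pi^-1 * \sum_j (re u1 j * im u2 j - im u1 j * re u2 j).

End ComplexSpace.

Section ReducedSpace.
Context {R : realType} {d n : nat}.
Variables (v : 'I_n -> 'cV[R]_d) (l : 'I_n -> R) (N : set 'cV[R[i]]_n).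

(* The value at a of sum_j (|z_j|^2 + l_j) e_j^*; Psi z is its restriction to
   the a in Rel v. *)
Definition Psi (z : 'rV[R]_(n + n)) (a : 'cV[R]_n) : R :=
  \sum_j (sqabs z j + l j) * a j 0.

Definition level : set 'rV[R]_(n + n) :=
  [set z | forall a, Rel v a -> Psi z a = 0].

Definition orbit (z : 'rV[R]_(n + n)) : set 'rV[R]_(n + n) :=
  [set w | exists2 t, N t & w = torus_act t z].

Definition same_orbit (z w : level) : bool :=
  `[< orbit (val z) = orbit (val w) >].

Lemma same_orbit_refl : reflexive same_orbit.
Proof. by move=> z; apply/asboolP. Qed.

Lemma same_orbit_sym : symmetric same_orbit.
Proof. by move=> z w; apply/asboolP/asboolP. Qed.

Lemma same_orbit_trans : transitive same_orbit.
Proof. by move=> w z y /asboolP zw /asboolP wy; apply/asboolP; rewrite zw. Qed.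

Canonical same_orbit_equiv :=
  EquivRel same_orbit same_orbit_refl same_orbit_sym same_orbit_trans.

Definition orbit_quot : quotType level := {eq_quot same_orbit}%qT.

Definition orbit_space : topologicalType := quotient_topology orbit_quot.

Definition orbit_class (z : level) : orbit_space := \pi_(orbit_quot)%qT z.

(* A vertex nu together with the increasing enumeration of the indices of the
   facet hyperplanes through nu, which identifies C^I with C^d. An inequality
   that is strict on the whole polyhedron is never active at nu. *)
Record vertex_index : Type := VertexIndex {
  vtx : 'rV[R]_d ;
  enumI : 'I_d -> 'I_n ;
  vtxP : vertex (polyhedron v l) vtx ;
  enumI_incr : {homo enumI : i j / (i < j)%N} ;
  enumIP : forall j, (exists k, enumI k = j) <-> pairing vtx (v j) = l j }.

Section Chart.
Variable nu : vertex_index.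

(* The mu with <mu, v_i> = |z_i|^2 + l_i for all i in I. *)
Definition chart_mu (z : 'rV[R]_(d + d)) : 'rV[R]_d :=
  (\row_k (sqabs z k + l (enumI nu k))) *m
    invmx (\matrix_(r, k) v (enumI nu k) r 0).

Definition chart_section (z : 'rV[R]_(d + d)) : 'rV[R]_(n + n) :=
  of_zcoord (fun j =>
    if [pick k | enumI nu k == j] is Some k then zcoord z k
    else Complex (Num.sqrt (pairing (chart_mu z) (v j) - l j)) 0).

Definition chart_dom : set 'rV[R]_(d + d) :=
  [set z | forall j, (forall k, enumI nu k <> j) ->
             l j < pairing (chart_mu z) (v j)].

Definition chart_grp : set ('rV[R]_(d + d) -> 'rV[R]_(d + d)) :=
  [set gam | exists t, [/\ N t,
     forall j, (forall k, enumI nu k <> j) -> t j 0 = 1 &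
     gam = torus_act (\col_k t (enumI nu k) 0)]].

Definition base_point : 'rV[R]_(n + n) :=
  of_zcoord (fun j => Complex (Num.sqrt (pairing (vtx nu) (v j) - l j)) 0).

Lemma base_point_level : base_point \in level.
Proof.
apply/mem_set => a va.
have lnu j : l j <= pairing (vtx nu) (v j).
  case: (vtxP nu) => w [c [_ e]].
  have : [set vtx nu] (vtx nu) by [].
  by rewrite e => -[+ _]; apply.
have sqE j : sqabs base_point j + l j = pairing (vtx nu) (v j).
  rewrite /sqabs /re /im /base_point /of_zcoord row_mxEl row_mxEr !mxE /=.
  by rewrite expr0n addr0 sqr_sqrtr ?subr_ge0// subrK.
rewrite /Psi (eq_bigr (fun j => (vtx nu *m (a j 0 *: v j)) 0 0)).
  by rewrite -summxE -mulmx_sumr -/(lincomb v a) va mulmx0 mxE.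
by move=> j _; rewrite sqE /pairing -scalemxAr [RHS]mxE mulrC.
Qed.

(* The default value [base_point] is never used on [chart_dom], where
   [chart_section] takes its values in [level]. *)
Definition chart_par (z : 'rV[R]_(d + d)) : orbit_space :=
  orbit_class (insubd (Sub base_point base_point_level : level) (chart_section z)).

(* The pullback of the ambient form by [chart_section], which lifts the chart to
   [level]: the expression in the chart of the form on the quotient whose
   pullback to [level] is the restriction of the ambient form. *)
Definition chart_form : two_form (R := R) (d + d) :=
  fun z u1 u2 => std_form ('D_u1 chart_section z) ('D_u2 chart_section z).

End Chart.

Definition reduced_space : quasifold_data R (d + d) :=
  @QuasifoldData R (d + d) orbit_space vertex_index
    (fun nu => Chart (chart_dom nu) (chart_grp nu) (chart_par nu)) chart_form.

(* The action of R^d/Q through (S^1)^n/N: if xi = sum_j a_j v_j, then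
   xi . [z] = [exp(a) z]. *)
Definition induced_action (act : 'cV[R]_d -> reduced_space -> reduced_space) : Prop :=
  forall (a : 'cV[R]_n) (z w : level),
    val w = torus_act (torus_exp a) (val z) ->
    act (lincomb v a) (orbit_class z) = orbit_class w.

End ReducedSpace.

Section PratoQuasifold.
Context {R : realType} {d : nat}.

(* Psi^{-1}(0) / exp (Rel v) *)
Definition reduction (n : nat) (v : 'I_n -> 'cV[R]_d) (l : 'I_n -> R) :
    quasifold_data R (d + d) :=
  reduced_space v l (torus_exp @` Rel v).

(* The symplectic quasifold determined by a datum, by the generalized Delzant
   construction. *)
Definition prato_quasifold (h : nat) (Q : set 'cV[R]_d) (v : 'I_h -> 'cV[R]_d)
    (l : 'I_h -> R) : quasifold_data R (d + d) :=
  reduced_space v l (torus_exp @` [set a | Q (lincomb v a)]).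

End PratoQuasifold.

(* Main.v *)
From HB Require Import structures.
Require Import Defs.
From mathcomp Require Import all_boot all_order all_algebra.
From mathcomp Require Import all_classical all_reals all_analysis.
From mathcomp Require Import complex ring lra.

(** Let [w] be a list of vectors with constants [c], and let [N] be the group of
    the exponentials of the coefficients [a] with [lincomb w a] in [Q]. When the
    integral span of [w] is [Q], such an [a] differs from a relation by integers, so that
    [N] is the exponential of [Rel w] ([torus_exp_rel]). Hence the reduced space
    and the quasifold determined by the datum are quotients of the same kind, one for all
    the vectors and one for the facet vectors. They are treated together, under the
    hypotheses collected in [quasi_data]: at each vertex the active vectors form a basis,
    and the active constraints of each point of the polyhedron are active at some vertex.
    Both follow from the simplicity of the polytope, once its facets have been matched with
    the first vectors ([facetE], [vertex_card], [vertex_above]); the additional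
    constraints are strict and are never active.

    A point [z] is in the level set when [|z_j|^2 + l_j] is the value on [v_j] of some
    [mu] ([levelP]). Since the vectors at a vertex form a basis, the phases of the other
    coordinates can be changed at will by relations, so an orbit where these coordinates do
    not vanish meets the slice where they are positive, and it does so along an orbit of
    the group of the chart; this gives the charts ([chart_is_chart]). Two charts are
    compared by means of the space [transition] of the triples of a point in each chart and
    a relation [a] whose exponential carries the section of one to the section of the
    other. It covers both overlaps: nearby points are reached by correcting phases
    with [atan]. It is connected, because the moduli squared can be deformed
    linearly and the relation shrunk to 0 ([transition_connected]). A lift of a group
    element changes [a] by integers, hence by a constant, which shows that both groups have
    the same lifts ([transition_compatible]).

    In a chart the reduced form is the standard one, as the remaining coordinates of
    the section are real ([chart_form_std]). The transition maps preserve it because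
    relations annihilate the differential of the moduli squared on the level set
    ([transport_pullback]). An arbitrary smooth lift of the identity differs from
    a transition map by a group element that may vary from point to point; as the
    group is countable, Baire's theorem makes it locally constant on a dense open set, and
    this is enough ([lift_pullback]). The quasitorus acts in a chart by rotations, with moment map
    [mu]; its image consists of all [mu] with nonnegative [<mu, v_j> - l_j], which is
    the polytope ([action_hamiltonian], [moment_range]). If [Q] is a lattice
    the groups of the charts are finite, and the moment map together with these groups
    separates points ([reduced_space_orbifold]).

    Finally the charts of the two quotients at a vertex have the same domains, and
    the section of the larger one only adds coordinates. The latter are functions of [mu],
    and being positive they force the angles of an identification to be integers, which
    does not matter modulo [Q]. So two points are identified in one quotient exactly when
    they are in the other ([same_par]), and the identity of the charts is the
    equivariant symplectomorphism ([comparison]). *)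

Set Implicit Arguments.
Unset Strict Implicit.
Unset Printing Implicit Defensive.

Import Order.TTheory GRing.Theory Num.Theory.
Import numFieldNormedType.Exports.

Local Open Scope classical_set_scope.
Local Open Scope ring_scope.

(** * Calculus of smooth functions on open sets *)

Section SmoothCalculus.
Context {R : realType}.

Section Regularity.
Context {V W : normedModType R}.

(** Smoothness is stated through derivatives along lists of directions; peeling
    off one direction at a time makes it accessible to induction on the order. *)
Fixpoint Ck (k : nat) (U : set V) (f : V -> W) : Prop :=
  if k is k'.+1 then
    [/\ forall x, U x -> {for x, continuous f},
        forall x u, U x -> derivable f x u &
        forall u, Ck k' U ('D_u f)]
  else forall x, U x -> {for x, continuous f}.

End Regularity.

Lemma smooth_onP {V W : normedModType R} (U : set V) (f : V -> W) :
  smooth_on U f <-> forall k, Ck k U f.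
Proof.
split=> [fs k|fC us x].
  elim: k f fs => [|k IH] f fs; first by move=> x Ux; exact: (fs [::] x Ux).1.
  split=> [x Ux|x u Ux|u]; first exact: (fs [::] x Ux).1.
    exact: (fs [::] x Ux).2.
  by apply: IH => us x Ux; have := fs (rcons us u) x Ux; rewrite /iter_derive foldr_rcons.
elim/last_ind: us f fC => [|us u IH] f fC Ux.
  by split=> [|u]; [exact: (fC 0%N)|have [_ + _] := fC 1%N; exact].
rewrite /iter_derive foldr_rcons; apply: IH => // k.
by have [_ _] := fC k.+1; exact.
Qed.

Lemma smooth_onS {V W : normedModType R} (U U' : set V) (f : V -> W) :
  U' `<=` U -> smooth_on U f -> smooth_on U' f.
Proof. by move=> UU fs us x /UU; exact: fs. Qed.

Section Basic.
Context {V W : normedModType R}.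
Implicit Types (U : set V) (f g : V -> W).

Lemma Ck_continuous k U f x : Ck k U f -> U x -> {for x, continuous f}.
Proof. by case: k => [|k] /=; [exact|case=> + _ _; exact]. Qed.

Lemma CkW k U f : Ck k.+1 U f -> Ck k U f.
Proof.
elim: k f => [|k IH] f; first by case.
by move=> [fc fd fD]; split=> // u; exact: IH.
Qed.

Lemma near_open_eq U f g x : open U -> {in U, f =1 g} -> U x ->
  \forall y \near x, f y = g y.
Proof.
move=> oU fg Ux; near=> y; apply: fg; apply/mem_set; near: y.
exact: open_nbhs_nbhs.
Unshelve. all: by end_near. Qed.

Lemma Ck_eq k U f g : open U -> {in U, f =1 g} -> Ck k U f -> Ck k U g.
Proof.
move=> oU; elim: k f g => [|k IH] f g fg.
  move=> fc x Ux; have nfg := near_open_eq oU fg Ux.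
  have -> : {for x, continuous g} = (g @ x --> f x) by rewrite (fg x)//; exact/mem_set.
  by apply: cvg_trans (fc x Ux); exact: near_eq_cvg.
move=> [fc fd fD]; split.
- move=> x Ux; have nfg := near_open_eq oU fg Ux.
  have -> : {for x, continuous g} = (g @ x --> f x) by rewrite (fg x)//; exact/mem_set.
  by apply: cvg_trans (fc x Ux); exact: near_eq_cvg.
- move=> x u Ux; apply: near_eq_derivable (fd x u Ux); exact: near_open_eq Ux.
- move=> u; apply: IH (fD u) => x /set_mem Ux.
  by apply: near_eq_derive; exact: near_open_eq Ux.
Qed.

Lemma Ck_cst k U (c : W) : Ck k U (fun=> c).
Proof.
elim: k c => [|k IH] c; first by move=> x _; exact: cst_continuous.
split=> [x _|x u _|u]; [exact: cst_continuous|exact: derivable_cst|].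
rewrite (_ : 'D_u _ = fun=> 0) //.
by apply/funext => x; rewrite (derive_cst c).
Qed.

Lemma is_derive_linear f x u : linear f -> is_derive x u f (f u).
Proof.
move=> lf.
have qE : (fun h => h^-1 *: ((f \o shift x) (h *: u) - f x)) @ (0 : R)^' --> f u.
  apply: cvg_near_cst; near=> h; have h0 : h != 0 by near: h; exact: nbhs_dnbhs_neq.
  by rewrite /= lf addrK scalerA mulVf// scale1r.
by apply: DeriveDef; [apply/cvg_ex; exists (f u)|exact: cvg_lim qE].
Unshelve. all: by end_near. Qed.

Lemma Ck_linear k U f : linear f -> continuous f -> Ck k U f.
Proof.
move=> lf cf; case: k => [|k]; first by move=> x _; exact: cf.
split=> [x _|x u _|u]; first exact: cf.
  by have [] := is_derive_linear x u lf.
rewrite (_ : 'D_u _ = fun=> f u); first exact: Ck_cst.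
by apply/funext => x; have [_] := is_derive_linear x u lf.
Qed.

End Basic.

Section Scalar.
Context {V : normedModType R}.
Implicit Types (U : set V) (f g : V -> R).

Lemma CkD k U f g : open U -> Ck k U f -> Ck k U g -> Ck k U (fun x => f x + g x).
Proof.
move=> oU; elim: k f g => [|k IH] f g.
  by move=> fc gc x Ux; apply: cvgD; [exact: fc|exact: gc].
move=> [fc fd fD] [gc gd gD]; split.
- by move=> x Ux; apply: cvgD; [exact: fc|exact: gc].
- by move=> x u Ux; apply: derivableD; [exact: fd|exact: gd].
- move=> u; apply: (@Ck_eq _ _ k U (fun x => 'D_u f x + 'D_u g x)) => //.
    by move=> x /set_mem Ux; rewrite /= -deriveD//; [exact: fd|exact: gd].
  exact: (IH _ _ (fD u) (gD u)).
Qed.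

Lemma CkM k U f g : open U -> Ck k U f -> Ck k U g -> Ck k U (fun x => f x * g x).
Proof.
move=> oU; elim: k f g => [|k IH] f g.
  by move=> fc gc x Ux; apply: cvgM; [exact: fc|exact: gc].
move=> fC gC; have [fc fd fD] := fC; have [gc gd gD] := gC; split.
- by move=> x Ux; apply: cvgM; [exact: fc|exact: gc].
- by move=> x u Ux; apply: derivableM; [exact: fd|exact: gd].
- move=> u.
  apply: (@Ck_eq _ _ k U (fun x => f x * 'D_u g x + g x * 'D_u f x : R)) => //.
    by move=> x /set_mem Ux; exact/esym/(deriveM (fd x u Ux) (gd x u Ux)).
  by exact: (CkD oU (IH _ _ (CkW fC) (gD u)) (IH _ _ (CkW gC) (fD u))).
Qed.

Lemma is_derive_chain f (phi : R -> R) x v df dphi :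
  is_derive x v f df -> is_derive (f x) 1 phi dphi ->
  is_derive x v (phi \o f) (dphi * df).
Proof.
move=> [fd <-] phid.
pose g := fun h : R => f (h *: v + x).
have lineE (F : V -> R) : 'D_v F x = 'D_1 (fun h : R => F (h *: v + x)) 0.
  rewrite /derive; set g1 := fun h => h^-1 *: _; set g2 := fun h => h^-1 *: _.
  suff -> : g1 = g2 by []; apply/funext => h; rewrite /g1 /g2 /=.
  by rewrite addr0 scale0r add0r [_%:A]mulr1.
have gd : is_derive (0 : R) 1 g ('D_v f x).
  by rewrite lineE; apply: DeriveDef => //; exact: (derivable1P _ _ _).1 fd.
have phid' : is_derive (g 0) 1 phi dphi by rewrite /g scale0r add0r.
have [cd cE] : is_derive (0 : R) 1 (phi \o g) (dphi * 'D_v f x).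
  exact: is_derive1_comp.
by apply: DeriveDef; [exact: (derivable1P _ _ _).2 cd|rewrite lineE].
Qed.

(** The functions [phi] of interest have a derivative that is built from
    functions of the same family, so this is the step of an induction on [k]. *)
Lemma Ck_chain k U f (phi dphi : R -> R) : open U ->
  (forall x, U x -> is_derive (f x) 1 phi (dphi (f x))) ->
  Ck k.+1 U f -> Ck k U (dphi \o f) -> Ck k.+1 U (phi \o f).
Proof.
move=> oU phid [fc fd fD] dC; split.
- move=> x Ux; apply: continuous_comp; first exact: fc.
  have [+ _] := phid x Ux => /derivable1_diffP; exact: differentiable_continuous.
- move=> x u Ux.
  by have [] := is_derive_chain (derivableP (fd x u Ux)) (phid x Ux).
- move=> u; apply: (@Ck_eq _ _ k U (fun x => (dphi \o f) x * 'D_u f x)) => //.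
    move=> x /set_mem Ux.
    by have [_ ->] := is_derive_chain (derivableP (fd x u Ux)) (phid x Ux).
  exact: (CkM oU dC (fD u)).
Qed.

Lemma CkN k U f : open U -> Ck k U f -> Ck k U (fun x => - f x).
Proof.
move=> oU fC; rewrite (_ : (fun x => _) = (fun x => (fun=> (-1)) x * f x)).
  by apply: CkM => //; exact: Ck_cst.
by apply/funext => x; rewrite mulN1r.
Qed.

Lemma CkB k U f g : open U -> Ck k U f -> Ck k U g -> Ck k U (fun x => f x - g x).
Proof. by move=> oU fC gC; apply: CkD => //; exact: CkN. Qed.

Lemma Ck_sum (I : Type) (r : seq I) (P : pred I) k U (F : I -> V -> R) : open U ->
  (forall i, Ck k U (F i)) -> Ck k U (fun x => \sum_(i <- r | P i) F i x).
Proof.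
move=> oU FC; elim: r => [|i r IH].
  by rewrite (_ : (fun x => _) = fun=> 0); [exact: Ck_cst|apply/funext => x; rewrite big_nil].
case Pi: (P i).
  rewrite (_ : (fun x => _) = fun x => F i x + \sum_(i <- r | P i) F i x).
    exact: CkD.
  by apply/funext => x; rewrite big_cons Pi.
rewrite (_ : (fun x => _) = fun x => \sum_(i <- r | P i) F i x) //.
by apply/funext => x; rewrite big_cons Pi.
Qed.

Lemma CkV k U f : open U -> (forall x, U x -> f x != 0) ->
  Ck k U f -> Ck k U (fun x => (f x)^-1).
Proof.
move=> oU f0; elim: k => [fc x Ux|k IH fC].
  by apply: cvgV; [exact: f0|exact: fc].
have [fc fd fD] := fC; have vC := IH (CkW fC); split.
- by move=> x Ux; apply: cvgV; [exact: f0|exact: fc].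
- by move=> x u Ux; apply: derivableV; [exact: f0|exact: fd].
- move=> u; apply: (@Ck_eq _ _ k U (fun x => - ((f x)^-1 * (f x)^-1) * 'D_u f x : R)) => //.
    move=> x /set_mem Ux; rewrite -expr2 exprVn.
    exact/esym/(deriveV (f0 x Ux) (fd x u Ux)).
  exact: (CkM oU (CkN oU (CkM oU vC vC)) (fD u)).
Qed.

Lemma Ck_sqrt k U f : open U -> (forall x, U x -> 0 < f x) ->
  Ck k U f -> Ck k U (fun x => Num.sqrt (f x)).
Proof.
move=> oU f0; elim: k => [fc x Ux|k IH fC].
  by apply: continuous_comp; [exact: fc|exact: sqrt_continuous].
apply: (@Ck_chain k U f Num.sqrt (fun y => (2 * Num.sqrt y)^-1)) => //.
  by move=> x Ux; apply: is_derive1_sqrt; exact: f0.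
apply: CkV => //= [x Ux|].
  by rewrite mulf_neq0// gt_eqF// sqrtr_gt0; exact: f0.
by apply: CkM; [|exact: Ck_cst|apply: IH; exact: CkW].
Qed.

Lemma Ck_cos_sin k U f : open U -> Ck k U f ->
  Ck k U (fun x => cos (f x)) /\ Ck k U (fun x => sin (f x)).
Proof.
move=> oU; elim: k => [fc|k IH fC].
  by split=> x Ux; apply: continuous_comp;
    do ?[exact: fc|exact: continuous_cos|exact: continuous_sin].
have [cC sC] := IH (CkW fC); split.
  apply: (@Ck_chain k U f cos (fun y => - sin y)) => //.
  exact: (@CkN k U (fun x => sin (f x))).
exact: (@Ck_chain k U f sin cos).
Qed.

Lemma Ck_atan k U f : open U -> Ck k U f -> Ck k U (fun x => atan (f x)).
Proof.
move=> oU; case: k => [fc x Ux|k fC].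
  by apply: continuous_comp; [exact: fc|exact: continuous_atan].
apply: (@Ck_chain k U f atan (fun y => (1 + y ^+ 2)^-1)) => //.
apply: CkV => //= [x _|]; first by rewrite gt_eqF// ltr_pwDl// sqr_ge0.
apply: (@CkD k U (fun=> 1) (fun x => f x * f x)) => //; first exact: Ck_cst.
by apply: CkM => //; exact: CkW.
Qed.

End Scalar.

Section Rows.
Context {V : normedModType R} {p q : nat}.

Lemma continuous_mx (T : topologicalType) (f : T -> 'M[R]_(p, q)) x :
  (forall i j, {for x, continuous (fun y => f y i j)}) -> {for x, continuous f}.
Proof.
move=> fc A [P fP PA]; apply: filterS PA _.
apply: (@filter_forall _ 'I_p) => i; apply: (@filter_forall _ 'I_q) => j.
exact: fc i j _ (fP i j).
Qed.

Lemma Ck_mx k (U : set V) (f : V -> 'M[R]_(p, q)) : open U ->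
  (forall i j, Ck k U (fun x => f x i j)) -> Ck k U f.
Proof.
move=> oU; elim: k f => [|k IH] f fC.
  by move=> x Ux; apply: continuous_mx => i j; exact: fC.
have fd x u : U x -> derivable f x u.
  by move=> Ux; apply/derivable_mxP => i j; have [_ + _] := fC i j; exact.
split=> //.
  by move=> x Ux; apply: continuous_mx => i j; exact: Ck_continuous (fC i j) _.
move=> u; apply: IH => i j.
apply: (@Ck_eq _ _ k U ('D_u (fun x => f x i j))) => //.
  by move=> x /set_mem Ux; rewrite derive_mx ?mxE//; exact: fd.
by have [_ _] := fC i j; exact.
Qed.

End Rows.

End SmoothCalculus.

(** * Dimension of unions of coordinate flats *)

Section FlatDimension.
Context {R : realType} {m : nat}.

Definition flat (S : {set 'I_m}) (c : 'rV[R]_m) : set 'rV[R]_m :=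
  [set y | forall i, i \in S -> y 0 i = c 0 i].

Definition flats (L : seq ({set 'I_m} * 'rV[R]_m)) : set 'rV[R]_m :=
  [set y | exists2 Sc, Sc \in L & flat Sc.1 Sc.2 y].

Lemma below_positives (s : seq R) (e0 : R) : 0 < e0 ->
  exists2 e, 0 < e < e0 & forall x, x \in s -> 0 < x -> e < x.
Proof.
move=> e0_gt0; elim: s => [|x s [e /andP[e_gt0 ee] es]].
  by exists (e0 / 2) => //; rewrite divr_gt0//= ltr_pdivrMr// ltr_pMr// ltr1n.
have [x0|x0] := ltP 0 x; last first.
  exists e; first by rewrite e_gt0.
  move=> y; rewrite inE => /orP[/eqP->|]; last exact: es.
  by rewrite ltNge x0.
have me0 : 0 < Num.min e x by rewrite lt_min e_gt0.
have mle : Num.min e x / 2 < Num.min e x by rewrite ltr_pdivrMr// ltr_pMr// ltr1n.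
exists (Num.min e x / 2).
  rewrite divr_gt0//=; apply: lt_trans ee; apply: lt_le_trans mle _.
  by rewrite ge_min lexx.
move=> y; rewrite inE => /orP[/eqP->|ys y0].
  by move=> _; apply: lt_le_trans mle _; rewrite ge_min lexx orbT.
by apply: lt_trans mle (le_lt_trans _ (es _ ys y0)); rewrite ge_min lexx.
Qed.

(** The intersection of a flat with a face of the cube of centre [x] and
    radius [e]. *)
Definition cut (x : 'rV[R]_m) (e : R) (Sc : {set 'I_m} * 'rV[R]_m) (i : 'I_m) (b : bool) :=
  (i |: Sc.1, \row_j if j == i then x 0 i + (-1) ^+ b * e else Sc.2 0 j).

(** A small ball around [x], in the maximum norm, avoids the hyperplanes
    that carry a flat but not [x]. Its boundary then cuts each flat in flats with one
    more fixed coordinate, and the dimension drops by one. *)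
Lemma dim_lt_flats k (A : set 'rV[R]_m) (L : seq ({set 'I_m} * 'rV[R]_m)) :
  (forall Sc, Sc \in L -> m < k + #|Sc.1|)%N -> A `<=` flats L -> dim_lt k A.
Proof.
elim: k A L => [|k IH] A L Lk AL /=.
  apply/seteqP; split=> // x /AL[[S c] /Lk /=].
  by rewrite add0n => mS; have := max_card (mem S); rewrite card_ord leqNgt mS.
move=> x U Ax oU Ux.
have /nbhs_ballP[e0 /= e0_gt0 ballU] : nbhs x U by exact: open_nbhs_nbhs.
pose bad := [seq `|Sc.2 0 i - x 0 i| | Sc : {set 'I_m} * 'rV[R]_m <- L, i : 'I_m <- enum 'I_m].
have [e /andP[e_gt0 ee] ebad] := below_positives bad e0_gt0.
pose W := ball x e.
have WE y : W y <-> forall i, `|x 0 i - y 0 i| < e.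
  split=> [[_ Wy] i|Wy]; first exact: Wy.
  by split=> // i j; rewrite !ord1; exact: Wy.
exists W; split.
- exact: ball_open.
- exact: ballxx.
- by move=> y xy; apply: ballU; apply: le_ball xy; exact: ltW.
pose L' := [seq cut x e Sc ib.1 ib.2 | Sc <- L, ib <- [seq (i, b) | i <- enum (~: Sc.1), b <- [:: true; false]]].
apply: (IH _ L') => [Sc /allpairsPdep[[S c] [[i b] [ScL /allpairsPdep[i' [b' [iS _ [-> ->]]]] ->]]] /=|].
  rewrite mem_enum inE in iS.
  by have := Lk _ ScL; rewrite cardsU1 iS /= addnA addn1.
move=> y [[Ay clWy] nWy].
have yle i : `|x 0 i - y 0 i| <= e.
  have : closure [set z : 'rV[R]_m | `|x 0 i - z 0 i| <= e] y.
    by apply: closureS clWy => z [_ /WE /(_ i)/ltW].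
  suff /closure_id <- : closed [set z : 'rV[R]_m | `|x 0 i - z 0 i| <= e] by [].
  rewrite (_ : mkset _ = (fun z : 'rV[R]_m => `|x 0 i - z 0 i|) @^-1` [set t | t <= e])//.
  apply: closed_comp => [z _|]; last exact: closed_le.
  have cz : {for z, continuous (fun z0 : 'rV[R]_m => x 0 i - z0 0 i)}.
    by apply: continuousB; [exact: cst_continuous|exact: coord_continuous].
  exact: (continuous_comp cz (@norm_continuous _ _ _)).
have [i yi] : exists i, e <= `|x 0 i - y 0 i|.
  apply: contrapT => /forallNP h; apply: nWy; apply/WE => i.
  by rewrite ltNge; apply/negP/h.
have {}yi : `|x 0 i - y 0 i| = e by apply/eqP; rewrite eq_le yle yi.
have [[S c] ScL Scy] := AL _ Ay.
have iS : i \notin S.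
  apply/negP => iS; have := Scy i iS; rewrite /= => yc.
  have cb : `|c 0 i - x 0 i| \in bad.
    by apply/allpairsP; exists ((S, c), i); rewrite mem_enum.
  by have := ebad _ cb; rewrite -yc distrC yi ltxx => /(_ e_gt0).
pose b := x 0 i - y 0 i >= 0.
exists (cut x e (S, c) i b).
  apply/allpairsPdep; exists (S, c), (i, b); split=> //.
  by apply/allpairsPdep; exists i, b; rewrite mem_enum inE iS; split=> //; case: (b).
move=> j /=; rewrite !inE mxE; case: eqP => [-> _|_ /= jS]; last exact: Scy.
rewrite -yi /b; case: ger0P => h; rewrite ?expr1 ?expr0; ring.
Qed.

End FlatDimension.

(** * Angles and rotations of complex coordinates *)

Section Angles.
Context {R : realType}.
Implicit Types a b x y : R.

Definition tcos a : R := cos (2 * pi * a).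
Definition tsin a : R := sin (2 * pi * a).

Lemma tcosD a b : tcos (a + b) = tcos a * tcos b - tsin a * tsin b.
Proof. by rewrite /tcos mulrDr cosD. Qed.

Lemma tsinD a b : tsin (a + b) = tsin a * tcos b + tcos a * tsin b.
Proof. by rewrite /tsin mulrDr sinD. Qed.

Lemma tcosN a : tcos (- a) = tcos a.
Proof. by rewrite /tcos mulrN cosN. Qed.

Lemma tsinN a : tsin (- a) = - tsin a.
Proof. by rewrite /tsin mulrN sinN. Qed.

Lemma tcos2Dtsin2 a : tcos a ^+ 2 + tsin a ^+ 2 = 1.
Proof. exact: cos2Dsin2. Qed.

Lemma trig_int a : a \is a Num.int -> tcos a = 1 /\ tsin a = 0.
Proof.
have nat_case n : tcos n%:R = 1 /\ tsin n%:R = 0.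
  rewrite /tcos /tsin (_ : 2 * pi * n%:R = 0 + (pi *+ 2) *+ n).
    by rewrite (periodicn (@cosD2pi R)) (periodicn (@sinD2pi R)) cos0 sin0.
  by rewrite add0r -[RHS]mulr_natr -[pi *+ 2]mulr_natl.
move=> /intrP[[n|n] ->] //; first exact: nat_case.
by rewrite NegzE mulrNz tcosN tsinN; have [-> ->] := nat_case n.+1; rewrite oppr0.
Qed.

Lemma tcos_eq1 a : tcos a = 1 -> a \is a Num.int.
Proof.
move=> ca; pose f := a - (Num.floor a)%:~R.
have [ci si] := trig_int (intr_int R (Num.floor a)).
have cf : tcos f = 1 by rewrite tcosD tcosN tsinN ci si ca; ring.
have f01 : 0 <= f < 1.
  by have := floorD1_gt a; have := floor_le a; rewrite intrD /f => ? ?; apply/andP; split; lra.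
have [f0|f0] := eqVneq f 0; first by rewrite (subr0_eq f0) intr_int.
have fgt : 0 < f by rewrite lt_neqAle eq_sym f0; case/andP: f01.
have spos : 0 < sin (pi * f).
  apply: sin_gt0_pi; rewrite mulr_gt0 ?pi_gt0//= -[ltRHS]mulr1 ltr_pM2l ?pi_gt0//.
  by case/andP: f01.
have : tcos f = 1 - 2 * sin (pi * f) ^+ 2.
  rewrite /tcos (_ : 2 * pi * f = pi * f *+ 2); last by rewrite -mulr_natl; ring.
  rewrite cos_mulr2n cos2sin2; ring.
rewrite cf => /eqP; rewrite eq_sym subr_eq addrC -subr_eq subrr eq_sym mulf_eq0 pnatr_eq0/=.
by rewrite sqrf_eq0 gt_eqF.
Qed.

Lemma trig_eq a b : tcos a = tcos b -> tsin a = tsin b -> a - b \is a Num.int.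
Proof.
move=> c s; apply: tcos_eq1; rewrite tcosD tcosN tsinN c s.
by have := tcos2Dtsin2 b; rewrite !expr2 => <-; ring.
Qed.

Lemma arg_ex x y : x ^+ 2 + y ^+ 2 = 1 -> exists a, tcos a = x /\ tsin a = y.
Proof.
move=> xy; have x1 : -1 <= x <= 1.
  by rewrite -ler_norml -sqrtr_sqr -sqrtr1 ler_wsqrtr// -xy lerDl sqr_ge0.
have pi2 : 2 * pi != 0 :> R by rewrite mulf_neq0// gt_eqF// pi_gt0.
have cK : cos (acos x) = x by rewrite acosK// in_itv.
have sK : sin (acos x) = `|y|.
  by rewrite sin_acos// -sqrtr_sqr -xy addrC addKr.
have [y0|y0] := leP 0 y.
  exists (acos x / (2 * pi)); rewrite /tcos /tsin mulrC divfK//.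
  by rewrite cK sK ger0_norm.
exists (- acos x / (2 * pi)); rewrite /tcos /tsin mulrC divfK//.
by rewrite cosN sinN cK sK ltr0_norm// opprK.
Qed.

End Angles.

Section Rotations.
Context {R : realType} {k : nat}.
Implicit Types (a b : 'cV[R]_k) (z w : 'rV[R]_(k + k)).

Fact rot_key : unit. Proof. exact: tt. Qed.

(** Locked, because rotations are handled through their group laws and almost
    never coordinate by coordinate. *)
Definition rot a z : 'rV[R]_(k + k) :=
  locked_with rot_key (torus_act (torus_exp a) z).

Lemma rotE a z : rot a z = torus_act (torus_exp a) z.
Proof. by rewrite /rot unlock. Qed.

Lemma re_of_zcoord (f : 'I_k -> R[i]) j : re (of_zcoord f) j = complex.Re (f j).
Proof. by rewrite /re /of_zcoord row_mxEl mxE. Qed.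

Lemma im_of_zcoord (f : 'I_k -> R[i]) j : im (of_zcoord f) j = complex.Im (f j).
Proof. by rewrite /im /of_zcoord row_mxEr mxE. Qed.

Lemma zcoord_ext z w :
  (forall j, re z j = re w j) -> (forall j, im z j = im w j) -> z = w.
Proof.
move=> rE iE; apply/rowP => i; case: (splitP i) => j ij.
  by rewrite (_ : i = lshift k j); [exact: rE|exact: val_inj].
by rewrite (_ : i = rshift k j); [exact: iE|exact: val_inj].
Qed.

Lemma re_rot a z j : re (rot a z) j = tcos (a j 0) * re z j - tsin (a j 0) * im z j.
Proof. by rewrite rotE re_of_zcoord mxE. Qed.

Lemma im_rot a z j : im (rot a z) j = tcos (a j 0) * im z j + tsin (a j 0) * re z j.
Proof. by rewrite rotE im_of_zcoord mxE. Qed.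

Lemma reD z w j : re (z + w) j = re z j + re w j. Proof. by rewrite /re mxE. Qed.
Lemma imD z w j : im (z + w) j = im z j + im w j. Proof. by rewrite /im mxE. Qed.
Lemma reZ (c : R) z j : re (c *: z) j = c * re z j. Proof. by rewrite /re mxE. Qed.
Lemma imZ (c : R) z j : im (c *: z) j = c * im z j. Proof. by rewrite /im mxE. Qed.

Lemma sqabs_ge0 z j : 0 <= sqabs z j.
Proof. by rewrite addr_ge0 ?sqr_ge0. Qed.

Lemma sqabs_rot a z j : sqabs (rot a z) j = sqabs z j.
Proof.
rewrite /sqabs re_rot im_rot -[RHS]mul1r -(tcos2Dtsin2 (a j 0)); ring.
Qed.

Lemma dot_rot a z w j :
  re (rot a z) j * re (rot a w) j + im (rot a z) j * im (rot a w) j =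
  re z j * re w j + im z j * im w j.
Proof.
rewrite !re_rot !im_rot -[RHS]mul1r -(tcos2Dtsin2 (a j 0)); ring.
Qed.

Lemma dot_rot_pos a z w j : im (rot a z) j = 0 ->
  re z j * re w j + im z j * im w j = re (rot a z) j * re (rot a w) j.
Proof. by move=> i0; rewrite -(dot_rot a z w j) i0 mul0r addr0. Qed.

Lemma rotD a b z : rot (a + b) z = rot a (rot b z).
Proof.
apply: zcoord_ext => j; rewrite !(re_rot, im_rot) mxE tcosD tsinD; ring.
Qed.

Lemma rot_int_coord a z j : a j 0 \is a Num.int ->
  re (rot a z) j = re z j /\ im (rot a z) j = im z j.
Proof. by move=> /trig_int[c s]; rewrite re_rot im_rot c s; split; ring. Qed.

Lemma rot_int a z : (forall j, a j 0 \is a Num.int) -> rot a z = z.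
Proof.
by move=> aint; apply: zcoord_ext => j; have [] := rot_int_coord z (aint j).
Qed.

Lemma rot0 z : rot 0 z = z.
Proof. by apply: rot_int => j; rewrite mxE. Qed.

Lemma rotK a : cancel (rot a) (rot (- a)).
Proof. by move=> z; rewrite -rotD addNr rot0. Qed.

Lemma rotNK a : cancel (rot (- a)) (rot a).
Proof. by move=> z; rewrite -rotD subrr rot0. Qed.

Lemma torus_expP a b :
  torus_exp a = torus_exp b <-> forall j, a j 0 - b j 0 \is a Num.int.
Proof.
split=> [/colP ab j|ab].
  by have := ab j; rewrite !mxE => -[]; exact: trig_eq.
have aE j : a j 0 = (a j 0 - b j 0) + b j 0 by rewrite subrK.
apply/colP => j; rewrite !mxE; have [c s] := trig_int (ab j).
congr Complex.
  by rewrite -[LHS]/(tcos (a j 0)) -[RHS]/(tcos (b j 0)) aE tcosD c s; ring.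
by rewrite -[LHS]/(tsin (a j 0)) -[RHS]/(tsin (b j 0)) aE tsinD c s; ring.
Qed.

Lemma rot_linear a : linear (rot a).
Proof.
move=> c z w; apply: zcoord_ext => j.
  by rewrite !(re_rot, reD, reZ, imD, imZ); ring.
by rewrite !(im_rot, reD, reZ, imD, imZ); ring.
Qed.

End Rotations.

(** * Linear relations and the level set *)

Section Relations.
Context {R : realType} {d n : nat} (v : 'I_n -> 'cV[R]_d).
Implicit Types (a b : 'cV[R]_n).

Definition colmx : 'M[R]_(d, n) := \matrix_(r, j) v j r 0.

Lemma lincombE a : lincomb v a = colmx *m a.
Proof.
apply/colP => r; rewrite summxE mxE; apply: eq_bigr => j _.
by rewrite !mxE mulrC.
Qed.

Lemma lincombD a b : lincomb v (a + b) = lincomb v a + lincomb v b.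
Proof. by rewrite !lincombE mulmxDr. Qed.

Lemma lincombN a : lincomb v (- a) = - lincomb v a.
Proof. by rewrite !lincombE mulmxN. Qed.

Lemma lincombB a b : lincomb v (a - b) = lincomb v a - lincomb v b.
Proof. by rewrite lincombD lincombN. Qed.

Lemma lincombZ c a : lincomb v (c *: a) = c *: lincomb v a.
Proof. by rewrite !lincombE scalemxAr. Qed.

Lemma pairing_lincomb (mu : 'rV[R]_d) a :
  pairing mu (lincomb v a) = \sum_j pairing mu (v j) * a j 0.
Proof.
rewrite /pairing /lincomb mulmx_sumr summxE; apply: eq_bigr => j _.
by rewrite -scalemxAr mxE mulrC.
Qed.

Variable l : 'I_n -> R.

(** The relations among the [v j] cut out the row space of their matrix, which
    is why the level set maps to the dual of R^d. *)
Lemma levelP z : level v l z <->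
  exists mu, forall j, sqabs z j + l j = pairing mu (v j).
Proof.
split=> [zl|[mu muE] a va]; last first.
  rewrite /Psi (eq_bigr (fun j => pairing mu (v j) * a j 0)).
    by rewrite -pairing_lincomb va /pairing mulmx0 mxE.
  by move=> j _; rewrite muE.
pose s : 'rV[R]_n := \row_j (sqabs z j + l j).
have /submxP[mu sE] : (s <= colmx)%MS.
  rewrite submxE; apply/eqP/rowP => i; rewrite !mxE.
  have : Rel v (col i (cokermx colmx)).
    by rewrite /Rel/= lincombE colE mulmxA mulmx_coker mul0mx.
  move=> /zl; rewrite /Psi => e; rewrite -[RHS]e.
  by apply: eq_bigr => j _; rewrite !mxE.
exists mu => j; have /rowP/(_ j) := sE; rewrite mxE => ->; rewrite /pairing !mxE.
by apply: eq_bigr => r _; rewrite mxE.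
Qed.

Lemma level_rot a z : level v l z -> level v l (rot a z).
Proof.
by move=> /levelP[mu muE]; apply/levelP; exists mu => j; rewrite sqabs_rot.
Qed.

End Relations.

(** * Charts at the vertices *)

Section Charts.
Context {R : realType} {d n : nat} {v : 'I_n -> 'cV[R]_d} {l : 'I_n -> R}.
Implicit Types (nu : vertex_index v l) (mu : 'rV[R]_d) (z : 'rV[R]_(d + d))
  (y : 'rV[R]_(n + n)) (b c : 'cV[R]_d) (a : 'cV[R]_n).

Definition vmx nu : 'M[R]_d := \matrix_(r, k) v (enumI nu k) r 0.

Definition inI nu (j : 'I_n) : bool := [exists k, enumI nu k == j].

Definition coords nu (x : 'cV[R]_d) : 'cV[R]_d := invmx (vmx nu) *m x.

Definition emb nu c : 'cV[R]_n :=
  \col_j (if [pick k | enumI nu k == j] is Some k then c k 0 else 0).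

Definition restrc nu a : 'cV[R]_d := \col_k a (enumI nu k) 0.

Definition restr nu y : 'rV[R]_(d + d) := of_zcoord (fun k => zcoord y (enumI nu k)).

Definition mask nu a : 'cV[R]_n := \col_j (if inI nu j then 0 else a j 0).

(** The relation among the [v j] whose coefficients off the vertex are those of
    [a]. *)
Definition ext nu a : 'cV[R]_n :=
  mask nu a - emb nu (coords nu (lincomb v (mask nu a))).

(** The image of the section of the chart, described without the section. *)
Definition slice nu y : Prop :=
  level v l y /\ forall j, ~~ inI nu j -> 0 < re y j /\ im y j = 0.

Lemma inIP nu j : reflect (exists k, enumI nu k = j) (inI nu j).
Proof. by apply: (iffP existsP) => -[k /eqP]; exists k => //; apply/eqP. Qed.

Lemma inI_enum nu k : inI nu (enumI nu k).
Proof. by apply/inIP; exists k. Qed.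

Lemma inI_active nu j : inI nu j <-> pairing (vtx nu) (v j) = l j.
Proof. by rewrite -enumIP; split=> /inIP. Qed.

Lemma notinIP nu j : ~~ inI nu j <-> forall k, enumI nu k <> j.
Proof.
split=> [/inIP h k kj|h]; first by apply: h; exists k.
by apply/inIP => -[k]; exact: h.
Qed.

Lemma enumI_inj nu : injective (enumI nu).
Proof.
move=> i j ij; apply/val_inj/eqP; case: ltngtP => // /(@enumI_incr _ _ _ _ _ nu).
  by rewrite ij ltnn.
by rewrite ij ltnn.
Qed.

Lemma pick_enum nu k : [pick k' | enumI nu k' == enumI nu k] = Some k.
Proof.
case: pickP => [k' /eqP/enumI_inj->//|/(_ k)].
by rewrite eqxx.
Qed.

Lemma pick_out nu j : ~~ inI nu j -> [pick k | enumI nu k == j] = None.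
Proof.
move=> /notinIP jI; case: pickP => // k /eqP kj.
by have := jI k; rewrite kj.
Qed.

Lemma emb_in nu c k : emb nu c (enumI nu k) 0 = c k 0.
Proof. by rewrite mxE pick_enum. Qed.

Lemma emb_out nu c j : ~~ inI nu j -> emb nu c j 0 = 0.
Proof. by move=> jI; rewrite mxE pick_out. Qed.

Lemma restrc_emb nu c : restrc nu (emb nu c) = c.
Proof. by apply/colP => k; rewrite mxE emb_in. Qed.

Lemma emb_restrc nu a : (forall j, ~~ inI nu j -> a j 0 = 0) -> emb nu (restrc nu a) = a.
Proof.
move=> a0; apply/colP => j; case: (boolP (inI nu j)) => [/inIP[k <-]|jI].
  by rewrite emb_in mxE.
by rewrite emb_out// a0.
Qed.

Lemma lincomb_emb nu c : lincomb v (emb nu c) = vmx nu *m c.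
Proof.
apply/colP => r; rewrite summxE mxE.
rewrite (bigID (mem (enumI nu @: 'I_d)))/= [X in _ + X]big1 ?addr0; last first.
  move=> j /negP jI; rewrite mxE emb_out ?mul0r//.
  by apply/notinIP => k kj; apply: jI; rewrite -kj imset_f.
rewrite big_imset/=; last by move=> ? ? _ _; exact: enumI_inj.
by apply: eq_bigr => k _; rewrite mxE emb_in !mxE mulrC.
Qed.

Lemma re_section_in nu z k : re (chart_section nu z) (enumI nu k) = re z k.
Proof. by rewrite re_of_zcoord pick_enum. Qed.

Lemma im_section_in nu z k : im (chart_section nu z) (enumI nu k) = im z k.
Proof. by rewrite im_of_zcoord pick_enum. Qed.

Lemma re_section_out nu z j : ~~ inI nu j ->
  re (chart_section nu z) j = Num.sqrt (pairing (chart_mu nu z) (v j) - l j).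
Proof. by move=> jI; rewrite re_of_zcoord pick_out. Qed.

Lemma im_section_out nu z j : ~~ inI nu j -> im (chart_section nu z) j = 0.
Proof. by move=> jI; rewrite im_of_zcoord pick_out. Qed.

Lemma re_restr nu y k : re (restr nu y) k = re y (enumI nu k).
Proof. by rewrite re_of_zcoord. Qed.

Lemma im_restr nu y k : im (restr nu y) k = im y (enumI nu k).
Proof. by rewrite im_of_zcoord. Qed.

Lemma sqabs_restr nu y k : sqabs (restr nu y) k = sqabs y (enumI nu k).
Proof. by rewrite /sqabs re_restr im_restr. Qed.

Lemma restr_section nu z : restr nu (chart_section nu z) = z.
Proof.
by apply: zcoord_ext => k; rewrite (re_restr, im_restr) (re_section_in, im_section_in).
Qed.

Lemma restr_rot nu a y : restr nu (rot a y) = rot (restrc nu a) (restr nu y).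
Proof.
apply: zcoord_ext => k; first by rewrite re_restr !re_rot re_restr im_restr mxE.
by rewrite im_restr !im_rot re_restr im_restr mxE.
Qed.

Lemma chart_domP nu z : chart_dom nu z <->
  forall j, ~~ inI nu j -> l j < pairing (chart_mu nu z) (v j).
Proof. by split=> h j; [move/notinIP|move/notinIP]; exact: h. Qed.

Lemma chart_mu_sqabs nu z z' :
  (forall k, sqabs z k = sqabs z' k) -> chart_mu nu z = chart_mu nu z'.
Proof.
by move=> e; congr (_ *m _); apply/rowP => k; rewrite !mxE e.
Qed.

Lemma chart_mu_rot nu b z : chart_mu nu (rot b z) = chart_mu nu z.
Proof. by apply: chart_mu_sqabs => k; rewrite sqabs_rot. Qed.

Lemma chart_dom_rot nu b z : chart_dom nu (rot b z) <-> chart_dom nu z.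
Proof. by rewrite /chart_dom /= chart_mu_rot. Qed.

Lemma section_rot nu a z : (forall j, ~~ inI nu j -> a j 0 \is a Num.int) ->
  chart_section nu (rot (restrc nu a) z) = rot a (chart_section nu z).
Proof.
move=> aI; apply: zcoord_ext => j; case: (boolP (inI nu j)) => [/inIP[k <-]|jI].
- by rewrite re_section_in !re_rot re_section_in im_section_in mxE.
- have [-> _] := rot_int_coord (chart_section nu z) (aI j jI).
  by rewrite !re_section_out// chart_mu_rot.
- by rewrite im_section_in !im_rot re_section_in im_section_in mxE.
- have [_ ->] := rot_int_coord (chart_section nu z) (aI j jI).
  by rewrite !im_section_out.
Qed.

Lemma section_rot_emb nu b z :
  chart_section nu (rot b z) = rot (emb nu b) (chart_section nu z).
Proof.
rewrite -{1}(restrc_emb nu b); apply: section_rot => j jI.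
by rewrite emb_out.
Qed.

Section Basis.
Variable nu : vertex_index v l.
Hypothesis basis : vmx nu \in unitmx.

Lemma coordsK x : vmx nu *m coords nu x = x.
Proof. by rewrite /coords mulKVmx. Qed.

Lemma mulmx_vmx mu k : (mu *m vmx nu) 0 k = pairing mu (v (enumI nu k)).
Proof. by rewrite /pairing !mxE; apply: eq_bigr => r _; rewrite mxE. Qed.

Lemma chart_mu_in z k : pairing (chart_mu nu z) (v (enumI nu k)) = sqabs z k + l (enumI nu k).
Proof.
have -> : sqabs z k + l (enumI nu k) = (chart_mu nu z *m vmx nu) 0 k.
  by rewrite /chart_mu mulmxKV// mxE.
by rewrite mulmx_vmx.
Qed.

Lemma pairing_inj mu mu' :
  (forall k, pairing mu (v (enumI nu k)) = pairing mu' (v (enumI nu k))) -> mu = mu'.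
Proof.
move=> e; apply: (can_inj (mulmxK basis)); apply/rowP => k.
by rewrite !mulmx_vmx.
Qed.

Lemma section_sqabs z j : chart_dom nu z ->
  sqabs (chart_section nu z) j + l j = pairing (chart_mu nu z) (v j).
Proof.
move=> /chart_domP zd; case: (boolP (inI nu j)) => [/inIP[k <-]|jI].
  by rewrite chart_mu_in /sqabs re_section_in im_section_in.
rewrite /sqabs re_section_out// im_section_out// expr0n addr0 sqr_sqrtr ?subrK//.
by rewrite subr_ge0 ltW// zd.
Qed.

Lemma section_slice z : chart_dom nu z -> slice nu (chart_section nu z).
Proof.
move=> zd; split=> [|j jI].
  by apply/levelP; exists (chart_mu nu z) => j; rewrite section_sqabs.
rewrite re_section_out// im_section_out// sqrtr_gt0 subr_gt0; split=> //.
by move/chart_domP: zd; exact.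
Qed.

Lemma restr_mu y mu : (forall j, sqabs y j + l j = pairing mu (v j)) ->
  chart_mu nu (restr nu y) = mu.
Proof.
by move=> yE; apply: pairing_inj => k; rewrite chart_mu_in sqabs_restr yE.
Qed.

Lemma slice_section y : slice nu y ->
  chart_dom nu (restr nu y) /\ chart_section nu (restr nu y) = y.
Proof.
move=> [/levelP[mu yE] yI]; have muE := restr_mu yE; split.
  apply/chart_domP => j jI; rewrite muE -yE ltrDr /sqabs.
  by have [y0 ->] := yI j jI; rewrite expr0n addr0 exprn_gt0.
apply: zcoord_ext => j; case: (boolP (inI nu j)) => [/inIP[k <-]|jI].
- by rewrite re_section_in re_restr.
- rewrite re_section_out// muE -yE addrK /sqabs; have [y0 ->] := yI j jI.
  by rewrite expr0n addr0 sqrtr_sqr gtr0_norm.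
- by rewrite im_section_in im_restr.
- by rewrite im_section_out//; have [_ ->] := yI j jI.
Qed.

Lemma lincomb_ext a : lincomb v (ext nu a) = 0.
Proof. by rewrite lincombB lincomb_emb coordsK subrr. Qed.

Lemma ext_out a j : ~~ inI nu j -> ext nu a j 0 = a j 0.
Proof.
by move=> jI; rewrite 2!mxE (negbTE jI) [X in _ + X]mxE emb_out// oppr0 addr0.
Qed.

Lemma rel_inj a : lincomb v a = 0 -> (forall j, ~~ inI nu j -> a j 0 = 0) -> a = 0.
Proof.
move=> va a0; rewrite -(emb_restrc a0) lincomb_emb in va.
have r0 : restrc nu a = 0 by rewrite -(mulKmx basis (restrc nu a)) va mulmx0.
rewrite -(emb_restrc a0) r0; apply/colP => j; rewrite !mxE.
by case: pickP => // k; rewrite mxE.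
Qed.

End Basis.

End Charts.

(** * Smoothness of the sections, rotations and straightenings *)

Section SmoothCoordinates.
Context {R : realType}.

Section Families.
Context {V : normedModType R} (k : nat) (U : set V).
Hypothesis oU : open U.

Definition zCk {p : nat} (Z : V -> 'rV[R]_(p + p)) : Prop :=
  forall j, Ck k U (fun x => re (Z x) j) /\ Ck k U (fun x => im (Z x) j).

Definition vCk {p : nat} (a : V -> 'cV[R]_p) : Prop :=
  forall j, Ck k U (fun x => a x j 0).

Lemma zCk_Ck p (Z : V -> 'rV[R]_(p + p)) : zCk Z -> Ck k U Z.
Proof.
move=> ZC; apply: Ck_mx => // i j; rewrite ord1; case: (splitP j) => r jr.
  by rewrite (_ : j = lshift p r); [have [] := ZC r|exact: val_inj].
by rewrite (_ : j = rshift p r); [have [] := ZC r|exact: val_inj].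
Qed.

Lemma vCk_Ck p (a : V -> 'cV[R]_p) : vCk a -> Ck k U a.
Proof. by move=> aC; apply: Ck_mx => // i j; rewrite ord1; exact: aC. Qed.

Lemma vCk_cst p (a : 'cV[R]_p) : vCk (fun=> a).
Proof. by move=> j; exact: Ck_cst. Qed.

Lemma vCk_linear p q (f : 'cV[R]_p -> 'cV[R]_q) (a : V -> 'cV[R]_p) :
  linear f -> vCk a -> vCk (fun x => f (a x)).
Proof.
move=> lf aC j.
pose fM := GRing.isLinear.Build R _ _ _ f lf.
pose g : {linear 'cV[R]_p -> 'cV[R]_q} := HB.pack f fM.
rewrite (_ : (fun x => f (a x) j 0) = fun x => \sum_i a x i 0 * f (delta_mx i 0) j 0).
  apply: Ck_sum => // i.
  exact: (CkM oU (aC i) (Ck_cst k U (f (delta_mx i 0) j 0))).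
apply/funext => x; rewrite -[f]/(g : _ -> _) {1}(matrix_sum_delta (a x)) linear_sum summxE.
by apply: eq_bigr => i _; rewrite big_ord1 linearZ mxE.
Qed.

Lemma vCkD p (a b : V -> 'cV[R]_p) : vCk a -> vCk b -> vCk (fun x => a x + b x).
Proof.
move=> aC bC j; rewrite (_ : (fun x => _) = fun x => a x j 0 + b x j 0).
  exact: (CkD oU (aC j) (bC j)).
by apply/funext => x; rewrite mxE.
Qed.

Lemma Ck_trig (f : V -> R) : Ck k U f ->
  Ck k U (fun x => tcos (f x)) /\ Ck k U (fun x => tsin (f x)).
Proof. by move=> fC; apply: Ck_cos_sin => //; exact: (CkM oU (Ck_cst k U (2 * pi)) fC). Qed.

Lemma zCk_rot p (a : V -> 'cV[R]_p) (Z : V -> 'rV[R]_(p + p)) :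
  vCk a -> zCk Z -> zCk (fun x => rot (a x) (Z x)).
Proof.
move=> aC ZC j; have [cC sC] := Ck_trig (aC j); have [rC iC] := ZC j.
split.
  rewrite (_ : (fun x => _) = fun x => tcos (a x j 0) * re (Z x) j - tsin (a x j 0) * im (Z x) j).
    exact: (CkB oU (CkM oU cC rC) (CkM oU sC iC)).
  by apply/funext => x; rewrite re_rot.
rewrite (_ : (fun x => _) = fun x => tcos (a x j 0) * im (Z x) j + tsin (a x j 0) * re (Z x) j).
  exact: (CkD oU (CkM oU cC iC) (CkM oU sC rC)).
by apply/funext => x; rewrite im_rot.
Qed.

Lemma Ck_sqabs p (Z : V -> 'rV[R]_(p + p)) j : zCk Z -> Ck k U (fun x => sqabs (Z x) j).
Proof.
by move=> ZC; have [rC iC] := ZC j; exact: (CkD oU (CkM oU rC rC) (CkM oU iC iC)).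
Qed.

Context {d n : nat} {v : 'I_n -> 'cV[R]_d} {l : 'I_n -> R}.
Implicit Types nu : vertex_index v l.

Lemma Ck_chart_mu_coord nu (Z : V -> 'rV[R]_(d + d)) r : zCk Z ->
  Ck k U (fun x => chart_mu nu (Z x) 0 r).
Proof.
move=> ZC; rewrite (_ : (fun x => _) = fun x =>
    \sum_i (sqabs (Z x) i + l (enumI nu i)) * invmx (vmx nu) i r).
  apply: Ck_sum => // i.
  apply: (CkM oU _ (Ck_cst k U (invmx (vmx nu) i r))).
  exact: (CkD oU (Ck_sqabs i ZC) (Ck_cst k U (l (enumI nu i)))).
by apply/funext => x; rewrite mxE; apply: eq_bigr => i _; rewrite mxE.
Qed.

Lemma Ck_pairing_mu nu (Z : V -> 'rV[R]_(d + d)) (w : 'cV[R]_d) : zCk Z ->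
  Ck k U (fun x => pairing (chart_mu nu (Z x)) w).
Proof.
move=> ZC; rewrite (_ : (fun x => _) = fun x => \sum_r chart_mu nu (Z x) 0 r * w r 0).
  apply: Ck_sum => // r.
  exact: (CkM oU (Ck_chart_mu_coord nu r ZC) (Ck_cst k U (w r 0))).
by apply/funext => x; rewrite /pairing mxE.
Qed.

Lemma zCk_section nu (Z : V -> 'rV[R]_(d + d)) : zCk Z ->
  (forall x, U x -> chart_dom nu (Z x)) -> zCk (fun x => chart_section nu (Z x)).
Proof.
move=> ZC Zd j; case: (boolP (inI nu j)) => [/inIP[i <-]|jI].
  have [rC iC] := ZC i; split.
    by rewrite (_ : (fun x => _) = fun x => re (Z x) i)//; apply/funext => x; rewrite re_section_in.
  by rewrite (_ : (fun x => _) = fun x => im (Z x) i)//; apply/funext => x; rewrite im_section_in.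
split; last first.
  rewrite (_ : (fun x => _) = fun=> 0); first exact: Ck_cst.
  by apply/funext => x; rewrite im_section_out.
rewrite (_ : (fun x => _) = fun x => Num.sqrt (pairing (chart_mu nu (Z x)) (v j) - l j)).
  apply: Ck_sqrt => //.
    by move=> x Ux; rewrite subr_gt0; move: (Zd x Ux) => /chart_domP; exact.
  exact: (CkB oU (Ck_pairing_mu nu (v j) ZC) (Ck_cst k U (l j))).
by apply/funext => x; rewrite re_section_out.
Qed.

Lemma zCk_restr nu (Y : V -> 'rV[R]_(n + n)) : zCk Y -> zCk (fun x => restr nu (Y x)).
Proof.
move=> YC i; have [rC iC] := YC (enumI nu i); split.
  by rewrite (_ : (fun x => _) = fun x => re (Y x) (enumI nu i))//; apply/funext => x; rewrite re_restr.
by rewrite (_ : (fun x => _) = fun x => im (Y x) (enumI nu i))//; apply/funext => x; rewrite im_restr.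
Qed.

(** Minus the argument, in turns, of a coordinate in the right half-plane. *)
Definition ang (p : nat) (y : 'rV[R]_(p + p)) : 'cV[R]_p :=
  \col_j (- (atan (im y j / re y j) * (2 * pi)^-1)).

(** Only the coordinates off the vertex have to be made positive; the factor
    [if] makes this depend on these coordinates alone. *)
Definition off_ang nu (y : 'rV[R]_(n + n)) : 'cV[R]_n :=
  \col_j (if inI nu j then 0 else ang y j 0).

Lemma vCk_off_ang nu (Y : V -> 'rV[R]_(n + n)) : zCk Y ->
  (forall x, U x -> forall j, ~~ inI nu j -> 0 < re (Y x) j) ->
  vCk (fun x => off_ang nu (Y x)).
Proof.
move=> YC Y0 j; case: (boolP (inI nu j)) => jI.
  rewrite (_ : (fun x => _) = fun=> 0); first exact: Ck_cst.
  by apply/funext => x; rewrite mxE jI.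
have [rC iC] := YC j.
rewrite (_ : (fun x => _) = fun x => - (atan (im (Y x) j * (re (Y x) j)^-1) * (2 * pi)^-1)).
  apply: (CkN oU (CkM oU (Ck_atan oU (CkM oU iC (CkV oU _ rC))) (Ck_cst k U (2 * pi)^-1))).
  by move=> x Ux; rewrite gt_eqF// Y0.
by apply/funext => x; rewrite mxE (negbTE jI) mxE.
Qed.

End Families.

Section Straight.
Context {d n : nat} {v : 'I_n -> 'cV[R]_d} {l : 'I_n -> R}.
Implicit Types nu : vertex_index v l.

Lemma ang_small p (y : 'rV[R]_(p + p)) j : `|ang y j 0| < 4^-1.
Proof.
rewrite mxE normrN normrM [X in _ * X]ger0_norm; last first.
  by rewrite invr_ge0 mulr_ge0// pi_ge0.
have p0 : 0 < pi :> R := pi_gt0 R.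
rewrite ltr_pdivrMr ?mulr_gt0//.
rewrite (_ : 4^-1 * (2 * pi) = pi / 2); last by field.
by rewrite ltr_norml atan_gtNpi2 atan_ltpi2.
Qed.

Lemma off_ang_small nu y j : `|off_ang nu y j 0| < 4^-1.
Proof. by rewrite mxE; case: ifP; rewrite ?normr0 ?invr_gt0// ang_small. Qed.

Lemma ang0 p (y : 'rV[R]_(p + p)) j : im y j = 0 -> ang y j 0 = 0.
Proof. by move=> y0; rewrite mxE y0 mul0r atan0 mul0r oppr0. Qed.

Lemma rot_ang p (y : 'rV[R]_(p + p)) (a : 'cV[R]_p) j : a j 0 = ang y j 0 ->
  0 < re y j -> 0 < re (rot a y) j /\ im (rot a y) j = 0.
Proof.
move=> aE y0; rewrite re_rot im_rot aE.
pose q := im y j / re y j.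
have c0 : 0 < cos (atan q) by rewrite cos_atan invr_gt0 sqrtr_gt0 ltr_pwDl// sqr_ge0.
have sE : sin (atan q) = q * cos (atan q).
  by rewrite -{2}(atanK q) /tan divfK// gt_eqF.
have pi2 : 2 * pi != 0 :> R by rewrite mulf_neq0// gt_eqF// pi_gt0.
have aE' : 2 * pi * ang y j 0 = - atan q by rewrite mxE mulrN mulrC divfK.
have -> : tcos (ang y j 0) = cos (atan q) by rewrite /tcos aE' cosN.
have -> : tsin (ang y j 0) = - (q * cos (atan q)) by rewrite /tsin aE' sinN sE.
have iE : im y j = q * re y j by rewrite divfK// gt_eqF.
rewrite iE; split; last by ring.
rewrite (_ : _ - _ = cos (atan q) * re y j * (1 + q ^+ 2)); last by ring.
by rewrite !mulr_gt0// ltr_pwDl// sqr_ge0.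
Qed.

(** A retraction onto the slice of the points of the level set whose coordinates
    off the vertex have positive real part. The correction by [ext] makes it a rotation
    by a relation, so that it stays in the orbit. *)
Definition straight nu (y : 'rV[R]_(n + n)) := rot (ext nu (off_ang nu y)) y.

Lemma slice_straight nu y : vmx nu \in unitmx -> level v l y ->
  (forall j, ~~ inI nu j -> 0 < re y j) -> slice nu (straight nu y).
Proof.
move=> basis yl y0; split=> [|j jI]; first exact: level_rot.
by apply: rot_ang; rewrite ?y0// ext_out// mxE (negbTE jI).
Qed.

Lemma ext_linear nu : linear (ext nu).
Proof.
move=> c a b; rewrite /ext.
have mE : mask nu (c *: a + b) = c *: mask nu a + mask nu b.
  by apply/colP => j; rewrite !mxE; case: ifP; rewrite ?mulr0 ?addr0.
have eE x y : emb nu (c *: x + y) = c *: emb nu x + emb nu y.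
  by apply/colP => j; rewrite !mxE; case: pickP => [i _|_]; rewrite ?mxE ?mulr0 ?addr0.
rewrite mE lincombD lincombZ /coords mulmxDr -scalemxAr eE.
by rewrite scalerBr opprD addrACA.
Qed.

End Straight.

End SmoothCoordinates.

(** * Topological preliminaries *)

Section TopologyFacts.

Lemma open_set_typeP (T : topologicalType) (E : set T) (S : set E) :
  open S <-> exists2 A : set T, open A & S = set_val @^-1` A.
Proof. by split=> -[A oA AE]; exists A. Qed.

Lemma open_set_type_near (T : topologicalType) (E : set T) (S : set E) :
  (forall x, S x -> exists A : set T, [/\ open A, A (set_val x) & set_val @^-1` A `<=` S]) ->
  open S.
Proof.
move=> SA; rewrite openE => x /SA[A [oA Ax AS]].
rewrite /interior nbhsE /=; exists (set_val @^-1` A) => //; split => //.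
by apply/open_set_typeP; exists A.
Qed.

Lemma connected_set_type (T : topologicalType) (E : set T) :
  connected E -> connected [set: E].
Proof.
move=> cE B [x Bx] [C1 oC1 BE1] [C2 cC2 BE2]; rewrite setTI in BE1; rewrite setTI in BE2.
have /open_set_typeP[A1 oA1 C1E] := oC1.
have /open_set_typeP[A2 oA2 C2E] : open (~` C2) by exact: closed_openC.
have BA1 y : B y <-> A1 (set_val y) by rewrite BE1 C1E.
have BA2 y : B y <-> ~ A2 (set_val y).
  by rewrite -[A2 _]/((set_val @^-1` A2) y) -C2E -BE2 /setC/= notK.
have EA : E `&` A1 = E.
  apply: cE; first by exists (set_val x); split; [exact: set_valP|exact/BA1].
    by exists A1.
  exists (~` A2); first exact: open_closedC.
  apply/seteqP; split=> y [Ey Ay]; split=> //; pose y' : E := exist _ y (mem_set Ey).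
    by apply: (BA2 y').1; apply/BA1.
  by apply: (BA1 y').1; apply/BA2.
apply/seteqP; split=> // y _; apply/BA1.
have EA1 t : E t -> A1 t by rewrite -{1}EA => -[].
by apply: EA1; exact: set_valP.
Qed.

Lemma connected_paths (R : realType) (T : topologicalType) (A : set T) (x0 : T) :
  (forall x, A x -> exists f : R -> T, [/\ continuous f, f 0 = x0, f 1 = x &
     forall t, 0 <= t <= 1 -> A (f t)]) -> connected A.
Proof.
move=> Apath; have [f fP] := choice (fun x : T => 
  match pselect (A x) return exists f : R -> T, A x -> [/\ continuous f, f 0 = x0, f 1 = x &
     forall t, 0 <= t <= 1 -> A (f t)] with
  | left Ax => let: ex_intro f fP := Apath x Ax in ex_intro _ f (fun=> fP)
  | right nAx => ex_intro _ (fun=> x) (fun Ax => False_ind _ (nAx Ax)) end).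
have -> : A = \bigcup_(x in A) (f x @` `[0, 1]).
  apply/seteqP; split=> [x Ax|x [y Ay [t t01 <-]]].
    exists x => //; exists 1; first by rewrite /= in_itv/= ler01 lexx.
    by have [] := fP x Ax.
  by have [_ _ _] := fP y Ay; apply; rewrite /= in_itv in t01.
apply: bigcup_connected => [|x Ax].
  exists x0 => x Ax; exists 0; first by rewrite /= in_itv/= ler01 lexx.
  by have [] := fP x Ax.
apply: connected_continuous_connected; first exact: segment_connected.
by have [fc _ _ _] := fP x Ax; exact: continuous_subspaceT.
Qed.

Lemma open_preimage (T U : topologicalType) (D : set T) (f : T -> U) (A : set U) :
  open D -> (forall x, D x -> {for x, continuous f}) -> open A ->
  open (D `&` f @^-1` A).
Proof.
move=> oD fc oA; rewrite openE => x [Dx Ax].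
apply: filterI; first by apply: open_nbhs_nbhs.
by apply: fc => //; exact: open_nbhs_nbhs.
Qed.

Lemma open_gt0 (R : realType) (T : topologicalType) (D : set T) (I : finType) (P : pred I)
    (f : I -> T -> R) : open D -> (forall i x, D x -> {for x, continuous (f i)}) ->
  open (D `&` [set x | forall i, P i -> 0 < f i x]).
Proof.
move=> oD fc; rewrite openE => x [Dx fx].
apply: filterI; first exact: open_nbhs_nbhs.
suff : nbhs x [set y | forall i : I, P i -> 0 < f i y] by [].
apply: filter_forall => i; case: (boolP (P i)) => Pi.
  have : nbhs x (f i @^-1` [set t | 0 < t]).
    by apply: fc => //; apply: open_nbhs_nbhs; split; [exact: open_gt|exact: fx].
  by apply: filterS.
by apply: filterS (filterT : nbhs x setT) => y _ /= Pi'; case/negP: Pi.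
Qed.

Lemma continuous_pair (T U V : topologicalType) (f : T -> U) (g : T -> V) x :
  {for x, continuous f} -> {for x, continuous g} ->
  {for x, continuous (fun y => (f y, g y))}.
Proof. by move=> fc gc; exact: (cvg_pair fc gc). Qed.

Lemma continuous_fst (U V : topologicalType) : continuous (@fst U V).
Proof. by move=> [x y]; exact: cvg_fst. Qed.

Lemma continuous_snd (U V : topologicalType) : continuous (@snd U V).
Proof. by move=> [x y]; exact: cvg_snd. Qed.

End TopologyFacts.

(** * The quotient and its charts *)

Section Quotient.
Context {R : realType} {d n : nat} (v : 'I_n -> 'cV[R]_d) (l : 'I_n -> R)
  (Q : set 'cV[R]_d).

Definition torus_subgroup : set 'cV[R[i]]_n := torus_exp @` [set a | Q (lincomb v a)].

(** The hypotheses under which the charts at the vertices make the quotient a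
    symplectic quasifold. They hold both for the whole list of vectors, where [Q] is its
    integral span, and for the facet vectors alone, so that the two reductions are
    instances of one construction. *)
Record quasi_data : Prop := QuasiData {
  qd_zero : Q 0 ;
  qd_sub : forall x y, Q x -> Q y -> Q (x - y) ;
  qd_gen : forall j, Q (v j) ;
  qd_countable : countable Q ;
  qd_basis : forall nu : vertex_index v l, vmx nu \in unitmx ;
  qd_cover : forall mu, polyhedron v l mu -> exists nu : vertex_index v l,
    forall j, pairing mu (v j) = l j -> inI nu j }.

Hypothesis D : quasi_data.
Local Notation N := torus_subgroup.
Local Notation cls := (@orbit_class R d n v l N).
Implicit Types (nu : vertex_index v l) (x z : 'rV[R]_(d + d)) (y : 'rV[R]_(n + n)).

Lemma Q_add p q : Q p -> Q q -> Q (p + q).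
Proof.
move=> Qp Qq; rewrite -[q]opprK; apply: (qd_sub D) => //.
by rewrite -sub0r; apply: (qd_sub D) => //; exact: (qd_zero D).
Qed.

Lemma Q_opp p : Q p -> Q (- p).
Proof. by rewrite -sub0r; apply: (qd_sub D); exact: (qd_zero D). Qed.

Lemma Q_sum (I : Type) (r : seq I) (P : pred I) (F : I -> 'cV[R]_d) :
  (forall i, P i -> Q (F i)) -> Q (\sum_(i <- r | P i) F i).
Proof.
by move=> QF; elim/big_ind: _ => //; [exact: (qd_zero D)|exact: Q_add].
Qed.

Lemma Q_mulz p (m : int) : Q p -> Q (m%:~R *: p).
Proof.
move=> Qp; have Qn k : Q (p *+ k).
  by elim: k => [|k IH]; rewrite ?mulr0n ?mulrS; [exact: (qd_zero D)|exact: Q_add].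
rewrite scaler_int; case: m => k; first exact: Qn.
by rewrite NegzE mulrNz; apply: Q_opp; exact: Qn.
Qed.

Lemma Q_int (a : 'cV[R]_n) : (forall j, a j 0 \is a Num.int) -> Q (lincomb v a).
Proof.
by move=> aint; apply: Q_sum => j _; have /intrP[m ->] := aint j; apply: Q_mulz; exact: (qd_gen D).
Qed.

Lemma clsP (z w : level v l) :
  cls z = cls w <-> exists a, Q (lincomb v a) /\ val w = rot a (val z).
Proof.
have orbE (y : 'rV[R]_(n + n)) : Defs.orbit N y = [set w | exists a, Q (lincomb v a) /\ w = rot a y].
  apply/seteqP; split=> [u [t [a Qa <-] ->]|u [a [Qa ->]]]; first by exists a; rewrite rotE.
  by exists (torus_exp a); [exists a|rewrite rotE].
rewrite /orbit_class; split=> [/eqquotP/asboolP zw|[a [Qa wE]]].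
  have : Defs.orbit N (val w) (val w) by rewrite orbE; exists 0; rewrite rot0 lincombE mulmx0; split=> //; exact: (qd_zero D).
  by rewrite -zw orbE => -[a [Qa wE]]; exists a.
apply/eqquotP/asboolP; rewrite !orbE; apply/seteqP; split=> u [b [Qb ->]].
  exists (b - a); rewrite lincombB wE -rotD subrK; split=> //; exact: (qd_sub D).
by exists (b + a); rewrite lincombD wE -rotD; split=> //; exact: Q_add.
Qed.

Lemma cls_surj (p : orbit_space v l N) : exists w, p = cls w.
Proof. by exists (repr p); rewrite /orbit_class reprK. Qed.

Lemma open_clsP (O : set (orbit_space v l N)) : open O <-> open (cls @^-1` O).
Proof. by []. Qed.

Definition of_level y (yl : level v l y) : level v l := exist _ y (mem_set yl).

Lemma slice_cls nu y (yl : level v l y) : slice nu y -> chart_par N nu (restr nu y) = cls (of_level yl).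
Proof.
move=> /(slice_section (qd_basis D nu))[_ yE]; rewrite /chart_par yE; congr cls.
by apply: val_inj; rewrite insubdK//=; exact/mem_set.
Qed.

Lemma par_cls nu z : chart_dom nu z ->
  exists2 w : level v l, val w = chart_section nu z & chart_par N nu z = cls w.
Proof.
move=> zd; have zs := section_slice (qd_basis D nu) zd.
exists (of_level zs.1) => //; by rewrite -(slice_cls zs.1 zs) restr_section.
Qed.

Lemma parP nu nu' z z' : chart_dom nu z -> chart_dom nu' z' ->
  chart_par N nu z = chart_par N nu' z' <->
  exists a, Q (lincomb v a) /\ chart_section nu' z' = rot a (chart_section nu z).
Proof.
by move=> /par_cls[w <- ->] /par_cls[w' <- ->]; exact: clsP.
Qed.

Lemma rot_pos_int (a : 'cV[R]_n) y j : 0 < re y j -> im y j = 0 -> 0 < re (rot a y) j ->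
  im (rot a y) j = 0 -> a j 0 \is a Num.int.
Proof.
rewrite re_rot im_rot => y0 ->; rewrite !mulr0 subr0 add0r => c0 /eqP.
rewrite mulf_eq0 (gt_eqF y0) orbF => /eqP s0.
have {}c0 : 0 < tcos (a j 0) by rewrite -(pmulr_lgt0 _ y0).
apply: tcos_eq1; have := tcos2Dtsin2 (a j 0); rewrite s0 expr0n addr0 => /eqP.
rewrite -[X in _ == X](expr1n _ 2) eqf_sqr => /orP[/eqP->//|/eqP c1].
by move: c0; rewrite c1 ltr0N1.
Qed.

Lemma slice_rot_int nu (a : 'cV[R]_n) y : slice nu y -> slice nu (rot a y) ->
  forall j, ~~ inI nu j -> a j 0 \is a Num.int.
Proof.
move=> [_ ys] [_ zs] j jI; have [y0 y1] := ys j jI; have [z0 z1] := zs j jI.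
exact: rot_pos_int z0 z1.
Qed.

Lemma same_chartP nu x z : chart_dom nu x -> chart_dom nu z ->
  chart_par N nu x = chart_par N nu z <->
  exists a, [/\ Q (lincomb v a), (forall j, ~~ inI nu j -> a j 0 \is a Num.int) &
    z = rot (restrc nu a) x].
Proof.
move=> xd zd; rewrite parP//; split=> [[a [Qa zE]]|[a [Qa ai ->]]]; last first.
  by exists a; split=> //; exact: section_rot.
have ai : forall j, ~~ inI nu j -> a j 0 \is a Num.int.
  by apply: (@slice_rot_int nu _ (chart_section nu x)); rewrite -?zE; exact: (section_slice (qd_basis D nu)).
by exists a; split=> //; rewrite -(restr_section nu z) zE restr_rot restr_section.
Qed.

Lemma chart_grpP nu gam : chart_grp N nu gam <->
  exists a, [/\ Q (lincomb v a), (forall j, ~~ inI nu j -> a j 0 \is a Num.int) &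
    gam = rot (restrc nu a)].
Proof.
have rE a : (\col_k torus_exp a (enumI nu k) 0) = torus_exp (restrc nu a).
  by apply/colP => k; rewrite !mxE.
split=> [[t [[a Qa <-] aI ->]]|[a [Qa aI ->]]].
  exists a; split=> //; last by apply/funext => z; rewrite rotE rE.
  move=> j /notinIP/aI; rewrite mxE => -[c _]; exact: tcos_eq1.
exists (torus_exp a); split; first by exists a.
  by move=> j /notinIP/aI/trig_int[c s]; rewrite mxE; congr Complex.
by apply/funext => z; rewrite rotE rE.
Qed.

(** Dropping the integral angles off the vertex changes the linear combination
    by an element of [Q]. *)
Lemma chart_grp_basisP nu gam : chart_grp N nu gam <->
  exists2 b, Q (vmx nu *m b) & gam = rot b.
Proof.
rewrite chart_grpP; split=> [[a [Qa aI ->]]|[b Qb ->]]; last first.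
  exists (emb nu b); rewrite lincomb_emb restrc_emb; split=> // j jI.
  by rewrite emb_out.
exists (restrc nu a) => //; rewrite -lincomb_emb.
have -> : emb nu (restrc nu a) = a - mask nu a.
  apply/colP => j; rewrite ![in RHS]mxE; case: (boolP (inI nu j)) => [/inIP[k <-]|jI].
    by rewrite emb_in mxE oppr0 addr0.
  by rewrite emb_out// subrr.
rewrite lincombB; apply: (qd_sub D) => //; apply: Q_int => j.
by rewrite mxE; case: ifPn => // /aI.
Qed.

End Quotient.

Section ChartProperties.
Context {R : realType} {d n : nat} (v : 'I_n -> 'cV[R]_d) (l : 'I_n -> R)
  (Q : set 'cV[R]_d).
Hypothesis D : quasi_data v l Q.
Local Notation N := (torus_subgroup v Q).
Local Notation cls := (@orbit_class R d n v l N).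
Implicit Types (nu : vertex_index v l) (x z : 'rV[R]_(d + d)) (y : 'rV[R]_(n + n)).

Lemma zCk_id k p (U : set 'rV[R]_(p + p)) : zCk k U id.
Proof.
move=> j; split; apply: Ck_linear.
- by move=> c z w; rewrite reD reZ.
- exact: coord_continuous.
- by move=> c z w; rewrite imD imZ.
- exact: coord_continuous.
Qed.

Lemma sqabs_neq0 (p : nat) (y : 'rV[R]_(p + p)) j : sqabs y j = 0 -> re y j = 0 /\ im y j = 0.
Proof.
move=> /eqP; rewrite paddr_eq0 ?sqr_ge0// !sqrf_eq0 => /andP[/eqP-> /eqP->].
by split.
Qed.

Lemma rotate_to_pos (p : nat) (y : 'rV[R]_(p + p)) j : sqabs y j != 0 ->
  exists t : R, forall a : 'cV[R]_p, a j 0 = t -> 0 < re (rot a y) j /\ im (rot a y) j = 0.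
Proof.
move=> y0; have s0 : 0 < sqabs y j by rewrite lt_neqAle eq_sym y0 sqabs_ge0.
pose r := Num.sqrt (sqabs y j); have r0 : 0 < r by rewrite sqrtr_gt0.
have r2 : r ^+ 2 = sqabs y j by rewrite sqr_sqrtr// ltW.
have rn : r != 0 by rewrite gt_eqF.
have [t [tc ts]] : exists t, tcos t = re y j / r /\ tsin t = - (im y j / r).
  apply: arg_ex; rewrite sqrrN !expr_div_n -mulrDl -/(sqabs y j) -r2 divff//.
  by rewrite expf_neq0.
exists t => a at_; rewrite re_rot im_rot at_ tc ts; split; last by ring.
rewrite (_ : _ - _ = sqabs y j / r); first by rewrite divr_gt0.
by rewrite /sqabs; field.
Qed.

(** The phases off the vertex can be prescribed, since the vectors at the vertex
    form a basis and complete any prescribed angles to a relation. *)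
Lemma straighten_ex nu y : level v l y -> (forall j, ~~ inI nu j -> sqabs y j != 0) ->
  exists a, lincomb v a = 0 /\ slice nu (rot a y).
Proof.
move=> yl y0.
have tP j : exists t : R, ~~ inI nu j -> forall a : 'cV[R]_n, a j 0 = t ->
    0 < re (rot a y) j /\ im (rot a y) j = 0.
  case: (boolP (inI nu j)) => jI; first by exists 0.
  by have [t tP] := rotate_to_pos (y0 j jI); exists t.
have [t {}tP] := choice tP; exists (ext nu (\col_j t j)).
rewrite lincomb_ext ?(qd_basis D)//; split=> //; split=> [|j jI]; first exact: level_rot.
by apply: tP => //; rewrite ext_out// mxE.
Qed.

Lemma chart_dom_open nu : open (chart_dom nu).
Proof.
rewrite (_ : chart_dom nu = setT `&` [set z | forall j, ~~ inI nu j ->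
    0 < pairing (chart_mu nu z) (v j) - l j]); last first.
  rewrite setTI; apply/seteqP; split=> z.
    by move=> /chart_domP zd j jI; rewrite subr_gt0 zd.
  by move=> zd; apply/chart_domP => j jI; rewrite -subr_gt0 zd.
apply: open_gt0 => [|j z _]; first exact: openT.
apply: (@Ck_continuous _ _ _ 0 setT) => //.
apply: (CkB openT _ (Ck_cst 0 setT (l j))).
exact: (Ck_pairing_mu openT nu (v j) (zCk_id 0 setT)).
Qed.

Lemma vtx_gt nu j : ~~ inI nu j -> l j < pairing (vtx nu) (v j).
Proof.
move=> jI; rewrite lt_neqAle; apply/andP; split.
  by apply: contra jI => /eqP e; apply/inI_active.
case: (vtxP nu) => w [c [_ e]]; have : [set vtx nu] (vtx nu) by [].
by rewrite e => -[+ _]; apply.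
Qed.

Lemma chart_mu_convex nu (t : R) z z' z'' :
  (forall k, sqabs z'' k = (1 - t) * sqabs z k + t * sqabs z' k) ->
  chart_mu nu z'' = (1 - t) *: chart_mu nu z + t *: chart_mu nu z'.
Proof.
move=> e; rewrite /chart_mu !scalemxAl -mulmxDl; congr (_ *m _).
by apply/rowP => k; rewrite !mxE e; ring.
Qed.

Lemma chart_mu0 nu : chart_mu nu 0 = vtx nu.
Proof.
apply: (pairing_inj (qd_basis D nu)) => k; rewrite chart_mu_in ?(qd_basis D)//.
rewrite (inI_active nu _).1 ?inI_enum//.
by rewrite /sqabs /re /im !mxE expr0n !add0r.
Qed.

Lemma pairingD (mu mu' : 'rV[R]_d) w : pairing (mu + mu') w = pairing mu w + pairing mu' w.
Proof. by rewrite /pairing mulmxDl mxE. Qed.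

Lemma pairingZ c (mu : 'rV[R]_d) w : pairing (c *: mu) w = c * pairing mu w.
Proof. by rewrite /pairing -scalemxAl mxE. Qed.

Lemma chart_dom0 nu : chart_dom nu 0.
Proof. by apply/chart_domP => j jI; rewrite chart_mu0 vtx_gt. Qed.

Lemma sqabsZ p (t : R) (y : 'rV[R]_(p + p)) j : sqabs (t *: y) j = t ^+ 2 * sqabs y j.
Proof. by rewrite /sqabs reZ imZ !exprMn mulrDr. Qed.

Lemma convex_gt (t a b c : R) : 0 <= t <= 1 -> c < a -> c < b -> c < (1 - t) * a + t * b.
Proof.
move=> /andP[t0 t1] ca cb; have [->|tn] := eqVneq t 0; first by lra.
have tp : 0 < t by rewrite lt_neqAle eq_sym tn.
have h1 : 0 <= (1 - t) * (a - c) by rewrite mulr_ge0 ?subr_ge0// ltW.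
have h2 : 0 < t * (b - c) by rewrite mulr_gt0 ?subr_gt0.
rewrite -subr_gt0 (_ : _ - c = (1 - t) * (a - c) + t * (b - c)); last by ring.
by rewrite ltr_wpDl.
Qed.

Lemma sqr01 (t : R) : 0 <= t <= 1 -> 0 <= t ^+ 2 <= 1.
Proof. by move=> /andP[t0 t1]; rewrite exprn_ge0// exprn_ile1. Qed.

(** In terms of the moduli squared a chart domain is convex, and it contains 0. *)
Lemma chart_dom_connected nu : connected (chart_dom nu).
Proof.
apply: (@connected_paths R _ (chart_dom nu) (0 : 'rV[R]_(d + d))) => z zd; exists (fun t => t *: z).
split; rewrite ?scale0r ?scale1r//.
  by move=> t; apply: cvgZr_tmp; exact: cvg_id.
move=> t t01; apply/chart_domP => j jI.
rewrite (@chart_mu_convex nu (t ^+ 2) 0 z); last first.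
  by move=> k; rewrite sqabsZ /sqabs /re /im !mxE expr0n addr0 mulr0 add0r.
rewrite pairingD !pairingZ; apply: convex_gt; rewrite ?sqr01 ?chart_mu0 ?vtx_gt//.
by move/chart_domP: zd; exact.
Qed.

Lemma rot_smooth p (U : set 'rV[R]_(p + p)) (b : 'cV[R]_p) : open U -> smooth_on U (rot b).
Proof.
move=> oU; apply/smooth_onP => k; apply: zCk_Ck => //.
exact: (zCk_rot oU (@vCk_cst _ _ k U _ b) (zCk_id k U)).
Qed.

Lemma rot_fixed p (b : 'cV[R]_p) (y : 'rV[R]_(p + p)) :
  rot b y = y <-> forall k, b k 0 \isn't a Num.int -> re y k = 0 /\ im y k = 0.
Proof.
split=> [e k bk|y0]; last first.
  apply: zcoord_ext => k; case: (boolP (b k 0 \is a Num.int)) => bk.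
  - by have [-> _] := rot_int_coord y bk.
  - by have [r0 i0] := y0 k bk; rewrite re_rot r0 i0 !mulr0 subrr.
  - by have [_ ->] := rot_int_coord y bk.
  - by have [r0 i0] := y0 k bk; rewrite im_rot r0 i0 !mulr0 addr0.
have rE : re (rot b y) k = re y k by rewrite e.
have iE : im (rot b y) k = im y k by rewrite e.
rewrite re_rot in rE; rewrite im_rot in iE.
have c1 : tcos (b k 0) - 1 != 0.
  by apply: contra bk; rewrite subr_eq0 => /eqP/tcos_eq1.
have D0 : (tcos (b k 0) - 1) ^+ 2 + tsin (b k 0) ^+ 2 != 0.
  by rewrite gt_eqF// ltr_pwDl ?sqr_ge0// exprn_even_gt0.
split; apply: (mulfI D0); rewrite mulr0.
  transitivity ((tcos (b k 0) - 1) * (tcos (b k 0) * re y k - tsin (b k 0) * im y k - re y k)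
     + tsin (b k 0) * (tcos (b k 0) * im y k + tsin (b k 0) * re y k - im y k)); first by ring.
  by rewrite rE iE !subrr !mulr0 addr0.
transitivity ((tcos (b k 0) - 1) * (tcos (b k 0) * im y k + tsin (b k 0) * re y k - im y k)
     - tsin (b k 0) * (tcos (b k 0) * re y k - tsin (b k 0) * im y k - re y k)); first by ring.
by rewrite rE iE !subrr !mulr0 subr0.
Qed.

(** A point that is fixed by a nontrivial group element lies on one of the
    complex coordinate hyperplanes, of real codimension 2. *)
Lemma not_free_dim nu : dim_lt (d + d).-1 (not_free (chart_dom nu) (chart_grp N nu)).
Proof.
pose L := [seq ([set lshift d k; rshift d k]%SET, 0 : 'rV[R]_(d + d)) | k <- enum 'I_d].
apply: (@dim_lt_flats R _ _ _ L) => [Sc /mapP[k _ ->] /=|x [xU [gam [+ gx [w wU gw]]]]].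
  rewrite cards2 (_ : _ != _); last by rewrite -(inj_eq val_inj)/= neq_ltn ltn_addr.
  by case: (d) k => [[]//|d' _]; rewrite addSn /= addn2.
move=> /(chart_grp_basisP D)[b Qb gE]; move: gx gw; rewrite gE => /rot_fixed gx gw.
have [k bk] : exists k, b k 0 \isn't a Num.int.
  apply: contrapT => /forallNP h; apply: gw; apply: rot_int => k.
  by apply/negPn/negP => /h.
have [r0 i0] := gx k bk.
exists ([set lshift d k; rshift d k]%SET, 0); first by apply/mapP; exists k; rewrite ?mem_enum.
by move=> i; rewrite !inE /= mxE => /orP[]/eqP->.
Qed.

Lemma not_free_closed nu :
  exists2 C, closed C & not_free (chart_dom nu) (chart_grp N nu) = chart_dom nu `&` C.
Proof.
pose good (S : {set 'I_d}) := `[< exists b, [/\ Q (vmx nu *m b),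
  exists2 w, chart_dom nu w & rot b w <> w & S = [set k | b k 0 \isn't a Num.int]%SET] >].
pose F (S : {set 'I_d}) : set 'rV[R]_(d + d) := [set x | \sum_(k in S) sqabs x k = 0].
exists (\big[setU/set0]_(S <- enum good) F S).
  apply: closed_bigsetU => S _.
  rewrite (_ : F S = (fun x => \sum_(k in S) sqabs x k) @^-1` [set 0])//.
  apply: closed_comp => [x _|]; last exact: closed_eq.
  apply: (@Ck_continuous _ _ _ 0 setT) => //.
  by apply: (Ck_sum _ _ openT) => k; exact: (Ck_sqabs openT k (zCk_id 0 setT)).
rewrite -bigcup_seq; apply/seteqP; split=> x.
  move=> [xU [gam [/(chart_grp_basisP D)[b Qb gE] gx [w wU gw]]]]; split=> //.
  exists [set k | b k 0 \isn't a Num.int]%SET.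
    rewrite /= mem_enum; apply/asboolP; exists b; split=> //.
    by exists w => //; rewrite -gE.
  rewrite /F/= big1// => k; rewrite inE => bk.
  by move: gx; rewrite gE => /rot_fixed/(_ k bk)[r0 i0]; rewrite /sqabs r0 i0 expr0n addr0.
move=> [xU [S /=]]; rewrite mem_enum => /asboolP[b [Qb [w wU bw] SE]] /eqP.
rewrite psumr_eq0 => [/allP x0|k _]; last exact: sqabs_ge0.
split=> //; exists (rot b); split; first by apply/(chart_grp_basisP D); exists b.
  apply/rot_fixed => k bk; apply: sqabs_neq0; apply/eqP.
  by have := x0 k (mem_index_enum k); rewrite SE inE bk.
by exists w.
Qed.

Lemma chart_grp_countable nu : countable (chart_grp N nu).
Proof.
apply: (@sub_countable _ _ _ ((fun q => rot (coords nu q)) @` Q)); last first.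
  by apply: card_le_trans (qd_countable D); exact: card_image_le.
apply: subset_card_le => gam /(chart_grp_basisP D)[b Qb ->]; exists (vmx nu *m b) => //.
by rewrite /coords mulKmx// (qd_basis D).
Qed.

Lemma chart_model nu : is_model (chart_dom nu) (chart_grp N nu).
Proof.
have oU := @chart_dom_open nu.
split.
- by split=> //; [exists 0; exact: chart_dom0|exact: chart_dom_connected].
- move=> gam /(chart_grp_basisP D)[b _ ->]; split; first exact: (rot_smooth b oU).
  by move=> x xd; exact: (chart_dom_rot nu b x).2 xd.
- split.
  + exists (rot 0) => [|x _]; last exact: rot0.
    by apply/(chart_grp_basisP D); exists 0; rewrite ?mulmx0; first exact: (qd_zero D).
  + move=> g1 g2 /(chart_grp_basisP D)[b1 Q1 ->] /(chart_grp_basisP D)[b2 Q2 ->].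
    exists (rot (b1 + b2)) => [|x _]; last exact: rotD.
    by apply/(chart_grp_basisP D); exists (b1 + b2); rewrite ?mulmxDr; first exact: (Q_add D).
  + move=> g1 /(chart_grp_basisP D)[b Qb ->].
    exists (rot (- b)) => [|x _]; last by rewrite rotK rotNK.
    by apply/(chart_grp_basisP D); exists (- b); rewrite ?mulmxN; first exact: (Q_opp D).
- exact: chart_grp_countable.
- by split; [exact: not_free_closed|exact: not_free_dim].
Qed.

Lemma chart_imageP nu (w : level v l) :
  (chart_par N nu @` chart_dom nu) (cls w) <-> forall j, ~~ inI nu j -> sqabs (val w) j != 0.
Proof.
split=> [[z zd] /=|w0].
  have [u uE ->] := par_cls D zd; move=> /(clsP D)[a [_ ->]] j jI.
  rewrite sqabs_rot uE /sqabs; have [_ /(_ j jI)[y0 ->]] := section_slice (qd_basis D nu) zd.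
  by rewrite expr0n addr0 gt_eqF// exprn_gt0.
have [a [va sa]] := straighten_ex (set_valP w) w0.
have [xd xE] := slice_section (qd_basis D nu) sa.
exists (restr nu (rot a (val w))) => //.
rewrite (slice_cls D sa.1 sa); apply/esym/(clsP D); exists a; rewrite va.
by split=> //; exact: (qd_zero D).
Qed.

(** A local inverse of the chart. *)
Lemma straight_par nu (w : level v l) (a : 'cV[R]_n) : Q (lincomb v a) ->
  (forall j, ~~ inI nu j -> 0 < re (rot a (val w)) j) ->
  let x := restr nu (straight nu (rot a (val w))) in
  chart_dom nu x /\ chart_par N nu x = cls w.
Proof.
move=> Qa w0 x; have bas := qd_basis D nu.
have sl : slice nu (straight nu (rot a (val w))).
  by apply: slice_straight => //; apply: level_rot; exact: (set_valP w).
split; first by have [] := slice_section bas sl.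
rewrite (slice_cls D sl.1 sl); apply/esym/(clsP D).
exists (ext nu (off_ang nu (rot a (val w))) + a); rewrite lincombD lincomb_ext// add0r.
by split=> //; rewrite rotD.
Qed.

Lemma chart_section_continuous nu x : chart_dom nu x ->
  {for x, continuous (chart_section nu)}.
Proof.
move=> xd; have oU := @chart_dom_open nu.
apply: (@Ck_continuous _ _ _ 0 (chart_dom nu)) => //.
exact: (zCk_Ck oU (zCk_section oU (zCk_id 0 (chart_dom nu)) (fun x xd => xd))).
Qed.

Lemma straight_continuous nu (a : 'cV[R]_n) :
  let U := [set y | forall j, ~~ inI nu j -> 0 < re (rot a y) j] in
  open U /\ forall y, U y -> {for y, continuous (fun y => restr nu (straight nu (rot a y)))}.
Proof.
move=> U; have rC k W : open W -> zCk k W (rot a).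
  by move=> oW; exact: (zCk_rot oW (@vCk_cst _ _ k W _ a) (zCk_id k W)).
have oU : open U.
  rewrite -[U]setTI; apply: open_gt0 => [|j x _]; first exact: openT.
  by apply: (@Ck_continuous _ _ _ 0 setT) => //; exact: (rC 0 setT openT j).1.
split=> // y Uy; apply: (@Ck_continuous _ _ _ 0 U) => //.
apply: zCk_Ck => //; apply: zCk_restr => //; apply: zCk_rot => //; last exact: rC.
apply: vCk_linear => //; first exact: ext_linear.
by apply: vCk_off_ang => //; exact: rC.
Qed.

Lemma chart_is_chart nu : is_chart (Chart (chart_dom nu) (chart_grp N nu) (chart_par N nu)).
Proof.
have bas := qd_basis D nu; have oU := @chart_dom_open nu.
split=> /=.
- exact: chart_model.
- move=> x z xd zd; rewrite (same_chartP D)//; split=> [[a [Qa ai ->]]|[gam /chart_grpP[a [Qa ai ->]] ->]].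
    by exists (rot (restrc nu a)) => //; apply/chart_grpP; exists a.
  by exists a.
- apply/open_clsP; apply/open_set_typeP.
  exists (setT `&` [set y | forall j, ~~ inI nu j -> 0 < sqabs y j]).
    apply: open_gt0 => [|j y _]; first exact: openT.
    by apply: (@Ck_continuous _ _ _ 0 setT) => //; exact: (Ck_sqabs openT j (zCk_id 0 setT)).
  apply/seteqP; split=> w /=.
    by move=> /chart_imageP w0; split=> // j jI; rewrite lt_neqAle eq_sym w0// sqabs_ge0.
  by move=> [_ w0]; apply/chart_imageP => j jI; rewrite gt_eqF// w0.
- move=> B OU; split=> oO.
    have /open_set_typeP[A oA OE] := (open_clsP B).1 oO.
    rewrite (_ : _ `&` _ = chart_dom nu `&` chart_section nu @^-1` A).
      by apply: open_preimage => // x xd; exact: chart_section_continuous.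
    apply/seteqP; split=> x [xd xO]; split=> //; have [w wE pE] := par_cls D xd.
      by rewrite /= -wE -[A _]/((set_val @^-1` A) w) -OE /= -pE.
    by rewrite /= pE -[B _]/((cls @^-1` B) w) OE /= -[set_val w]/(val w) wE.
  apply/open_clsP; apply: open_set_type_near => w Ow.
  have /chart_imageP w0 := OU _ Ow.
  have [a [va [_ sa]]] := straighten_ex (set_valP w) w0.
  have [oV cV] := @straight_continuous nu a.
  set V := [set y | _] in oV cV.
  pose f y := restr nu (straight nu (rot a y)).
  exists (V `&` f @^-1` (chart_dom nu `&` chart_par N nu @^-1` B)).
  have Qa : Q (lincomb v a) by rewrite va; exact: (qd_zero D).
  have Vw : V (set_val w) by move=> j /sa[].
  split; first exact: open_preimage.
    by split=> //; have [fd fp] := straight_par Qa Vw; split=> //; rewrite /= /f fp.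
  move=> u [Vu [fd fO]]; have [_ fp] := straight_par Qa Vu.
  by move: fO; rewrite /= /f fp.
Qed.

Lemma charts_cover (p : orbit_space v l N) :
  exists nu x, chart_dom nu x /\ chart_par N nu x = p.
Proof.
have [w ->] := cls_surj p.
have /levelP[mu muE] := set_valP w.
have Pmu : polyhedron v l mu by move=> j; rewrite -muE lerDr sqabs_ge0.
have [nu nuP] := qd_cover D Pmu; exists nu.
have [|x xd <-] := (chart_imageP nu w).2; last by exists x.
move=> j jI; apply: contra jI => /eqP s0; apply: nuP; rewrite -muE s0; exact: add0r.
Qed.

End ChartProperties.

(** * Transition maps *)

Section Transition.
Context {R : realType} {d n : nat} (v : 'I_n -> 'cV[R]_d) (l : 'I_n -> R)
  (Q : set 'cV[R]_d).
Hypothesis D : quasi_data v l Q.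
Local Notation N := (torus_subgroup v Q).
Local Notation cls := (@orbit_class R d n v l N).
Local Notation T := ('rV[R]_(d + d) * 'rV[R]_(d + d) * 'cV[R]_n)%type.
Local Notation chart_at nu := (Chart (chart_dom nu) (chart_grp N nu) (chart_par N nu)).
Implicit Types (nu : vertex_index v l) (x z : 'rV[R]_(d + d)) (a b e : 'cV[R]_n) (y : T).

(** A common covering of the two sides of a transition map: the triples of a
    point in each chart and a relation [a] whose exponential carries the first
    point to the second. Taking [a] in R^n, and not its exponential, makes the
    projections to the charts locally injective. *)
Definition transition nu1 nu2 : set T := [set y : T |
  [/\ chart_dom nu1 y.1.1, chart_dom nu2 y.1.2,
      forall j, ~~ inI nu1 j -> ~~ inI nu2 j -> y.2 j 0 = 0,
      lincomb v y.2 = 0 &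
      chart_section nu2 y.1.2 = rot y.2 (chart_section nu1 y.1.1)]].

(** Exchanging the charts turns each statement on the first projection into one
    on the second. *)
Definition swap (y : T) : T := (y.1.2, y.1.1, - y.2).

Lemma swap_transition nu1 nu2 y : transition nu1 nu2 y -> transition nu2 nu1 (swap y).
Proof.
move=> [d1 d2 y0 yr ye]; split; [exact: d2|exact: d1| | |].
- by move=> j j2 j1; rewrite mxE (y0 j j1 j2) oppr0.
- by rewrite lincombN yr oppr0.
- by rewrite ye rotK.
Qed.

Lemma swapK y : swap (swap y) = y.
Proof. by case: y => [[x z] a]; rewrite /swap /= opprK. Qed.

Section Pair.
Variables nu1 nu2 : vertex_index v l.
Local Notation sec := (chart_section nu1).
Local Notation E := (transition nu1 nu2).
Local Notation bas1 := (qd_basis D nu1).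
Local Notation bas2 := (qd_basis D nu2).

Lemma transition_slice y : E y -> slice nu2 (rot y.2 (sec y.1.1)).
Proof. by move=> [_ d2 _ _ <-]; exact: (section_slice bas2 d2). Qed.

Lemma transition_restr y : E y -> y.1.2 = restr nu2 (rot y.2 (sec y.1.1)).
Proof. by move=> [_ d2 _ _ <-]; rewrite restr_section. Qed.

Lemma transition_mk x a : chart_dom nu1 x ->
  (forall j, ~~ inI nu1 j -> ~~ inI nu2 j -> a j 0 = 0) -> lincomb v a = 0 ->
  slice nu2 (rot a (sec x)) -> E (x, restr nu2 (rot a (sec x)), a).
Proof. by move=> xd a0 va sa; have [d2 e2] := slice_section bas2 sa; split. Qed.

(** Over a point of the first chart the relation changes by whole turns, so the
    fibres of the first projection are discrete. *)
Lemma transition_fibre y y' : E y -> E y' -> y.1.1 = y'.1.1 ->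
  forall j, ~~ inI nu2 j -> y'.2 j 0 - y.2 j 0 \is a Num.int.
Proof.
move=> /transition_slice s1 /transition_slice s2 yy j jI.
have := @slice_rot_int _ _ _ _ _ nu2 (y'.2 - y.2) _ s1; rewrite -rotD subrK yy.
by move=> /(_ s2 j jI); rewrite !mxE.
Qed.

Lemma transition_inj y y' : E y -> E y' -> y.1.1 = y'.1.1 ->
  (forall j, ~~ inI nu2 j -> y.2 j 0 = y'.2 j 0) -> y = y'.
Proof.
move=> Ey Ey' x1 aa; have ae : y.2 = y'.2.
  apply/subr0_eq/(rel_inj bas2) => [|j jI]; last by rewrite !mxE aa// subrr.
  by case: Ey => _ _ _ yr _; case: Ey' => _ _ _ yr' _; rewrite lincombB yr yr' subrr.
have := transition_restr Ey; have := transition_restr Ey'.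
by case: y {Ey aa} x1 ae => [[? ?] ?]; case: y' {Ey'} => [[? ?] ?] /= -> -> -> ->.
Qed.

Lemma transition_close y y' : E y -> E y' -> y.1.1 = y'.1.1 ->
  (forall j, ~~ inI nu2 j -> `|y'.2 j 0 - y.2 j 0| < 2^-1) -> y = y'.
Proof.
move=> Ey Ey' x1 small; apply: transition_inj => // j jI.
have /intrP[m mE] := transition_fibre Ey Ey' x1 jI.
have := small j jI; rewrite mE; case: (eqVneq m 0) => [m0 _|m0].
  by apply/esym/subr0_eq; rewrite mE m0.
rewrite ltNge; have -> // : 2^-1 <= `|m%:~R| :> R.
rewrite -intr_norm; have m1 : (1 <= `|m|)%R by rewrite -gtz0_ge1 normr_gt0.
have : (1%:~R : R) <= `|m|%:~R by rewrite ler_int.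
by apply: le_trans; rewrite invf_le1// ler1n.
Qed.

(** The arguments of the coordinates off [nu2] differ by less than a quarter
    turn, so that they can be compared by [atan]. *)
Definition half_turn x x' : Prop := forall j, ~~ inI nu2 j ->
  0 < re (sec x) j * re (sec x') j + im (sec x) j * im (sec x') j.

Lemma half_turn_sym x x' : half_turn x x' -> half_turn x' x.
Proof. by move=> h j jI; rewrite mulrC [X in _ + X]mulrC h. Qed.

Lemma half_turnP y x' : E y ->
  half_turn y.1.1 x' <-> forall j, ~~ inI nu2 j -> 0 < re (rot y.2 (sec x')) j.
Proof.
move=> /transition_slice[_ s2].
have dotE j : ~~ inI nu2 j ->
    re (sec y.1.1) j * re (sec x') j + im (sec y.1.1) j * im (sec x') j =
    re (rot y.2 (sec y.1.1)) j * re (rot y.2 (sec x')) j.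
  move=> jI; have [_ i0] := s2 j jI.
  exact: dot_rot_pos.
split=> h j jI; have [r0 _] := s2 j jI; have := h j jI.
  by rewrite (dotE j jI) (pmulr_rgt0 _ r0).
by rewrite (dotE j jI) (pmulr_rgt0 _ r0).
Qed.

(** Along the first chart the relation of [y] is kept, up to the small angles
    that bring the coordinates off [nu2] back to the positive reals. *)
Definition transport_rel (y : T) x' : 'cV[R]_n :=
  ext nu2 (off_ang nu2 (rot y.2 (sec x'))) + y.2.

Definition transport (y : T) x' : T :=
  (x', restr nu2 (straight nu2 (rot y.2 (sec x'))), transport_rel y x').

Lemma transport_transition y x' : E y -> chart_dom nu1 x' -> half_turn y.1.1 x' ->
  E (transport y x').
Proof.
move=> Ey xd /(half_turnP x' Ey) w0; have [d1 d2 y0 yr _] := Ey.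
have wl : level v l (rot y.2 (sec x')) by apply: level_rot; have [] := section_slice bas1 xd.
have sw := slice_straight bas2 wl w0.
rewrite /transport /straight -rotD -/(transport_rel y x'); apply: transition_mk => //.
- move=> j j1 j2; rewrite mxE ext_out// mxE (negbTE j2) ang0.
    by rewrite add0r y0.
  have yi : y.2 j 0 \is a Num.int by rewrite (y0 j j1 j2) rpred0.
  by have [_ ->] := rot_int_coord (sec x') yi; exact: im_section_out.
- by rewrite lincombD (lincomb_ext bas2) yr addr0.
- by rewrite rotD.
Qed.

Lemma transport_small y x' j : ~~ inI nu2 j -> `|(transport y x').2 j 0 - y.2 j 0| < 4^-1.
Proof. by move=> jI; rewrite /= mxE addrK ext_out// off_ang_small. Qed.

Definition nearby (y : T) : set 'rV[R]_(d + d) :=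
  [set x' | chart_dom nu1 x' /\ half_turn y.1.1 x'].

Let rotC k (U : set 'rV[R]_(d + d)) a : open U -> U `<=` chart_dom nu1 -> zCk k U (fun x' => rot a (sec x')).
Proof.
move=> oU Ud; apply: zCk_rot => //; first exact: vCk_cst.
by apply: (zCk_section oU (zCk_id k U)) => x' /Ud.
Qed.

Lemma nearby_open y : open (nearby y).
Proof.
apply: open_gt0 => [|j x' xd]; first exact: chart_dom_open.
have oU := @chart_dom_open _ _ _ v l nu1.
apply: (@Ck_continuous _ _ _ 0 (chart_dom nu1)) => //.
have [rC iC] := zCk_section oU (zCk_id 0 (chart_dom nu1)) (fun x xd => xd) j.
exact: (CkD oU (CkM oU (Ck_cst 0 _ _) rC) (CkM oU (Ck_cst 0 _ _) iC)).
Qed.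

Section Smooth.
Variable y : T.
Hypothesis Ey : E y.
Let oU := @nearby_open y.
Let Ud : nearby y `<=` chart_dom nu1. Proof. by move=> x' []. Qed.
Let pos x' : nearby y x' -> forall j, ~~ inI nu2 j -> 0 < re (rot y.2 (sec x')) j.
Proof. by move=> [_ /(half_turnP x' Ey)]. Qed.

Lemma transport_relC k : vCk k (nearby y) (fun x' => ext nu2 (off_ang nu2 (rot y.2 (sec x')))).
Proof.
apply: vCk_linear => //; first exact: ext_linear.
by apply: vCk_off_ang => //; exact: rotC.
Qed.

Lemma transport_fstC k : zCk k (nearby y) (fun x' => (transport y x').1.2).
Proof.
apply: zCk_restr => //; apply: zCk_rot => //; first exact: transport_relC.
exact: rotC.
Qed.

Lemma transport_smooth : smooth_on (nearby y) (fun x' => (transport y x').1.2).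
Proof. by apply/smooth_onP => k; apply: zCk_Ck => //; exact: transport_fstC. Qed.

Lemma transport_continuous x' : nearby y x' -> {for x', continuous (transport y)}.
Proof.
move=> xy; rewrite /transport /straight /transport_rel.
apply: continuous_pair; first apply: continuous_pair.
- exact: cvg_id.
- apply: (@Ck_continuous _ _ _ 0 (nearby y)) => //; apply: zCk_Ck => //; exact: transport_fstC.
- apply: (@Ck_continuous _ _ _ 0 (nearby y)) => //; apply: vCk_Ck => //.
  by apply: vCkD => //; [exact: transport_relC|exact: vCk_cst].
Qed.

End Smooth.

Lemma overlapP x : overlap (chart_at nu1) (chart_at nu2) x <->
  chart_dom nu1 x /\ forall j, ~~ inI nu2 j -> sqabs (sec x) j != 0.
Proof.
split=> -[/= xd h]; split=> //; have [w wE pE] := par_cls D xd.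
  by move: h; rewrite pE => /(chart_imageP D); rewrite wE.
by rewrite /= pE; apply/(chart_imageP D); rewrite wE.
Qed.

Lemma transition_overlap x :
  overlap (chart_at nu1) (chart_at nu2) x <-> exists2 y, E y & y.1.1 = x.
Proof.
rewrite overlapP; split=> [[xd x0]|[y Ey <-]]; last first.
  have [d1 _ _ _ _] := Ey; split=> // j jI; have [_ s] := transition_slice Ey.
  rewrite -(sqabs_rot y.2) /sqabs; have [r0 ->] := s j jI.
  by rewrite expr0n addr0 gt_eqF// exprn_gt0.
have [xl x1] := section_slice bas1 xd.
have tP j : exists t : R, (~~ inI nu1 j -> t = 0) /\
    (~~ inI nu2 j -> forall a : 'cV[R]_n, a j 0 = t -> 0 < re (rot a (sec x)) j /\ im (rot a (sec x)) j = 0).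
  case: (boolP (inI nu1 j)) => j1.
    case: (boolP (inI nu2 j)) => j2; first by exists 0.
    by have [t tP] := rotate_to_pos (x0 j j2); exists t.
  exists 0; split=> // _ a a0; have ai : a j 0 \is a Num.int by rewrite a0 rpred0.
  by have [-> ->] := rot_int_coord (sec x) ai; exact: x1 j j1.
have [t {}tP] := choice tP; pose a := ext nu2 (\col_j t j).
exists (x, restr nu2 (rot a (sec x)), a) => //; apply: transition_mk => //.
- by move=> j j1 j2; rewrite ext_out// mxE; exact: (tP j).1.
- exact: (lincomb_ext bas2).
- split=> [|j jI]; first exact: level_rot.
  by apply: (tP j).2 => //; rewrite ext_out// mxE.
Qed.

End Pair.

End Transition.

Section TransitionCovering.
Context {R : realType} {d n : nat} (v : 'I_n -> 'cV[R]_d) (l : 'I_n -> R)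
  (Q : set 'cV[R]_d).
Hypothesis D : quasi_data v l Q.
Local Notation N := (torus_subgroup v Q).
Local Notation T := ('rV[R]_(d + d) * 'rV[R]_(d + d) * 'cV[R]_n)%type.
Local Notation chart_at nu := (Chart (chart_dom nu) (chart_grp N nu) (chart_par N nu)).

Lemma quarter_close (c a b : R) : `|a - c| < 4^-1 -> `|b - c| < 4^-1 -> `|b - a| < 2^-1.
Proof.
move=> ac bc; rewrite (_ : b - a = (b - c) - (a - c)); last by ring.
apply: le_lt_trans (ler_normB _ _) _; rewrite (_ : 2^-1 = 4^-1 + 4^-1); last by field.
exact: ltrD.
Qed.

Section Sheets.
Variables nu1 nu2 : vertex_index v l.
Local Notation E := (transition nu1 nu2).
Implicit Types (y : E).

Definition proj1 y : 'rV[R]_(d + d) := (set_val y).1.1.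
Definition proj2 y : 'rV[R]_(d + d) := (set_val y).1.2.
Definition angle y : 'cV[R]_n := (set_val y).2.

Definition of_transition (t : T) (Et : E t) : E := exist _ t (mem_set Et).

Lemma proj1_continuous : continuous proj1.
Proof.
move=> y; apply: (@continuous_comp _ _ _ set_val (fun t : T => t.1.1)).
  exact: initial_continuous.
by apply: continuous_comp; exact: continuous_fst.
Qed.

Lemma angle_continuous j : continuous (fun y => angle y j 0).
Proof.
move=> y; apply: (@continuous_comp _ _ _ set_val (fun t : T => t.2 j 0)).
  exact: initial_continuous.
apply: (@continuous_comp _ _ _ (fun t : T => t.2) (fun a : 'cV[R]_n => a j 0)).
  exact: continuous_snd.
exact: coord_continuous.
Qed.

(** Two angles within a quarter turn of a third are less than half a turn apart,
    hence equal if they differ by an integer: a sheet meets a fibre at most once. *)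
Definition sheet y0 : set E := [set y | nearby nu1 nu2 (set_val y0) (proj1 y) /\
  forall j, ~~ inI nu2 j -> `|angle y j 0 - angle y0 j 0| < 4^-1].

Lemma sheet_open y0 : open (sheet y0).
Proof.
have o1 : open (setT `&` proj1 @^-1` nearby nu1 nu2 (set_val y0)).
  apply: open_preimage; [exact: openT|by move=> y _; exact: proj1_continuous|].
  exact: nearby_open.
rewrite (_ : sheet y0 = (setT `&` proj1 @^-1` nearby nu1 nu2 (set_val y0)) `&`
    [set y | forall j, ~~ inI nu2 j -> 0 < 4^-1 - `|angle y j 0 - angle y0 j 0|]).
  apply: open_gt0 => // j y _.
  have c1 : {for y, continuous (fun y => angle y j 0 - angle y0 j 0)}.
    by apply: continuousB; [exact: angle_continuous|exact: cst_continuous].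
  apply: continuousB; first exact: cst_continuous.
  exact: (continuous_comp c1 (@norm_continuous _ _ _)).
apply/seteqP; split=> y [].
  by move=> yn ya; split=> // j jI; rewrite subr_gt0; exact: ya.
by move=> [_ yn] ya; split=> // j jI; rewrite -subr_gt0; exact: ya.
Qed.

Lemma sheet_inj y0 y y' : sheet y0 y -> sheet y0 y' -> proj1 y = proj1 y' -> y = y'.
Proof.
move=> [_ ya] [_ ya'] yy; apply: val_inj.
apply: (transition_close D (set_valP y) (set_valP y') yy) => j jI.
exact: quarter_close (ya j jI) (ya' j jI).
Qed.

Lemma sheet_transport y0 (x' : 'rV[R]_(d + d)) : nearby nu1 nu2 (set_val y0) x' ->
  exists2 y, sheet y0 y & set_val y = transport nu1 nu2 (set_val y0) x'.
Proof.
move=> xn; have [xd xt] := xn.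
exists (of_transition (transport_transition D (set_valP y0) xd xt)) => //.
by split=> // j jI; exact: transport_small.
Qed.

Lemma sheetE y0 y : sheet y0 y -> set_val y = transport nu1 nu2 (set_val y0) (proj1 y).
Proof.
move=> ys; have [y' ys' y'E] := sheet_transport ys.1.
rewrite -y'E; congr set_val; apply: (sheet_inj ys ys').
by rewrite [RHS]/proj1 y'E.
Qed.

Lemma sheet_open_map y0 (O : set E) : open O -> O `<=` sheet y0 -> open (proj1 @` O).
Proof.
move=> /open_set_typeP[A oA OE] Os.
rewrite (_ : proj1 @` O = nearby nu1 nu2 (set_val y0) `&`
    transport nu1 nu2 (set_val y0) @^-1` A).
  apply: open_preimage; [exact: nearby_open| |exact: oA].
  by move=> x' xn; exact: (transport_continuous D (set_valP y0) xn).
apply/seteqP; split=> [x' [y Oy <-]|x' [xn xA]].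
  have ys := Os y Oy; split; first exact: ys.1.
  by rewrite /= -(sheetE ys); move: Oy; rewrite OE.
have [y ys yE] := sheet_transport xn.
by exists y; [rewrite OE /= yE|rewrite /proj1 yE].
Qed.

Lemma nearby_self (t : T) : E t -> nearby nu1 nu2 t t.1.1.
Proof.
move=> Et; split; first by have [] := Et.
apply/(half_turnP D t.1.1 Et) => j jI.
by have [_ /(_ j jI)[]] := transition_slice D Et.
Qed.

Lemma sheet_self y : sheet y y.
Proof.
split=> [|j _]; first exact: nearby_self (set_valP y).
by rewrite subrr normr0 invr_gt0.
Qed.

Lemma proj1_covering : covering (overlap (chart_at nu1) (chart_at nu2)) proj1.
Proof.
split; first exact: proj1_continuous.
  apply/seteqP; split=> [x [y _ <-]|x].
    by apply/(transition_overlap D); exists (set_val y) => //; exact: set_valP.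
  by move=> /(transition_overlap D)[t Et <-]; exists (of_transition Et).
move=> x /(transition_overlap D)[t Et tx].
pose t0 := of_transition Et.
have nE y : proj1 y = x -> nearby nu1 nu2 (set_val y) = nearby nu1 nu2 (set_val t0).
  by rewrite /proj1 /nearby => ->; rewrite tx.
have xd : chart_dom nu1 x by rewrite -tx; have [] := Et.
exists (nearby nu1 nu2 (set_val t0)); split.
- exact: nearby_open.
- by rewrite -tx; exact: nearby_self Et.
- apply/subsetP => x' /set_mem [x'd x't]; apply/mem_set/(transition_overlap D).
  by exists (transport nu1 nu2 t x'); first exact: (transport_transition D Et x'd x't).
(* The sheets over a neighbourhood of [x] are indexed by the fibre over [x]. *)
exists {y : E | proj1 y = x}, (fun y : {y : E | proj1 y = x} => sheet (sval y)); split.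
- by move=> y; exact: sheet_open.
- move=> [y1 y1x] [y2 y2x] y [_ /= s1] [_ /= s2].
  have e12 : y1 = y2.
    apply: val_inj; apply: (transition_close D (set_valP y1) (set_valP y2)) => [|j jI].
      by rewrite -[LHS]/(proj1 y1) -[RHS]/(proj1 y2) y1x.
    by apply: (@quarter_close (angle y j 0)); rewrite distrC; [exact: s1|exact: s2].
  by case: y2 / e12 y2x {s2} => y2x; congr exist; exact: Prop_irrelevance.
- apply/seteqP; split=> [y yn|y [[y0 y0x] _ [/= yn _]]]; last by rewrite /= -(nE y0).
  have [xd' xt'] : nearby nu1 nu2 (set_val y) x.
    split=> //; apply: half_turn_sym.
    by move: yn => [_]; rewrite [(set_val t0).1.1]tx.
  have Et' := transport_transition D (set_valP y) xd' xt'.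
  pose y0 := of_transition Et'; have y0x : proj1 y0 = x by [].
  exists (exist (fun y => proj1 y = x) y0 y0x); [exact: I|split].
    by rewrite [sval _]/= (nE y0 y0x).
  by move=> j jI; rewrite distrC; exact: (transport_small nu1 (set_val y) x jI).
- move=> [y0 y0x] /=; split.
  + by move=> y y' /set_mem ys /set_mem ys'; exact: sheet_inj ys ys'.
  + rewrite -(nE y0 y0x); apply/seteqP; split=> [x' [y ys <-]|x' xn]; first exact: ys.1.
    by have [y ys yE] := sheet_transport xn; exists y => //; rewrite /proj1 yE.
  + by move=> O; exact: sheet_open_map.
Qed.

End Sheets.

End TransitionCovering.

Section TransitionConnected.
Context {R : realType} {d n : nat} (v : 'I_n -> 'cV[R]_d) (l : 'I_n -> R)
  (Q : set 'cV[R]_d).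
Hypothesis D : quasi_data v l Q.
Local Notation T := ('rV[R]_(d + d) * 'rV[R]_(d + d) * 'cV[R]_n)%type.
Variables nu1 nu2 : vertex_index v l.
Local Notation sec := (chart_section nu1).
Local Notation E := (transition nu1 nu2).

Definition midpoint : 'rV[R]_d := 2^-1 *: (vtx nu1 + vtx nu2).

Definition gap (j : 'I_n) : R := pairing midpoint (v j) - l j.

Lemma vtx_ge nu j : l j <= pairing (vtx (v := v) (l := l) nu) (v j).
Proof.
case: (boolP (inI nu j)) => [/inI_active->//|jI].
by apply: ltW; exact: vtx_gt.
Qed.

Lemma gapE j : gap j = 2^-1 * ((pairing (vtx nu1) (v j) - l j) + (pairing (vtx nu2) (v j) - l j)).
Proof. by rewrite /gap /midpoint pairingZ pairingD; field. Qed.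

Lemma gap_both j : inI nu1 j -> inI nu2 j -> gap j = 0.
Proof. by move=> /inI_active e1 /inI_active e2; rewrite gapE e1 e2 !subrr addr0 mulr0. Qed.

Lemma gap_gt0 j : ~~ (inI nu1 j && inI nu2 j) -> 0 < gap j.
Proof.
rewrite negb_and gapE => /orP[]/vtx_gt jI; rewrite mulr_gt0 ?invr_gt0//.
  by rewrite ltr_pwDl// ?subr_gt0// subr_ge0 vtx_ge.
by rewrite ltr_wpDl// ?subr_gt0// subr_ge0 vtx_ge.
Qed.

Section Path.
Variable y : T.
Hypothesis Ey : E y.
Local Notation both j := (inI nu1 j && inI nu2 j).

(** Moduli squared are interpolated linearly towards the midpoint of the two
    vertices, whose active constraints are those common to both. *)
Definition path_sq (t : R) j : R := t ^+ 2 * sqabs (sec y.1.1) j + (1 - t ^+ 2) * gap j.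

Definition path_mod (t : R) : 'rV[R]_(n + n) := of_zcoord (fun j =>
  if both j then Complex (t * re (sec y.1.1) j) (t * im (sec y.1.1) j)
  else Complex (Num.sqrt (path_sq t j)) 0).

(** The phases are chosen so that the coordinates off [nu1] are positive reals,
    and those off [nu2] become so after the rotation by [t *: y.2]. *)
Definition path_level (t : R) : 'rV[R]_(n + n) := rot (- (t *: mask nu2 y.2)) (path_mod t).

Definition path (t : R) : T :=
  (restr nu1 (path_level t), restr nu2 (rot (t *: y.2) (path_level t)), t *: y.2).

Lemma re_path_mod t j : re (path_mod t) j =
  if both j then t * re (sec y.1.1) j else Num.sqrt (path_sq t j).
Proof. by rewrite re_of_zcoord; case: ifP. Qed.

Lemma im_path_mod t j : im (path_mod t) j = if both j then t * im (sec y.1.1) j else 0.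
Proof. by rewrite im_of_zcoord; case: ifP. Qed.

Lemma path_sq_gt0 t j : 0 <= t <= 1 -> ~~ both j -> 0 < path_sq t j.
Proof.
move=> /sqr01 t01 jI; rewrite /path_sq addrC; apply: convex_gt => //; first exact: gap_gt0.
have ov := (transition_overlap D nu1 nu2 y.1.1).2 (ex_intro2 _ _ _ Ey erefl).
have [xd h] := (overlapP D nu1 nu2 y.1.1).1 ov.
have sl := section_slice (qd_basis D nu1) xd.
rewrite lt_neqAle eq_sym sqabs_ge0 andbT.
case: (boolP (inI nu2 j)) => j2; last exact: h.
have j1 : ~~ inI nu1 j by move: jI; rewrite j2 andbT.
have [r0 i0] := sl.2 j j1.
by rewrite /sqabs i0 expr0n addr0 gt_eqF// exprn_gt0.
Qed.

Lemma sqabs_path t j : 0 <= t <= 1 -> sqabs (path_level t) j = path_sq t j.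
Proof.
move=> t01; rewrite sqabs_rot /sqabs re_path_mod im_path_mod.
case: ifPn => [/andP[j1 j2]|jI]; last first.
  by rewrite expr0n addr0 sqr_sqrtr// ltW// path_sq_gt0.
by rewrite /path_sq gap_both// mulr0 addr0 /sqabs; ring.
Qed.

Lemma path_in_level t : 0 <= t <= 1 -> level v l (path_level t).
Proof.
move=> t01; have sl := section_slice (qd_basis D nu1) (let: And5 xd _ _ _ _ := Ey in xd).
have [/levelP[mu muE] _] := sl.
apply/levelP; exists ((1 - t ^+ 2) *: midpoint + t ^+ 2 *: mu) => j.
rewrite sqabs_path// /path_sq /gap; move: midpoint => m.
by rewrite pairingD !pairingZ -muE; ring.
Qed.

Lemma path_transition t : 0 <= t <= 1 -> E (path t).
Proof.
move=> t01; have [_ _ y0 yr _] := Ey.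
have coordE (b : 'cV[R]_n) j : b j 0 = 0 -> ~~ both j ->
    0 < re (rot b (path_mod t)) j /\ im (rot b (path_mod t)) j = 0.
  move=> b0 jI; have bi : b j 0 \is a Num.int by rewrite b0 rpred0.
  have [-> ->] := rot_int_coord (path_mod t) bi.
  by rewrite re_path_mod im_path_mod (negbTE jI) sqrtr_gt0 path_sq_gt0.
have s1 : slice nu1 (path_level t).
  split=> [|j j1]; first exact: path_in_level.
  apply: coordE; last by rewrite (negbTE j1).
  rewrite !mxE; case: ifPn => [|j2]; first by rewrite mulr0 oppr0.
  by rewrite (y0 j j1 j2) mulr0 oppr0.
have [xd xE] := slice_section (qd_basis D nu1) s1.
rewrite /path -{2}xE; apply: (transition_mk D xd).
- by move=> j j1 j2; rewrite mxE (y0 j j1 j2) mulr0.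
- by rewrite lincombZ yr scaler0.
rewrite xE; split=> [|j j2]; first by apply: level_rot; exact: path_in_level.
rewrite /path_level -rotD; apply: coordE; last by rewrite (negbTE j2) andbF.
by rewrite !mxE (negbTE j2) subrr.
Qed.

Lemma path1 : path 1 = y.
Proof.
have [xd _ y0 _ _] := Ey; have [_ s1] := section_slice (qd_basis D nu1) xd.
have [_ s2] := transition_slice D Ey.
have posE (z : 'rV[R]_(n + n)) j : 0 < re z j -> im z j = 0 -> Num.sqrt (sqabs z j) = re z j.
  by move=> r0 i0; rewrite /sqabs i0 expr0n addr0 sqrtr_sqr gtr0_norm.
have sqE j : path_sq 1 j = sqabs (sec y.1.1) j.
  by rewrite /path_sq expr1n subrr mul0r addr0 mul1r.
have modE : path_mod 1 = rot (mask nu2 y.2) (sec y.1.1).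
  apply: zcoord_ext => j; rewrite (re_path_mod, im_path_mod);
    case: (boolP (inI nu2 j)) => j2; rewrite ?andbT ?andbF.
  - have mi : mask nu2 y.2 j 0 \is a Num.int by rewrite mxE j2 rpred0.
    have [-> _] := rot_int_coord (sec y.1.1) mi.
    case: ifPn => j1; first by rewrite mul1r.
    by have [r0 i0] := s1 j j1; rewrite sqE posE.
  - have [r0 i0] := s2 j j2.
    rewrite sqE -(sqabs_rot y.2) posE// !re_rot mxE (negbTE j2) //.
  - have mi : mask nu2 y.2 j 0 \is a Num.int by rewrite mxE j2 rpred0.
    have [_ ->] := rot_int_coord (sec y.1.1) mi.
    case: ifPn => j1; first by rewrite mul1r.
    by have [r0 i0] := s1 j j1.
  - by have [r0 i0] := s2 j j2; rewrite -i0 !im_rot mxE (negbTE j2).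
rewrite /path /path_level scale1r modE rotK scale1r restr_section -(transition_restr Ey).
by case: (y) => [[]].
Qed.

Lemma path0 : path 0 =
  (restr nu1 (of_zcoord (fun j => Complex (Num.sqrt (gap j)) 0)),
   restr nu2 (of_zcoord (fun j => Complex (Num.sqrt (gap j)) 0)), 0).
Proof.
rewrite /path !scale0r rot0; suff -> : path_level 0 = of_zcoord (fun j => Complex (Num.sqrt (gap j)) 0) by [].
rewrite /path_level scale0r oppr0 rot0; apply: zcoord_ext => j.
  have sqE : path_sq 0 j = gap j by rewrite /path_sq expr0n/= mul0r add0r subr0 mul1r.
  rewrite re_path_mod re_of_zcoord /= sqE mul0r.
  by case: ifP => // /andP[j1 j2]; rewrite gap_both// sqrtr0.
by rewrite im_path_mod im_of_zcoord mul0r; case: ifP.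
Qed.

Lemma path_continuous : continuous path.
Proof.
have tC : Ck 0 setT (fun t : R => t) by move=> t _; exact: cvg_id.
have zC (a : 'cV[R]_n) : vCk 0 setT (fun t : R => t *: a).
  move=> j; rewrite (_ : (fun t => _) = fun t => t * a j 0).
    exact: (CkM openT tC (Ck_cst 0 _ _)).
  by apply/funext => t; rewrite mxE.
have nC (a : 'cV[R]_n) : vCk 0 setT (fun t : R => - (t *: a)).
  move=> j; rewrite (_ : (fun t => _) = fun t => - ((t *: a) j 0)).
    exact: (CkN openT (zC a j)).
  by apply/funext => t; rewrite mxE.
have mC : zCk 0 setT path_mod.
  move=> j; split.
    rewrite (_ : (fun t => _) = fun t => if both j then t * re (sec y.1.1) j else Num.sqrt (path_sq t j)).
      case: (both j); first exact: (CkM openT tC (Ck_cst 0 _ _)).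
      move=> t _; apply: continuous_comp; last exact: sqrt_continuous.
      have sC : Ck 0 setT (fun t : R => t ^+ 2) := CkM openT tC tC.
      exact: (CkD openT (CkM openT sC (Ck_cst 0 _ _)) (CkM openT (CkB openT (Ck_cst 0 _ _) sC) (Ck_cst 0 _ _))) t I.
    by apply/funext => t; rewrite re_path_mod.
  rewrite (_ : (fun t => _) = fun t => if both j then t * im (sec y.1.1) j else 0).
    by case: (both j); [exact: (CkM openT tC (Ck_cst 0 _ _))|exact: (Ck_cst 0)].
  by apply/funext => t; rewrite im_path_mod.
have lC : zCk 0 setT path_level by apply: (zCk_rot openT (nC _) mC).
move=> t.
have c1 : {for t, continuous (fun t : R => restr nu1 (path_level t))}.
  exact: (zCk_Ck openT (zCk_restr nu1 lC)) t I.
have c2 : {for t, continuous (fun t : R => restr nu2 (rot (t *: y.2) (path_level t)))}.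
  exact: (zCk_Ck openT (zCk_restr nu2 (zCk_rot openT (zC _) lC))) t I.
have c3 : {for t, continuous (fun t : R => t *: y.2)}.
  exact: (vCk_Ck openT (zC _)) t I.
exact: (continuous_pair (continuous_pair c1 c2) c3).
Qed.

End Path.

(** All the paths start at the same point, which lies over the midpoint of the two
    vertices and carries the zero relation. *)
Lemma transition_connected : connected [set: E].
Proof.
apply: connected_set_type; apply: (@connected_paths R _ E
  (restr nu1 (of_zcoord (fun j => Complex (Num.sqrt (gap j)) 0)),
   restr nu2 (of_zcoord (fun j => Complex (Num.sqrt (gap j)) 0)), 0)) => y Ey.
exists (path y); split; [exact: path_continuous|exact: path0|exact: path1|exact: path_transition].
Qed.

End TransitionConnected.

Lemma continuous_compose (T U V : topologicalType) (f : T -> U) (g : U -> V) :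
  continuous f -> continuous g -> continuous (g \o f).
Proof. by move=> cf cg x; apply: continuous_comp; [exact: cf|exact: cg]. Qed.

Section CoveringHomeomorphism.
Context {V Y Y' : topologicalType} (s : Y -> Y') (s' : Y' -> Y).
Hypotheses (cs : continuous s) (cs' : continuous s') (sK : cancel s s') (s'K : cancel s' s).
Implicit Types (W : set V) (p : Y' -> V) (G : set (V -> V)).

Lemma homeo_open (O : set Y) : open O -> open (s @` O).
Proof.
move=> oO; rewrite (_ : s @` O = s' @^-1` O).
  by apply: open_comp => // y _; exact: cs'.
apply/seteqP; split=> [_ [y Oy <-]|y Oy]; first by rewrite /= sK.
by exists (s' y) => //; exact: s'K.
Qed.

Lemma covering_homeo W p : covering W p -> covering W (p \o s).
Proof.
move=> [cp rp ev]; split.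
- by move=> y; apply: continuous_comp; [exact: cs|exact: cp].
- rewrite -rp; apply/seteqP; split=> [_ [y _ <-]|_ [y _ <-]]; first by exists (s y).
  by exists (s' y) => //=; rewrite s'K.
- move=> x /ev[U [oU Ux UW [J [S [oS dS pU SP]]]]]; exists U; split=> //.
  exists J, (fun j => s @^-1` S j); split.
  + by move=> j; apply: open_comp => // y _; exact: cs.
  + by move=> i j y; exact: dS.
  + by rewrite comp_preimage pU preimage_bigcup.
  + move=> j; have [iS SU oSO] := SP j; split.
    * move=> y y' /set_mem yS /set_mem yS' pyy; apply: (can_inj sK).
      by apply: iS pyy; exact/mem_set.
    * rewrite -SU; apply/seteqP; split=> [_ [y Sy <-]|_ [y Sy <-]]; first by exists (s y).
      by exists (s' y) => /=; rewrite s'K.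
    * move=> O oO OS; rewrite -image_comp; apply: oSO; first exact: homeo_open.
      by move=> _ [y /OS Sy <-].
Qed.

Lemma lifts_homeo G p g : lifts G (p \o s) g <-> lifts G p (s \o g \o s').
Proof.
split=> [[[cg [g' cg' [gK g'K]]] [gam Gg gE]]|[[cg [g' cg' [gK g'K]]] [gam Gg gE]]].
  split; last by exists gam => // y; have := gE (s' y); rewrite /= s'K.
  split; first exact: (continuous_compose cs' (continuous_compose cg cs)).
  exists (s \o g' \o s').
    exact: (continuous_compose cs' (continuous_compose cg' cs)).
  by split=> y /=; rewrite sK ?gK ?g'K s'K.
split; last by exists gam => // y; have := gE (s y); rewrite /= sK.
have gE' y : g y = s' ((s \o g \o s') (s y)) by rewrite /= !sK.
split.
  rewrite (_ : g = s' \o (s \o g \o s') \o s); last by apply/funext => y; exact: gE'.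
  exact: (continuous_compose cs (continuous_compose cg cs')).
exists (s' \o g' \o s).
  exact: (continuous_compose cs (continuous_compose cg' cs')).
split=> y /=.
  have := gK (s y); rewrite /= sK => /(congr1 s'); by rewrite sK.
have := g'K (s y); rewrite /= => /(congr1 s'); by rewrite !sK.
Qed.

Lemma model_covering_homeo W G p : model_covering W G p -> model_covering W G (p \o s).
Proof.
move=> [cY cov ex]; split.
- have -> : [set: Y] = s' @` [set: Y'].
    by apply/seteqP; split=> // y _; exists (s y) => //; exact: sK.
  by apply: connected_continuous_connected => //; exact: continuous_subspaceT.
- exact: covering_homeo.
- move=> y y' yy; have [g gl gy] := ex (s y) (s y') yy.
  exists (s' \o g \o s); last by rewrite /= gy sK.
  apply/lifts_homeo; rewrite (_ : _ \o _ \o s' = g)//.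
  by apply/funext => z /=; rewrite !s'K.
Qed.

End CoveringHomeomorphism.

Lemma connected_int_const (R : realType) (Y : topologicalType) (f : Y -> R) (c : R) :
  connected [set: Y] -> continuous f -> (forall y, f y + c \is a Num.int) ->
  forall y y', f y = f y'.
Proof.
move=> cY cf fint y y'.
have ball_int z : `|f z - f y'| < 1 -> f z = f y'.
  have /intrP[m mE] : f z - f y' \is a Num.int.
    rewrite (_ : _ - _ = (f z + c) - (f y' + c)); last by ring.
    by rewrite rpredB.
  rewrite mE => m1; apply/subr0_eq; rewrite mE; apply/eqP; move: m1.
  by apply: contraTT => m0; rewrite -leNgt norm_intr_ge1// intr_int.
suff : [set z | f z = f y'] = [set: Y] by move=> /seteqP[_ /(_ y I)].
apply: cY; first by exists y'.
  exists (f @^-1` ball (f y') 1); first by apply: open_comp; [move=> z _; exact: cf|exact: ball_open].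
  rewrite setTI; apply/seteqP; split=> z.
    by move=> /= ->; exact: ballxx.
  by move=> fz; apply: ball_int; rewrite distrC; exact: fz.
exists (f @^-1` [set f y']); last by rewrite setTI.
by apply: closed_comp => [z _|]; [exact: cf|exact: closed_eq].
Qed.

Section Lifts.
Context {R : realType} {d n : nat} (v : 'I_n -> 'cV[R]_d) (l : 'I_n -> R)
  (Q : set 'cV[R]_d).
Hypothesis D : quasi_data v l Q.
Local Notation N := (torus_subgroup v Q).
Local Notation T := ('rV[R]_(d + d) * 'rV[R]_(d + d) * 'cV[R]_n)%type.
Local Notation chart_at nu := (Chart (chart_dom nu) (chart_grp N nu) (chart_par N nu)).
Implicit Types (nu : vertex_index v l) (b e : 'cV[R]_n).

Lemma rot_continuous p (b : 'cV[R]_p) : continuous (rot b : 'rV[R]_(p + p) -> _).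
Proof.
move=> z; have sm := rot_smooth b (openT : open [set: 'rV[R]_(p + p)]).
exact: (sm [::] z I).1.
Qed.

Definition swapT nu1 nu2 (y : transition nu1 nu2) : transition nu2 nu1 :=
  of_transition (swap_transition (set_valP y)).

Lemma proj1_swapT nu1 nu2 (y : transition nu1 nu2) : proj1 (swapT y) = proj2 y.
Proof. exact: erefl. Qed.

Lemma swapT_K nu1 nu2 : cancel (@swapT nu1 nu2) (@swapT nu2 nu1).
Proof. by move=> y; apply: val_inj; exact: swapK. Qed.

Lemma swapT_continuous nu1 nu2 : continuous (@swapT nu1 nu2).
Proof.
apply: continuous_comp_initial => y.
apply: (@continuous_comp _ _ _ set_val swap); first exact: initial_continuous.
rewrite /swap; apply: continuous_pair; first apply: continuous_pair.
- by apply: continuous_comp; [exact: continuous_fst|exact: continuous_snd].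
- by apply: continuous_comp; [exact: continuous_fst|exact: continuous_fst].
- by apply: continuous_comp; [exact: continuous_snd|exact: opp_continuous].
Qed.

Section Deck.
Variables nu1 nu2 : vertex_index v l.
Local Notation E := (transition nu1 nu2).
Implicit Types (y : E).

Lemma angle_rel y : lincomb v (angle y) = 0.
Proof. by have [_ _ _ vy _] := set_valP y. Qed.

(** The data of a simultaneous lift of an element [exp b] of the group of the
    first chart and of an element [exp (b + e)] of the group of the second. *)
Definition deck_data b e : Prop :=
  [/\ Q (lincomb v b), forall j, ~~ inI nu1 j -> b j 0 \is a Num.int,
      forall j, ~~ inI nu2 j -> (b + e) j 0 \is a Num.int,
      lincomb v e = 0 & forall j, ~~ inI nu1 j -> ~~ inI nu2 j -> e j 0 = 0].

Definition deckT b e (t : T) : T :=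
  (rot (restrc nu1 b) t.1.1, rot (restrc nu2 (b + e)) t.1.2, t.2 + e).

Lemma deckT_transition b e t : deck_data b e -> E t -> E (deckT b e t).
Proof.
move=> [Qb b1 b2 ve e0] [d1 d2 t0 vt tE]; split.
- exact: (chart_dom_rot nu1 (restrc nu1 b) t.1.1).2 d1.
- exact: (chart_dom_rot nu2 (restrc nu2 (b + e)) t.1.2).2 d2.
- by move=> j j1 j2; rewrite mxE (t0 j j1 j2) (e0 j j1 j2) addr0.
- by rewrite lincombD vt ve addr0.
- rewrite (section_rot _ b2) (section_rot _ b1) tE -!rotD /=.
  by congr rot; rewrite addrC [b + e]addrC addrA.
Qed.

Lemma deck_dataN b e : deck_data b e -> deck_data (- b) (- e).
Proof.
move=> [Qb b1 b2 ve e0]; split.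
- by rewrite lincombN; exact: (Q_opp D).
- by move=> j j1; rewrite mxE rpredN; exact: b1.
- by move=> j j2; rewrite -opprD mxE rpredN; exact: b2.
- by rewrite lincombN ve oppr0.
- by move=> j j1 j2; rewrite mxE (e0 j j1 j2) oppr0.
Qed.

Lemma deckTK b e : cancel (deckT b e) (deckT (- b) (- e)).
Proof.
have rN nu (c : 'cV[R]_n) : restrc nu (- c) = - restrc nu c by apply/colP => k; rewrite !mxE.
by move=> [[x z] a]; rewrite /deckT /= -opprD !rN !rotK addrK.
Qed.

Definition deck b e (be : deck_data b e) y : E :=
  of_transition (deckT_transition be (set_valP y)).

Lemma deck_continuous b e (be : deck_data b e) : continuous (deck be).
Proof.
apply: continuous_comp_initial => y.
apply: (@continuous_comp _ _ _ set_val (deckT b e)); first exact: initial_continuous.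
rewrite /deckT; apply: continuous_pair; first apply: continuous_pair.
- apply: (@continuous_comp _ _ _ (fun t : T => t.1.1)); last exact: rot_continuous.
  by apply: continuous_comp; [exact: continuous_fst|exact: continuous_fst].
- apply: (@continuous_comp _ _ _ (fun t : T => t.1.2)); last exact: rot_continuous.
  by apply: continuous_comp; [exact: continuous_fst|exact: continuous_snd].
- by apply: continuousD; [exact: continuous_snd|exact: cst_continuous].
Qed.

Lemma deck_homeomorphism b e (be : deck_data b e) : homeomorphism (deck be).
Proof.
split; first exact: deck_continuous.
exists (deck (deck_dataN be)); first exact: deck_continuous.
split=> y; apply: val_inj; first exact: deckTK.
by have := deckTK (- b) (- e) (set_val y); rewrite !opprK.
Qed.

Lemma lifts_ex y y' :
  (exists2 gam, chart_grp N nu1 gam & proj1 y' = gam (proj1 y)) ->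
  exists2 g, lifts (chart_grp N nu1) (@proj1 _ _ _ _ _ nu1 nu2) g & g y = y'.
Proof.
move=> [gam /chart_grpP[b [Qb b1 ->]] yE].
have [d1 d2 y0 vy ye] := set_valP y; have [d1' d2' y0' vy' ye'] := set_valP y'.
pose e : 'cV[R]_n := angle y' - angle y.
have be : deck_data b e.
  split=> //; last 2 first.
  - by rewrite lincombB vy vy' subrr.
  - by move=> j j1 j2; rewrite !mxE (y0 j j1 j2) (y0' j j1 j2) subrr.
  have s1 := transition_slice D (set_valP y); have s2 := transition_slice D (set_valP y').
  apply: (slice_rot_int s1).
  rewrite -[(set_val y').1.1]/(proj1 y') yE (section_rot _ b1) in s2.
  rewrite -!rotD in s2 *; rewrite (_ : b + e + _ = angle y' + b)//.
  by rewrite /e -addrA subrK addrC.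
exists (deck be).
  split; first exact: deck_homeomorphism.
  by exists (rot (restrc nu1 b)) => //; apply/chart_grpP; exists b.
apply: val_inj; apply: (transition_inj D (set_valP (deck be y)) (set_valP y')).
  exact/esym/yE.
by move=> j _; rewrite /= -/(angle y) -/(angle y') mxE mxE addrC mxE subrK.
Qed.

(** Along a lift the change of angles is locally constant, hence constant; this
    is how a lift for the first projection determines one for the second. *)
Lemma lifts_sub (y0 : E) g :
  lifts (chart_grp N nu1) (@proj1 _ _ _ _ _ nu1 nu2) g ->
  lifts (chart_grp N nu2) (@proj2 _ _ _ _ _ nu1 nu2) g.
Proof.
move=> [hg [gam /chart_grpP[b [Qb b1 ->]] gE]]; split=> //.
have [cg _] := hg.
pose e := angle (g y0) - angle y0.
have aint y j : ~~ inI nu2 j -> (b + (angle (g y) - angle y)) j 0 \is a Num.int.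
  have s1 := transition_slice D (set_valP y); have s2 := transition_slice D (set_valP (g y)).
  apply: (slice_rot_int s1).
  rewrite -[(set_val (g y)).1.1]/(proj1 (g y)) gE (section_rot _ b1) in s2.
  rewrite -!rotD in s2 *; rewrite (_ : b + _ + _ = angle (g y) + b)//.
  by rewrite -addrA subrK addrC.
have eE y : angle (g y) = angle y + e.
  apply/subr0_eq/(rel_inj (qd_basis D nu2)) => [|j j2].
    by rewrite lincombB lincombD /e lincombB !angle_rel !(addr0, subr0).
  pose f y := angle (g y) j 0 - angle y j 0.
  have cf : continuous f.
    move=> z; apply: continuousB; last exact: angle_continuous.
    exact: (continuous_compose cg (@angle_continuous _ _ _ _ _ nu1 nu2 j)).
  have fint z : f z + b j 0 \is a Num.int.
    by rewrite addrC; have := aint z j j2; rewrite !mxE.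
  have := connected_int_const (@transition_connected _ _ _ _ _ _ D nu1 nu2) cf fint y y0.
  rewrite /f => fE; rewrite /e !mxE -fE; ring.
have be2 j : ~~ inI nu2 j -> (b + e) j 0 \is a Num.int by exact: aint.
have ve : lincomb v e = 0.
  by rewrite lincombB !angle_rel subrr.
exists (rot (restrc nu2 (b + e))).
  by apply/chart_grpP; exists (b + e); rewrite lincombD ve addr0.
move=> y; rewrite [proj2 (g y)](transition_restr (set_valP (g y))).
rewrite [proj2 y](transition_restr (set_valP y)) -restr_rot.
rewrite -[(set_val (g y)).1.1]/(proj1 (g y)) gE (section_rot _ b1) -!rotD.
have aE : (set_val (g y)).2 + b = (b + e) + (set_val y).2.
  by rewrite -[(set_val (g y)).2]/(angle (g y)) eE -addrA [e + b]addrC addrC.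
by rewrite aE.
Qed.

End Deck.

Lemma transition_compatible nu1 nu2 :
  overlap (chart_at nu1) (chart_at nu2) !=set0 ->
  compatible_charts (chart_at nu1) (chart_at nu2).
Proof.
move=> [x0 /(transition_overlap D)[t0 Et0 _]].
pose y0 := of_transition Et0.
have cs12 := @swapT_continuous nu1 nu2; have cs21 := @swapT_continuous nu2 nu1.
have K12 := @swapT_K nu1 nu2; have K21 := @swapT_K nu2 nu1.
have mc mu1 mu2 : model_covering (overlap (chart_at mu1) (chart_at mu2))
    (chart_grp N mu1) (@proj1 _ _ _ v l mu1 mu2).
  split; [exact: (@transition_connected _ _ _ _ _ _ D)|exact: (proj1_covering D)|].
  exact: (@lifts_ex mu1 mu2).
exists (transition nu1 nu2), (@proj1 _ _ _ v l nu1 nu2), (@proj2 _ _ _ v l nu1 nu2).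
split.
- exact: mc.
- exact: (model_covering_homeo cs12 cs21 K12 K21 (mc nu2 nu1)).
- move=> y; have [d1 d2 _ vy yE] := set_valP y; apply/(parP D d1 d2).
  by exists (angle y); rewrite angle_rel; split; [exact: (qd_zero D)|exact: yE].
- move=> y.
  pose O := sheet y `&` (@swapT nu1 nu2) @^-1` sheet (swapT y).
  have oO : open O.
    apply: openI; first exact: sheet_open.
    by apply: open_comp => [z _|]; [exact: cs12|exact: sheet_open].
  exists O, (fun x' => (transport nu1 nu2 (set_val y) x').1.2),
    (fun x' => (transport nu2 nu1 (set_val (swapT y)) x').1.2).
  have O1 : O `<=` sheet y by move=> z [].
  have O2 : @swapT nu1 nu2 @` O `<=` sheet (swapT y) by move=> _ [z [_ zs] <-].
  have p2E : @proj2 _ _ _ v l nu1 nu2 @` O = @proj1 _ _ _ v l nu2 nu1 @` (@swapT nu1 nu2 @` O).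
    apply/seteqP; split=> [_ [z Oz <-]|_ [_ [z Oz <-] <-]].
      exact: (ex_intro2 _ _ (swapT z) (ex_intro2 _ _ z Oz erefl) (proj1_swapT z)).
    exact: (ex_intro2 _ _ z Oz (esym (proj1_swapT z))).
  split.
  + by split; [exact: oO|split; [exact: (@sheet_self _ _ _ _ _ _ D nu1 nu2 y)|exact: (@sheet_self _ _ _ _ _ _ D nu2 nu1 (swapT y))]].
  + split; first exact: (sheet_open_map D oO O1).
    by rewrite p2E; apply: (sheet_open_map D _ O2); exact: (homeo_open cs21 K12 K21 oO).
  + split; apply: smooth_onS (transport_smooth D (set_valP _)).
      by move=> _ [z /O1 [zn _] <-].
    by rewrite p2E => _ [z /O2 [zn _] <-].
  + move=> z Oz; split; first by rewrite -(sheetE D (O1 z Oz)).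
    have sz : sheet (swapT y) (swapT z) := O2 _ (ex_intro2 _ _ z Oz erefl).
    by rewrite -proj1_swapT -(sheetE D sz).
- apply/seteqP; split=> g; first exact: (lifts_sub y0).
  move=> /(lifts_homeo cs12 cs21 K12 K21 _ (@proj1 _ _ _ v l nu2 nu1)) gl.
  apply/(lifts_homeo cs12 cs21 K12 K21 _ (@proj2 _ _ _ v l nu2 nu1)).
  exact: (lifts_sub (swapT y0) gl).
Qed.

End Lifts.

(** * The symplectic form *)

Section Derivatives.
Context {R : realType} {V : normedModType R}.
Implicit Types (f g : V -> R) (x u : V).

Lemma is_derive_sumE (I : Type) (r : seq I) (P : pred I) (F : I -> V -> R) (dF : I -> R) x u :
  (forall i, is_derive x u (F i) (dF i)) ->
  is_derive x u (fun y => \sum_(i <- r | P i) F i y) (\sum_(i <- r | P i) dF i).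
Proof.
move=> FD; elim: r => [|i r IH].
  rewrite big_nil (_ : (fun y => _) = cst 0); first exact: is_derive_cst.
  by apply/funext => y; rewrite big_nil.
rewrite big_cons; case Pi: (P i).
  rewrite (_ : (fun y => _) = F i + (fun y => \sum_(i <- r | P i) F i y)).
    exact: is_deriveD.
  by apply/funext => y; rewrite big_cons Pi.
by rewrite (_ : (fun y => _) = fun y => \sum_(i <- r | P i) F i y)//; apply/funext => y; rewrite big_cons Pi.
Qed.

Lemma is_deriveM_fun f g df dg x u : is_derive x u f df -> is_derive x u g dg ->
  is_derive x u (fun y => f y * g y) (f x * dg + g x * df).
Proof. by move=> fd gd; exact: is_deriveM. Qed.

Lemma is_deriveD_fun f g df dg x u : is_derive x u f df -> is_derive x u g dg ->
  is_derive x u (fun y => f y + g y) (df + dg).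
Proof. by move=> fd gd; exact: is_deriveD. Qed.

Lemma is_deriveB_fun f g df dg x u : is_derive x u f df -> is_derive x u g dg ->
  is_derive x u (fun y => f y - g y) (df - dg).
Proof. by move=> fd gd; exact: is_deriveB. Qed.

Lemma is_derive_trig f df x u : is_derive x u f df ->
  is_derive x u (fun y => tcos (f y)) (- tsin (f x) * (2 * pi * df)) /\
  is_derive x u (fun y => tsin (f y)) (tcos (f x) * (2 * pi * df)).
Proof.
move=> fd; have cd : is_derive x u (fun y => 2 * pi * f y) (2 * pi * df).
  apply: is_derive_eq (is_deriveM_fun (is_derive_cst (2 * pi) x u) fd) _.
  by rewrite /cst mulr0 addr0.
by split; [exact: (is_derive_chain cd (is_derive_cos _))|exact: (is_derive_chain cd (is_derive_sin _))].
Qed.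

Lemma near_derive0 f x u : (\forall y \near x, f y = 0) -> 'D_u f x = 0.
Proof. by move=> f0; rewrite (near_eq_derive u f0) (derive_cst (0 : R)). Qed.

End Derivatives.

Section FormOfDerivatives.
Context {R : realType} {V : normedModType R}.
Implicit Types (x u : V).

Lemma re_derive p (g : V -> 'rV[R]_(p + p)) x u j : derivable g x u ->
  re ('D_u g x) j = 'D_u (fun y => re (g y) j) x.
Proof. by move=> gd; rewrite /re derive_mx// mxE. Qed.

Lemma im_derive p (g : V -> 'rV[R]_(p + p)) x u j : derivable g x u ->
  im ('D_u g x) j = 'D_u (fun y => im (g y) j) x.
Proof. by move=> gd; rewrite /im derive_mx// mxE. Qed.

Lemma re_is_derive p (g : V -> 'rV[R]_(p + p)) x u j : derivable g x u ->
  is_derive x u (fun y => re (g y) j) (re ('D_u g x) j).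
Proof.
by move=> gd; rewrite re_derive//; apply: derivableP; exact: (derivable_mxP _ _ _).1.
Qed.

Lemma im_is_derive p (g : V -> 'rV[R]_(p + p)) x u j : derivable g x u ->
  is_derive x u (fun y => im (g y) j) (im ('D_u g x) j).
Proof.
by move=> gd; rewrite im_derive//; apply: derivableP; exact: (derivable_mxP _ _ _).1.
Qed.

Lemma derivable_zcoord p (g : V -> 'rV[R]_(p + p)) x u :
  (forall j, derivable (fun y => re (g y) j) x u /\ derivable (fun y => im (g y) j) x u) ->
  derivable g x u.
Proof.
move=> gd; apply/derivable_mxP => i j; rewrite ord1; case: (splitP j) => r jr.
  by have -> : j = lshift p r; [exact: val_inj|exact: (gd r).1].
by have -> : j = rshift p r; [exact: val_inj|exact: (gd r).2].
Qed.

Section Rotated.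
Context {p : nat}.
Variables (w : V -> 'rV[R]_(p + p)) (a : V -> 'cV[R]_p) (x u : V).
Hypotheses (wd : derivable w x u) (ad : derivable a x u).

Lemma coord_is_derive j : is_derive x u (fun y => a y j 0) (('D_u a x) j 0).
Proof.
by rewrite derive_mx// mxE; apply: derivableP; exact: (derivable_mxP _ _ _).1.
Qed.

Lemma sqabs_is_derive j : is_derive x u (fun y => sqabs (w y) j)
  (2 * (re (w x) j * re ('D_u w x) j + im (w x) j * im ('D_u w x) j)).
Proof.
have rd := re_is_derive j wd; have id := im_is_derive j wd.
apply: is_derive_eq (is_deriveD_fun (is_deriveM_fun rd rd) (is_deriveM_fun id id)) _.
ring.
Qed.

Let c j := tcos (a x j 0).
Let s j := tsin (a x j 0).

Lemma rot_is_derive j :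
  is_derive x u (fun y => re (rot (a y) (w y)) j)
    (c j * (re ('D_u w x) j - 2 * pi * ('D_u a x) j 0 * im (w x) j)
     - s j * (im ('D_u w x) j + 2 * pi * ('D_u a x) j 0 * re (w x) j)) /\
  is_derive x u (fun y => im (rot (a y) (w y)) j)
    (c j * (im ('D_u w x) j + 2 * pi * ('D_u a x) j 0 * re (w x) j)
     + s j * (re ('D_u w x) j - 2 * pi * ('D_u a x) j 0 * im (w x) j)).
Proof.
have rd := re_is_derive j wd; have id := im_is_derive j wd.
have [cd sd] := is_derive_trig (coord_is_derive j).
split.
  rewrite (_ : (fun y => _) = fun y => tcos (a y j 0) * re (w y) j - tsin (a y j 0) * im (w y) j).
    apply: is_derive_eq (is_deriveB_fun (is_deriveM_fun cd rd) (is_deriveM_fun sd id)) _.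
    rewrite /c /s; ring.
  by apply/funext => y; rewrite re_rot.
rewrite (_ : (fun y => _) = fun y => tcos (a y j 0) * im (w y) j + tsin (a y j 0) * re (w y) j).
  apply: is_derive_eq (is_deriveD_fun (is_deriveM_fun cd id) (is_deriveM_fun sd rd)) _.
  rewrite /c /s; ring.
by apply/funext => y; rewrite im_rot.
Qed.

Lemma rot_derivable : derivable (fun y => rot (a y) (w y)) x u.
Proof.
apply: derivable_zcoord => j.
by have [[rd _] [id _]] := rot_is_derive j.
Qed.

Lemma re_rot_derive j : re ('D_u (fun y => rot (a y) (w y)) x) j =
  c j * (re ('D_u w x) j - 2 * pi * ('D_u a x) j 0 * im (w x) j)
     - s j * (im ('D_u w x) j + 2 * pi * ('D_u a x) j 0 * re (w x) j).
Proof. by have [[_ <-] _] := rot_is_derive j; rewrite (re_derive _ rot_derivable). Qed.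

Lemma im_rot_derive j : im ('D_u (fun y => rot (a y) (w y)) x) j =
  c j * (im ('D_u w x) j + 2 * pi * ('D_u a x) j 0 * re (w x) j)
     + s j * (re ('D_u w x) j - 2 * pi * ('D_u a x) j 0 * im (w x) j).
Proof. by have [_ [_ <-]] := rot_is_derive j; rewrite (im_derive _ rot_derivable). Qed.

End Rotated.

Lemma rot_form_identity (X1 Y1 X2 Y2 S1 S2 C S P A1 A2 r1 i1 r2 i2 r i : R) :
  X1 = C * (r1 - 2 * P * A1 * i) - S * (i1 + 2 * P * A1 * r) ->
  Y1 = C * (i1 + 2 * P * A1 * r) + S * (r1 - 2 * P * A1 * i) ->
  X2 = C * (r2 - 2 * P * A2 * i) - S * (i2 + 2 * P * A2 * r) ->
  Y2 = C * (i2 + 2 * P * A2 * r) + S * (r2 - 2 * P * A2 * i) ->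
  S1 = 2 * (r * r1 + i * i1) -> S2 = 2 * (r * r2 + i * i2) -> C ^+ 2 + S ^+ 2 = 1 ->
  X1 * Y2 - Y1 * X2 = (r1 * i2 - i1 * r2) + P * (A2 * S1 - A1 * S2).
Proof.
move=> -> -> -> -> -> -> CS; transitivity ((C ^+ 2 + S ^+ 2) *
  ((r1 - 2 * P * A1 * i) * (i2 + 2 * P * A2 * r) - (i1 + 2 * P * A1 * r) * (r2 - 2 * P * A2 * i))).
  by ring.
by rewrite CS; ring.
Qed.

(** Rotating a map [w] by variable angles [a] changes the pullback of the form
    by terms that pair the derivative of [a] with that of the moment map. *)
Lemma std_form_rot p (w : V -> 'rV[R]_(p + p)) (a : V -> 'cV[R]_p) x u1 u2 :
  derivable w x u1 -> derivable w x u2 -> derivable a x u1 -> derivable a x u2 ->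
  \sum_j ('D_u1 a x) j 0 * 'D_u2 (fun y => sqabs (w y) j) x = 0 ->
  \sum_j ('D_u2 a x) j 0 * 'D_u1 (fun y => sqabs (w y) j) x = 0 ->
  std_form ('D_u1 (fun y => rot (a y) (w y)) x) ('D_u2 (fun y => rot (a y) (w y)) x) =
  std_form ('D_u1 w x) ('D_u2 w x).
Proof.
move=> w1 w2 a1 a2 e12 e21; rewrite /std_form; congr (_ * _).
transitivity (\sum_j (re ('D_u1 w x) j * im ('D_u2 w x) j - im ('D_u1 w x) j * re ('D_u2 w x) j) +
  pi * (\sum_j ('D_u2 a x) j 0 * 'D_u1 (fun y => sqabs (w y) j) x -
        \sum_j ('D_u1 a x) j 0 * 'D_u2 (fun y => sqabs (w y) j) x)); last first.
  by rewrite e12 e21 subrr mulr0 addr0.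
rewrite -sumrB mulr_sumr -big_split; apply: eq_bigr => j _ /=.
have [_ s1] := sqabs_is_derive w1 j; have [_ s2] := sqabs_is_derive w2 j.
exact: (rot_form_identity (re_rot_derive w1 a1 j) (im_rot_derive w1 a1 j)
  (re_rot_derive w2 a2 j) (im_rot_derive w2 a2 j) s1 s2 (tcos2Dtsin2 _)).
Qed.

End FormOfDerivatives.

Section StandardForm.
Context {R : realType} {p : nat}.
Implicit Types (u w : 'rV[R]_(p + p)).

Lemma std_formDl c u1 u2 w :
  std_form (c *: u1 + u2) w = c * std_form u1 w + std_form u2 w.
Proof.
rewrite /std_form [c * _]mulrCA -mulrDr; congr (_ * _).
rewrite mulr_sumr -big_split; apply: eq_bigr => j _ /=; rewrite !(reD, imD, reZ, imZ); ring.
Qed.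

Lemma std_form_anti u w : std_form u w = - std_form w u.
Proof.
rewrite /std_form -mulrN; congr (_ * _); rewrite -sumrN.
by apply: eq_bigr => j _; ring.
Qed.

Lemma std_form_alt u : std_form u u = 0.
Proof.
rewrite /std_form big1 ?mulr0// => j _; ring.
Qed.

(** The form is nondegenerate because multiplication by the imaginary unit
    turns it into a multiple of the Euclidean scalar product. *)
Lemma std_form_nondegenerate u : (forall w, std_form u w = 0) -> u = 0.
Proof.
move=> /(_ (of_zcoord (fun j => Complex (- im u j) (re u j)))) /eqP.
rewrite /std_form mulf_eq0 invr_eq0 (gt_eqF (pi_gt0 R)) /= => /eqP u0.
have s0 j : sqabs u j = 0.
  have /eqP : \sum_j sqabs u j = 0.
    rewrite -[RHS]u0; apply: eq_bigr => i _.
    by rewrite re_of_zcoord im_of_zcoord /sqabs /=; ring.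
  rewrite psumr_eq0 => [/allP/(_ j (mem_index_enum j))/eqP//|i _].
  exact: sqabs_ge0.
by apply: zcoord_ext => j; have [r0 i0] := sqabs_neq0 (s0 j); rewrite ?r0 ?i0 /re /im mxE.
Qed.

Lemma std_form_rot_cst (b : 'cV[R]_p) u w : std_form (rot b u) (rot b w) = std_form u w.
Proof.
rewrite /std_form; congr (_ * _); apply: eq_bigr => j _.
rewrite !re_rot !im_rot -[RHS]mul1r -(tcos2Dtsin2 (b j 0)); ring.
Qed.

Lemma derive_rot_cst {V : normedModType R} (b : 'cV[R]_p) (f : V -> 'rV[R]_(p + p)) (x u : V) :
  derivable f x u -> 'D_u (fun y => rot b (f y)) x = rot b ('D_u f x).
Proof.
move=> fd; have bd : derivable (fun=> b) x u := derivable_cst b x u.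
have D0 j : ('D_u (fun=> b) x) j 0 = 0 by rewrite (derive_cst b) mxE.
apply: zcoord_ext => j.
  rewrite (re_rot_derive fd bd) re_rot D0; ring.
rewrite (im_rot_derive fd bd) im_rot D0; ring.
Qed.

End StandardForm.

(* Rows form a complete normed space, to which Baire's theorem applies. *)
HB.instance Definition _ (R : realType) (p q : nat) := Complete.on 'M[R]_(p, q).

Section CountableBaire.
Context {R : realType} {m : nat}.
Implicit Types (W : set 'rV[R]_m).

(** Baire's theorem for countably many relatively closed sets covering an open set. *)
Lemma countable_cover_interior W (A : nat -> set 'rV[R]_m) : open W -> W !=set0 ->
  W `<=` \bigcup_k A k -> (forall k, W `&` closure (W `&` A k) `<=` A k) ->
  exists k B, [/\ open B, B !=set0, B `<=` W & B `<=` A k].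
Proof.
move=> oW W0 WA Acl; apply: contrapT => no.
have : dense (\bigcap_k ~` closure (W `&` A k)).
  apply: Baire => k; split; first exact/closed_openC/closed_closure.
  move=> O O0 oO; apply: contrapT => OF.
  have Ocl : O `<=` closure (W `&` A k).
    by move=> x Ox; apply: contrapT => nx; apply: OF; exists x.
  apply: no; exists k, (O `&` W); split.
  - exact: openI.
  - have [x Ox] := O0; have [y [[Wy _] Oy]] := Ocl x Ox O (open_nbhs_nbhs (conj oO Ox)).
    by exists y.
  - by move=> x [].
  - by move=> x [Ox Wx]; apply: Acl; split=> //; exact: Ocl.
move=> /(_ W W0 oW)[x [Wx xF]]; have [k _ Akx] := WA x Wx.
by apply: (xF k I); apply: subset_closure; split.
Qed.

Lemma eq_set_relatively_closed W (f g : 'rV[R]_m -> 'rV[R]_m) :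
  (forall x, W x -> {for x, continuous f}) -> (forall x, W x -> {for x, continuous g}) ->
  W `&` closure (W `&` [set x | f x = g x]) `<=` [set x | f x = g x].
Proof.
move=> fc gc x [Wx xcl] /=; apply: contrapT => /eqP; rewrite -subr_eq0 => fg.
have hc : {for x, continuous (fun y => f y - g y)}.
  by apply: continuousB; [exact: fc|exact: gc].
have nb : nbhs x [set y | f y - g y != 0].
  apply: (hc [set z | z != 0]); apply: open_nbhs_nbhs; split; last exact: fg.
  have -> : [set z : 'rV[R]_m | z != 0] = ~` [set 0].
    by apply/seteqP; split=> z /= /eqP.
  apply: closed_openC; apply: accessible_closed_set1.
  by apply: hausdorff_accessible; exact: norm_hausdorff.
have [y [[Wy fgy] /=]] := xcl _ nb.
by rewrite fgy subrr eqxx.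
Qed.

End CountableBaire.

Section SymplecticForms.
Context {R : realType} {d n : nat} (v : 'I_n -> 'cV[R]_d) (l : 'I_n -> R)
  (Q : set 'cV[R]_d).
Hypothesis D : quasi_data v l Q.
Local Notation N := (torus_subgroup v Q).
Local Notation T := ('rV[R]_(d + d) * 'rV[R]_(d + d) * 'cV[R]_n)%type.
Local Notation chart_at nu := (Chart (chart_dom nu) (chart_grp N nu) (chart_par N nu)).
Implicit Types (nu : vertex_index v l).

Lemma sum_enumI nu (F : 'I_n -> R) : (forall j, ~~ inI nu j -> F j = 0) ->
  \sum_j F j = \sum_k F (enumI nu k).
Proof.
move=> F0; rewrite (bigID (mem (enumI nu @: 'I_d)))/= [X in _ + X]big1 ?addr0; last first.
  move=> j /negP jI; apply: F0.
  by apply/notinIP => k kj; apply: jI; rewrite -kj imset_f.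
by rewrite big_imset//=; last by move=> ? ? _ _; exact: enumI_inj.
Qed.

(** Only the coordinates of the vertex contribute to the form when the others
    are kept real. *)
Lemma std_form_restr nu {V : normedModType R} (g : V -> 'rV[R]_(n + n)) x u1 u2 :
  derivable g x u1 -> derivable g x u2 ->
  (forall j, ~~ inI nu j -> \forall y \near x, im (g y) j = 0) ->
  std_form ('D_u1 g x) ('D_u2 g x) =
  std_form ('D_u1 (fun y => restr nu (g y)) x) ('D_u2 (fun y => restr nu (g y)) x).
Proof.
move=> g1 g2 g0; rewrite /std_form; congr (_ * _).
have reE u k : derivable g x u -> re ('D_u (fun y => restr nu (g y)) x) k = re ('D_u g x) (enumI nu k) /\
    im ('D_u (fun y => restr nu (g y)) x) k = im ('D_u g x) (enumI nu k).
  move=> gd; have rd : derivable (fun y => restr nu (g y)) x u.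
    apply: derivable_zcoord => i.
    have [r _] := re_is_derive (enumI nu i) gd; have [r' _] := im_is_derive (enumI nu i) gd.
    have reF : (fun y => re (restr nu (g y)) i) = fun y => re (g y) (enumI nu i).
      by apply/funext => y; exact: re_restr.
    have imF : (fun y => im (restr nu (g y)) i) = fun y => im (g y) (enumI nu i).
      by apply/funext => y; exact: im_restr.
    by rewrite reF imF; split; [exact: r|exact: r'].
  rewrite (re_derive k rd) (im_derive k rd) (re_derive (enumI nu k) gd) (im_derive (enumI nu k) gd).
  by split; congr ('D_u _ x); apply/funext => y; rewrite (re_restr, im_restr).
rewrite (sum_enumI (nu := nu)) => [|j jI].
  apply: eq_bigr => k _; have [e1 e2] := reE u1 k g1; have [e3 e4] := reE u2 k g2.
  by congr (_ * _ - _ * _); apply: esym; [exact: e1|exact: e4|exact: e2|exact: e3].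
have i1 : im ('D_u1 g x) j = 0 by rewrite (im_derive j g1); exact: (near_derive0 _ (g0 j jI)).
have i2 : im ('D_u2 g x) j = 0 by rewrite (im_derive j g2); exact: (near_derive0 _ (g0 j jI)).
by rewrite i1 i2 mulr0 mul0r subrr.
Qed.

Lemma section_derivable nu x u : chart_dom nu x -> derivable (chart_section nu) x u.
Proof.
move=> xd; have oU := @chart_dom_open _ _ _ v l nu.
have [_ + _] := zCk_Ck oU (zCk_section oU (zCk_id 1 (chart_dom nu)) (fun x xd => xd)).
exact.
Qed.

(** The coordinates of the section off the vertex are real, so they do not
    contribute to the pullback of the form. *)
Lemma chart_form_std nu x u1 u2 : chart_dom nu x -> chart_form nu x u1 u2 = std_form u1 u2.
Proof.
move=> xd; rewrite /chart_form (std_form_restr (nu := nu)).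
- rewrite (_ : (fun y => _) = id); last by apply/funext => y; exact: restr_section.
  by rewrite !derive_id.
- exact: section_derivable.
- exact: section_derivable.
- by move=> j jI; near=> y; exact: im_section_out.
Unshelve. all: by end_near. Qed.

Lemma chart_form_symplectic nu : symplectic_form (chart_dom nu) (chart_form nu).
Proof.
have oU := @chart_dom_open _ _ _ v l nu.
have nearE u1 u2 x : chart_dom nu x -> \forall y \near x, chart_form nu y u1 u2 = std_form u1 u2.
  move=> xd; have : nbhs x (chart_dom nu) by apply: open_nbhs_nbhs.
  by apply: filterS => y; exact: chart_form_std.
have D0 u u1 u2 x : chart_dom nu x -> 'D_u (fun y => chart_form nu y u1 u2) x = 0.
  by move=> xd; rewrite (near_eq_derive u (nearE u1 u2 x xd)) (derive_cst (std_form u1 u2)).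
split.
- move=> x xd; split; first by move=> a u1 u2 u3; rewrite !chart_form_std// std_formDl.
  split; first by move=> u; rewrite chart_form_std// std_form_alt.
  by move=> u1 u2; rewrite !chart_form_std// std_form_anti.
- move=> u1 u2; apply/smooth_onP => k.
  apply: (Ck_eq oU _ (Ck_cst k (chart_dom nu) (std_form u1 u2))).
  by move=> x /set_mem xd; rewrite chart_form_std.
- move=> x xd u1 u2 u3.
  have sum0 (a b c : R) : a = 0 -> b = 0 -> c = 0 -> a + b + c = 0.
    by move=> -> -> ->; rewrite !addr0.
  exact: (sum0 _ _ _ (D0 u1 u2 u3 x xd) (D0 u2 u3 u1 x xd) (D0 u3 u1 u2 x xd)).
- move=> x xd u u0; apply: std_form_nondegenerate => w.
  by rewrite -(chart_form_std u w xd).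
Qed.

(** The transport rotates the section by angles whose derivative is a relation.
    Relations pair to zero with the derivatives of the moduli squared, because the
    section takes its values in the level set, so the rotation does not affect the form. *)
Lemma transport_pullback nu1 nu2 (y : T) (Ey : transition nu1 nu2 y) x u1 u2 :
  nearby nu1 nu2 y x ->
  std_form ('D_u1 (fun x' => (transport nu1 nu2 y x').1.2) x)
           ('D_u2 (fun x' => (transport nu1 nu2 y x').1.2) x) = std_form u1 u2.
Proof.
move=> xy; have oU := @nearby_open _ _ _ v l nu1 nu2 y.
have xd : chart_dom nu1 x by case: xy.
pose a x' := transport_rel nu1 nu2 y x'.
pose w x' := chart_section nu1 x'.
have aC k : vCk k (nearby nu1 nu2 y) a.
  by apply: (vCkD oU); [exact: (transport_relC D Ey)|exact: vCk_cst].
have ad u : derivable a x u.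
  by have [_ + _] := vCk_Ck oU (aC 1%N); exact.
have wd u : derivable w x u by exact: section_derivable.
have nE : nbhs x (nearby nu1 nu2 y) by apply: open_nbhs_nbhs.
have Et x' : nearby nu1 nu2 y x' -> transition nu1 nu2 (transport nu1 nu2 y x').
  by move=> [x'd x't]; exact: (transport_transition D Ey x'd x't).
have secE x' : nearby nu1 nu2 y x' ->
    chart_section nu2 (transport nu1 nu2 y x').1.2 = rot (a x') (w x').
  by move=> /Et[].
have resE x' : (transport nu1 nu2 y x').1.2 = restr nu2 (rot (a x') (w x')).
  by rewrite /= /straight -rotD.
rewrite (_ : (fun x' => _) = fun x' => restr nu2 (rot (a x') (w x'))); last first.
  by apply/funext => x'; exact: resE.
have arel u : lincomb v ('D_u a x) = 0.
  apply/colP => r; rewrite lincombE mxE [RHS]mxE.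
  have := is_derive_sumE (index_enum 'I_n) xpredT
    (fun j => is_deriveM_fun (is_derive_cst (colmx v r j) x u) (coord_is_derive (ad u) j)).
  case=> _ dE; rewrite (eq_bigr (fun j => cst (colmx v r j) x * ('D_u a x) j 0 + a x j 0 * 0)).
    rewrite -dE; apply: near_derive0; apply: filterS nE => x' /Et[_ _ _ vE _].
    by have /colP/(_ r) := vE; rewrite lincombE !mxE.
  by move=> j _; rewrite mulr0 addr0.
have moment0 b u : lincomb v b = 0 -> \sum_j b j 0 * 'D_u (fun y => sqabs (w y) j) x = 0.
  move=> vb.
  have sd j : is_derive x u (fun y => sqabs (w y) j) ('D_u (fun y => sqabs (w y) j) x).
    by apply: derivableP; have [] := sqabs_is_derive (wd u) j.
  have := is_derive_sumE (index_enum 'I_n) xpredT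
    (fun j => is_deriveM_fun (is_derive_cst (b j 0) x u) (is_deriveD_fun (sd j) (is_derive_cst (l j) x u))).
  case=> _ dE.
  rewrite (eq_bigr (fun j => cst (b j 0) x * ('D_u (fun y => sqabs (w y) j) x + 0) + (sqabs (w x) j + cst (l j) x) * 0)).
    rewrite -dE; apply: near_derive0; apply: filterS nE => x' [x'd _].
    have [/(_ b vb) sl _] := section_slice (qd_basis D nu1) x'd.
    by rewrite -[RHS]sl /Psi; apply: eq_bigr => j _; rewrite mulrC.
  by move=> j _; rewrite mulr0 !addr0.
rewrite -(std_form_restr (g := fun x' => rot (a x') (w x'))).
- rewrite -(chart_form_std u1 u2 xd) /chart_form.
  by apply: (std_form_rot (wd u1) (wd u2) (ad u1) (ad u2)); apply: moment0; exact: arel.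
- exact: (rot_derivable (wd u1) (ad u1)).
- exact: (rot_derivable (wd u2) (ad u2)).
- move=> j jI; apply: filterS nE => x' x'n; rewrite -(secE x' x'n).
  exact: im_section_out.
Qed.

End SymplecticForms.

Section Quasifold.
Context {R : realType} {d n : nat} (v : 'I_n -> 'cV[R]_d) (l : 'I_n -> R)
  (Q : set 'cV[R]_d).
Hypothesis D : quasi_data v l Q.
Local Notation N := (torus_subgroup v Q).
Local Notation X := (reduced_space v l N).
Local Notation T := ('rV[R]_(d + d) * 'rV[R]_(d + d) * 'cV[R]_n)%type.
Implicit Types (nu : vertex_index v l).

Lemma zCk0 {V : normedModType R} (U : set V) p (A : V -> 'rV[R]_(p + p)) :
  (forall x, U x -> {for x, continuous A}) -> zCk 0 U A.
Proof.
move=> Ac j; split=> x Ux.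
  exact: (continuous_comp (Ac x Ux) (@coord_continuous R 1 (p + p) 0 (lshift p j) (A x))).
exact: (continuous_comp (Ac x Ux) (@coord_continuous R 1 (p + p) 0 (rshift p j) (A x))).
Qed.

Lemma std_form_continuous {V : normedModType R} (U : set V) p (A B : V -> 'rV[R]_(p + p)) :
  open U -> (forall x, U x -> {for x, continuous A}) -> (forall x, U x -> {for x, continuous B}) ->
  forall x, U x -> {for x, continuous (fun y => std_form (A y) (B y))}.
Proof.
move=> oU /zCk0 AC /zCk0 BC; suff : Ck 0 U (fun y => std_form (A y) (B y)) by [].
apply: (CkM oU (Ck_cst 0 U (pi^-1))); apply: Ck_sum => // j.
exact: (CkB oU (CkM oU (AC j).1 (BC j).2) (CkM oU (AC j).2 (BC j).1)).
Qed.

Lemma transition_par nu1 nu2 (y : T) : transition nu1 nu2 y ->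
  chart_par N nu1 y.1.1 = chart_par N nu2 y.1.2.
Proof.
move=> [d1 d2 _ vy yE]; apply/(parP D d1 d2).
by exists y.2; rewrite vy; split; [exact: (qd_zero D)|exact: yE].
Qed.

(** Two smooth lifts of the identity differ at each point by one of countably
    many group elements, so by Baire's theorem they differ by a single one on
    some open subset of any given open set; as the form is constant, this
    suffices to compare the pullbacks by continuity. *)
Lemma lift_pullback nu1 nu2 (O : set 'rV[R]_(d + d)) f :
  open O -> O `<=` chart_dom nu1 -> smooth_on O f ->
  (forall x, O x -> chart_dom nu2 (f x) /\ chart_par N nu2 (f x) = chart_par N nu1 x) ->
  forall x, O x -> forall u1 u2, std_form u1 u2 = std_form ('D_u1 f x) ('D_u2 f x).
Proof.
move=> oO Od fs fP x Ox u1 u2; apply: contrapT => neq.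
have [t Et tx] : exists2 t, transition nu1 nu2 t & t.1.1 = x.
  apply/(transition_overlap D); split; first exact: Od.
  by exists (f x); have [] := fP x Ox.
pose phi y := std_form ('D_u1 f y) ('D_u2 f y).
have phic y : O y -> {for y, continuous phi}.
  exact: (std_form_continuous oO (fun z Oz => (fs [:: u1] z Oz).1) (fun z Oz => (fs [:: u2] z Oz).1)).
pose f0 x' := (transport nu1 nu2 t x').1.2.
pose W := (O `&` phi @^-1` [set s | s != std_form u1 u2]) `&` nearby nu1 nu2 t.
have oW : open W.
  apply: openI; last exact: nearby_open.
  apply: (open_preimage oO phic).
  rewrite (_ : mkset _ = ~` [set std_form u1 u2]).
    by apply: closed_openC; exact: closed_eq.
  by apply/seteqP; split=> z /= /eqP.
have Wx : W x.
  split; last by rewrite -tx; exact: (nearby_self D Et).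
  by split=> //; apply/eqP => e; apply: neq; rewrite -e.
have /countable_injP[cnt cntI] := chart_grp_countable D nu2.
pose A k := [set y | exists2 gam, chart_grp N nu2 gam /\ cnt gam = k & f y = gam (f0 y)].
have WA : W `<=` \bigcup_k A k.
  move=> y [[Oy _] [yd yt]]; have Ey := transport_transition D Et yd yt.
  have [fd fp] := fP y Oy; have d0 : chart_dom nu2 (f0 y) by have [] := Ey.
  have /(same_chartP D d0 fd)[a [Qa ai fE]] : chart_par N nu2 (f0 y) = chart_par N nu2 (f y).
    by rewrite fp -(transition_par Ey).
  exists (cnt (rot (restrc nu2 a))) => //; exists (rot (restrc nu2 a)) => //.
  by split=> //; apply/chart_grpP; exists a.
have f0s := transport_smooth D Et.
have Acl k : W `&` closure (W `&` A k) `<=` A k.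
  have [[gam [Gg gk]]|no] := pselect (exists gam, chart_grp N nu2 gam /\ cnt gam = k); last first.
    move=> y [Wy ycl]; have [z [[_ [gam [Gg gk] _]] _]] := ycl setT filterT.
    by case: no; exists gam.
  have AE : A k = [set y | f y = gam (f0 y)].
    apply/seteqP; split=> y; last by exists gam.
    by move=> [g [Gg' gk']]; have -> : g = gam by apply: cntI; rewrite ?inE// gk gk'.
  rewrite AE; have /chart_grpP[a [_ _ ->]] := Gg.
  apply: eq_set_relatively_closed => y [[Oy _] yn]; first exact: (fs [::] y Oy).1.
  exact: (continuous_comp (f0s [::] y yn).1 (@rot_continuous _ _ _ _)).
have [k [B [oB [y By] BW BA]]] := countable_cover_interior oW (ex_intro _ x Wx) WA Acl.
have [gam [Gg gk] _] := BA y By; have /chart_grpP[a [_ _ gE]] := Gg.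
have fE z : B z -> f z = rot (restrc nu2 a) (f0 z).
  move=> /BA[g [Gg' gk'] ->]; rewrite -gE.
  by have -> : g = gam by apply: cntI; rewrite ?inE// gk gk'.
have nfE : \forall z \near y, f z = rot (restrc nu2 a) (f0 z).
  have : nbhs y B by exact: open_nbhs_nbhs.
  by apply: filterS => z; exact: fE.
have [[Oy phin] yn] := BW y By.
have DE u : 'D_u f y = rot (restrc nu2 a) ('D_u f0 y).
  rewrite (near_eq_derive u nfE); apply: derive_rot_cst.
  exact: (f0s [::] y yn).2.
move/eqP: phin; apply.
by rewrite /phi !DE std_form_rot_cst; exact: (transport_pullback D Et).
Qed.

Lemma reduced_space_symplectic : is_symplectic_quasifold X.
Proof.
split.
- split.
  + by move=> nu; exact: (chart_is_chart D nu).
  + move=> p; have [nu [x [xd xp]]] := charts_cover D p.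
    by exists nu, x.
  + by move=> nu1 nu2; exact: (transition_compatible D).
- by move=> nu; exact: (chart_form_symplectic nu).
- move=> nu1 nu2 O f [oO Od fs fP] x Ox u1 u2.
  rewrite [LHS](chart_form_std u1 u2 (Od x Ox)).
  rewrite [RHS](chart_form_std _ _ (fP x Ox).1).
  exact: (lift_pullback oO Od fs fP).
Qed.

End Quasifold.

(** * The quasitorus action and its moment map *)

Section LinearSubstitution.
Context {R : realType} {V V' W : normedModType R}.

Lemma derive_linear_comp (L : V' -> V) (f : V -> W) x u : linear L ->
  'D_u (f \o L) x = 'D_(L u) f (L x).
Proof.
move=> lL; rewrite /derive; set g1 := fun h => h^-1 *: _; set g2 := fun h => h^-1 *: _.
by suff -> : g1 = g2 by []; apply/funext => h; rewrite /g1 /g2 /= lL.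
Qed.

Lemma derivable_linear_comp (L : V' -> V) (f : V -> W) x u : linear L ->
  derivable f (L x) (L u) -> derivable (f \o L) x u.
Proof.
move=> lL; rewrite /derivable; set g1 := fun h => h^-1 *: _; set g2 := fun h => h^-1 *: _.
by suff -> : g1 = g2 by []; apply/funext => h; rewrite /g1 /g2 /= lL.
Qed.

Lemma smooth_on_linear_comp (L : V' -> V) (U : set V) (f : V -> W) :
  linear L -> continuous L -> smooth_on U f -> smooth_on (L @^-1` U) (f \o L).
Proof.
move=> lL cL fs us x Ux.
have iterE : iter_derive us (f \o L) = iter_derive (map L us) f \o L.
  elim: us => [//|u us /= ->]; apply/funext => y; exact: derive_linear_comp.
rewrite iterE; have [fc fd] := fs (map L us) (L x) Ux; split.
  exact: (continuous_comp (cL x) fc).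
by move=> u; apply: derivable_linear_comp.
Qed.

End LinearSubstitution.

Section Action.
Context {R : realType} {d n : nat} (v : 'I_n -> 'cV[R]_d) (l : 'I_n -> R)
  (Q : set 'cV[R]_d).
Hypothesis D : quasi_data v l Q.
Local Notation N := (torus_subgroup v Q).
Local Notation X := (reduced_space v l N).
Local Notation cls := (@orbit_class R d n v l N).
Implicit Types (nu : vertex_index v l) (xi : 'cV[R]_d).

(** A constant rotation preserves the form, which reduces the lifts of the action
    to those of the identity. *)
Lemma lift_pullback_rot nu1 nu1' nu2 (b : 'cV[R]_d) (O : set 'rV[R]_(d + d)) f :
  open O -> smooth_on O f -> (forall x, O x -> chart_dom nu1' (rot b x)) ->
  (forall x, O x -> chart_dom nu2 (f x) /\ chart_par N nu2 (f x) = chart_par N nu1' (rot b x)) ->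
  forall x, O x -> forall u1 u2, std_form u1 u2 = std_form ('D_u1 f x) ('D_u2 f x).
Proof.
move=> oO fs Od fP x Ox u1 u2.
have lb := rot_linear (- b); have cb := @rot_continuous R _ (- b).
pose O' := rot (- b) @^-1` O.
have oO' : open O' by apply: open_comp => // y _; exact: cb.
have := @lift_pullback _ _ _ v l Q D nu1' nu2 O' (f \o rot (- b)) oO' _ _ _ (rot b x) _ (rot b u1) (rot b u2).
rewrite !(derive_linear_comp _ _ _ lb) !rotK std_form_rot_cst; apply.
- by move=> y Oy; have := Od _ Oy; rewrite rotNK.
- exact: smooth_on_linear_comp.
- by move=> y Oy; have := fP _ Oy; rewrite rotNK.
- by rewrite /O' /= rotK.
Qed.

Variable nu0 : vertex_index v l.

(** Any coefficients of [xi] would do; those supported at a fixed vertex are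
    linear in [xi]. *)
Definition action xi (p : X) : X :=
  cls (of_level (level_rot (emb nu0 (coords nu0 xi)) (set_valP (repr p : level v l)))).

Lemma action_cls (a : 'cV[R]_n) (z w : level v l) : val w = rot a (val z) ->
  action (lincomb v a) (cls z) = cls w.
Proof.
move=> wE; have [c [Qc cE]] : exists c, Q (lincomb v c) /\ val z = rot c (val (repr (cls z))).
  by apply/(clsP D); rewrite [LHS]reprK.
apply/(clsP D); set e := emb nu0 _.
exists (a + c - e); rewrite lincombB lincombD lincomb_emb (coordsK (qd_basis D nu0)).
rewrite addrAC subrr add0r; split=> //.
by rewrite wE cE /= -!rotD subrK.
Qed.

Lemma action_par nu xi x : chart_dom nu x ->
  action xi (chart_par N nu x) = chart_par N nu (rot (coords nu xi) x).
Proof.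
move=> xd; have xd' := (chart_dom_rot nu (coords nu xi) x).2 xd.
have [z zE ->] := par_cls D xd; have [w wE ->] := par_cls D xd'.
have {1}-> : xi = lincomb v (emb nu (coords nu xi)).
  by rewrite lincomb_emb (coordsK (qd_basis D nu)).
by apply: action_cls; rewrite wE zE section_rot_emb.
Qed.

Lemma action_induced : induced_action action.
Proof. by move=> a z w wE; apply: action_cls; rewrite rotE. Qed.

Lemma lincomb_surj xi : exists a, xi = lincomb v a.
Proof. by exists (emb nu0 (coords nu0 xi)); rewrite lincomb_emb (coordsK (qd_basis D nu0)). Qed.

Lemma action_quasitorus : quasitorus_action Q action.
Proof.
have lv (a : 'cV[R]_n) (z : level v l) : exists w : level v l, val w = rot a (val z).
  by exists (of_level (level_rot a (set_valP z))).
split.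
- move=> p; have [z ->] := cls_surj p.
  have -> : 0 = lincomb v 0 :> 'cV[R]_d by rewrite lincombE mulmx0.
  by apply: action_cls; rewrite rot0.
- move=> xi eta p; have [z ->] := cls_surj p.
  have [a ->] := lincomb_surj xi; have [b ->] := lincomb_surj eta.
  have [w wE] := lv b z; have [w' w'E] := lv a w.
  rewrite -lincombD (action_cls wE) (action_cls w'E).
  by apply: action_cls; rewrite w'E wE rotD.
- move=> xi Qxi p; have [z ->] := cls_surj p.
  have [a aE] := lincomb_surj xi; have [w wE] := lv a z.
  rewrite {1}aE (action_cls wE); apply/esym/(clsP D); exists a.
  by rewrite -aE.
Qed.

Lemma free_point : exists z : level v l, forall j, sqabs (val z) j != 0.
Proof.
have : nbhs (0 : 'rV[R]_(d + d)) (chart_dom nu0).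
  by apply: open_nbhs_nbhs; split; [exact: chart_dom_open|exact: (chart_dom0 D)].
move=> /nbhs_ballP[e /= e0 eb].
pose x : 'rV[R]_(d + d) := of_zcoord (fun=> Complex (e / 2) 0).
have e2 : 0 < e / 2 by rewrite divr_gt0.
have xd : chart_dom nu0 x.
  apply: eb; split=> // i j; rewrite ord1 mxE /ball/= sub0r normrN.
  case: (splitP j) => r jr.
    rewrite (_ : j = lshift d r); last exact: val_inj.
    rewrite -[x 0 _]/(re x r) re_of_zcoord /= gtr0_norm// ltr_pdivrMr// ltr_pMr// ltr1n.
    exact: isT.
  rewrite (_ : j = rshift d r); last exact: val_inj.
  by rewrite -[x 0 _]/(im x r) im_of_zcoord /= normr0.
have [sl s0] := section_slice (qd_basis D nu0) xd.
exists (of_level sl) => j /=; case: (boolP (inI nu0 j)) => [/inIP[k <-]|jI].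
  rewrite /sqabs re_section_in im_section_in re_of_zcoord im_of_zcoord /= expr0n addr0.
  by rewrite gt_eqF// exprn_gt0.
by have [r0 i0] := s0 j jI; rewrite /sqabs i0 expr0n addr0 gt_eqF// exprn_gt0.
Qed.

(** At a point without vanishing coordinates the angles of a rotation that fixes
    the point are integers. *)
Lemma action_effective : effective_action Q action.
Proof.
move=> xi triv; have [z z0] := free_point; have [a aE] := lincomb_surj xi.
have Lw := level_rot a (set_valP z).
have : cls (of_level Lw) = cls z.
  by rewrite -(triv (cls z)) aE; apply/esym/action_cls.
move=> /(clsP D)[c [Qc cE]].
have ai j : (c + a) j 0 \is a Num.int.
  apply: contrapT => /negP nint.
  have zE : rot (c + a) (val z) = val z by rewrite rotD [RHS]cE.
  have [r0 i0] := (rot_fixed (c + a) (val z)).1 zE j nint.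
  by have := z0 j; rewrite /sqabs r0 i0 expr0n addr0 eqxx.
rewrite aE (_ : a = (c + a) - c); last by rewrite addrAC subrr add0r.
by rewrite lincombB; apply: (qd_sub D) => //; exact: (Q_int D).
Qed.

Lemma coords_linear nu : linear (coords nu).
Proof. by move=> c x y; rewrite /coords mulmxDr -scalemxAr. Qed.

Section SmoothAction.
Context {V : normedModType R}.
Variables (a : V -> 'cV[R]_d) (Z : V -> 'rV[R]_(d + d)).
Hypotheses (la : linear a) (ca : continuous a) (lZ : linear Z) (cZ : continuous Z).

Lemma rot_smooth_linear : smooth_on setT (fun p => rot (a p) (Z p)).
Proof.
apply/smooth_onP => k; apply: (zCk_Ck openT); apply: (zCk_rot openT) => j.
  apply: Ck_linear => [c p q|p]; first by rewrite la !mxE.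
  exact: (continuous_comp (@ca p) (@coord_continuous R d 1 j 0 (a p))).
split; apply: Ck_linear.
- by move=> c p q; rewrite lZ reD reZ.
- move=> p; exact: (continuous_comp (@cZ p) (@coord_continuous R 1 (d + d) 0 (lshift d j) (Z p))).
- by move=> c p q; rewrite lZ imD imZ.
- move=> p; exact: (continuous_comp (@cZ p) (@coord_continuous R 1 (d + d) 0 (rshift d j) (Z p))).
Qed.

End SmoothAction.

Lemma mulmx_continuous p q (A : 'M[R]_(p, q)) : continuous (fun x : 'cV[R]_q => A *m x).
Proof.
move=> x; suff : Ck 0 setT (fun x : 'cV[R]_q => A *m x) by move=> /(_ x I).
apply: (vCk_Ck openT); apply: (vCk_linear openT (f := fun x : 'cV[R]_q => A *m x)).
  by move=> c y z; rewrite mulmxDr scalemxAr.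
by move=> j z _; exact: coord_continuous.
Qed.

Lemma action_smooth : smooth_action action.
Proof.
move=> nu x xi xd; exists nu, setT, (fun p => rot (coords nu p.1) p.2); split => //.
- exact: openT.
- apply: rot_smooth_linear.
  + by move=> c p q /=; exact: coords_linear.
  + move=> p; apply: (continuous_comp (@continuous_fst _ _ p)); exact: mulmx_continuous.
  + by [].
  + exact: continuous_snd.
- move=> eta y _ yd; split; first exact: (chart_dom_rot nu (coords nu eta) y).2 yd.
  exact: esym (action_par eta yd).
Qed.

Lemma action_symplectic xi : preserves_forms (action xi).
Proof.
move=> nu1 nu2 O f [oO Od fs fP] x Ox u1 u2.
rewrite [LHS](chart_form_std u1 u2 (Od x Ox)).
rewrite [RHS](chart_form_std _ _ (fP x Ox).1).
apply: (@lift_pullback_rot nu1 nu1 nu2 (coords nu1 xi) O f) => //.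
  by move=> y Oy; exact: (chart_dom_rot nu1 (coords nu1 xi) y).2 (Od y Oy).
move=> y Oy; have [fd fE] := fP y Oy; split=> //.
by rewrite [LHS]fE; exact: action_par (Od y Oy).
Qed.

Definition moment (p : X) : 'rV[R]_d := chart_mu nu0 (restr nu0 (val (repr p : level v l))).

Lemma moment_cls (z : level v l) mu : (forall j, sqabs (val z) j + l j = pairing mu (v j)) ->
  moment (cls z) = mu.
Proof.
move=> zE; apply: (restr_mu (qd_basis D nu0)) => j; rewrite -zE; congr (_ + _).
have [c [_ ->]] : exists c, Q (lincomb v c) /\ val z = rot c (val (repr (cls z))).
  by apply/(clsP D); rewrite [LHS]reprK.
by rewrite sqabs_rot.
Qed.

Lemma moment_par nu x : chart_dom nu x -> moment (chart_par N nu x) = chart_mu nu x.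
Proof.
move=> xd; have [z zE ->] := par_cls D xd; apply: moment_cls => j.
by rewrite zE (section_sqabs (qd_basis D nu)).
Qed.

(** Over a point of the polyhedron there is the point of the level set whose
    coordinates are the square roots of the values of the constraints. *)
Lemma moment_range : range moment = polyhedron v l.
Proof.
apply/seteqP; split=> [_ [p _ <-]|mu mP].
  have [z ->] := cls_surj p; have /levelP[mu muE] := set_valP z.
  by rewrite (moment_cls muE) => j; rewrite -muE lerDr sqabs_ge0.
pose y : 'rV[R]_(n + n) := of_zcoord (fun j => Complex (Num.sqrt (pairing mu (v j) - l j)) 0).
have yE j : sqabs y j + l j = pairing mu (v j).
  by rewrite /sqabs re_of_zcoord im_of_zcoord /= expr0n addr0 sqr_sqrtr ?subrK// subr_ge0.
have yl : level v l y by apply/levelP; exists mu.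
by exists (cls (of_level yl)) => //; exact: moment_cls.
Qed.

Lemma pairing_mu_coords nu x xi : pairing (chart_mu nu x) xi =
  \sum_k coords nu xi k 0 * (sqabs x k + l (enumI nu k)).
Proof.
rewrite -{1}(coordsK (qd_basis D nu) xi) -lincomb_emb pairing_lincomb.
rewrite (sum_enumI (nu := nu)) => [|j jI]; last by rewrite emb_out// mulr0.
by apply: eq_bigr => k _; rewrite emb_in (chart_mu_in (qd_basis D nu)) mulrC.
Qed.

Lemma action_generated nu xi x : chart_dom nu x ->
  generated_vector action xi nu x ('D_1 (fun t : R^o => rot (t *: coords nu xi) x) 0).
Proof.
move=> xd; exists setT, (fun p => rot (p.1 *: coords nu xi) p.2); split => //.
- by split; first exact: openT.
- apply: rot_smooth_linear.
  + by move=> c p q /=; rewrite scalerDl scalerA.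
  + by move=> p; apply: cvgZr_tmp; exact: continuous_fst.
  + by [].
  + exact: continuous_snd.
- move=> t y _ yd; split; first exact: (chart_dom_rot nu (t *: coords nu xi) y).2 yd.
  rewrite (_ : t *: coords nu xi = coords nu (t *: xi)); last by rewrite /coords -scalemxAr.
  exact: esym (action_par (t *: xi) yd).
- by move=> y _ /=; rewrite scale0r rot0.
Qed.

(** In a chart the action is by rotations at constant speed and the moment map is
    an affine combination of the moduli squared, so this is the standard computation
    on the complex space. *)
Lemma action_moment : moment_map action moment.
Proof.
split.
- move=> xi p; have [z ->] := cls_surj p; have /levelP[mu muE] := set_valP z.
  have [a aE] := lincomb_surj xi; have Lw := level_rot a (set_valP z).
  rewrite (moment_cls muE) aE (@action_cls a z (of_level Lw))//.
  by apply: moment_cls => j; rewrite /= sqabs_rot.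
- move=> nu; apply/smooth_onP => k; have oU := @chart_dom_open _ _ _ v l nu.
  apply: (@Ck_eq _ _ _ k (chart_dom nu) (chart_mu nu)) => //.
    by move=> x /set_mem xd; exact: esym (moment_par xd).
  apply: (Ck_mx oU) => i r; rewrite ord1.
  exact: (Ck_chart_mu_coord oU nu r (zCk_id k (chart_dom nu))).
- move=> xi nu x xd; exists ('D_1 (fun t : R^o => rot (t *: coords nu xi) x) 0).
    exact: action_generated.
  move=> w; rewrite [RHS](chart_form_std w _ xd).
  pose b := coords nu xi.
  have oU := @chart_dom_open _ _ _ v l nu.
  have nE : \forall y \near x, pairing (moment (chart_par N nu y)) xi =
      \sum_k b k 0 * (sqabs y k + l (enumI nu k)).
    have : nbhs x (chart_dom nu) by apply: open_nbhs_nbhs.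
    by apply: filterS => y yd; rewrite (moment_par yd) pairing_mu_coords.
  have idd : derivable id x w by exact: derivable_id.
  have := is_derive_sumE (index_enum 'I_d) xpredT
    (fun k => is_deriveM_fun (is_derive_cst (b k 0) x w)
       (is_deriveD_fun (sqabs_is_derive idd k) (is_derive_cst (l (enumI nu k)) x w))).
  case=> _ dE; rewrite [LHS](near_eq_derive w nE) [LHS]dE derive_id.
  (* The generated vector is the derivative at 0 of a rotation at constant speed. *)
  pose a t : 'cV[R]_d := (t : R^o) *: b.
  have la : linear a by move=> c p q; rewrite /a scalerDl scalerA.
  have [ad aE] := is_derive_linear (0 : R^o) 1 la.
  have xd' : derivable (fun _ : R^o => x) 0 1 by exact: derivable_cst.
  have x0 : 'D_1 (fun _ : R^o => x) 0 = 0 by rewrite (derive_cst x).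
  have ai k : a 0 k 0 \is a Num.int by rewrite /a scale0r mxE rpred0.
  have aD k : ('D_1 a 0) k 0 = b k 0 by rewrite aE /a scale1r.
  have rE k : re ('D_1 (fun t => rot (a t) x) 0) k = - (2 * pi * b k 0 * im x k).
    rewrite (re_rot_derive xd' ad) aD x0; have [-> ->] := trig_int (ai k).
    by rewrite /re mxE; ring.
  have iE k : im ('D_1 (fun t => rot (a t) x) 0) k = 2 * pi * b k 0 * re x k.
    rewrite (im_rot_derive xd' ad) aD x0; have [-> ->] := trig_int (ai k).
    by rewrite /im mxE; ring.
  rewrite /std_form mulr_sumr; apply: eq_bigr => k _.
  rewrite -/a rE iE /cst; have := lt0r_neq0 (pi_gt0 R).
  by move: (pi : R) => q q0; field.
Qed.

Lemma action_hamiltonian : hamiltonian_action Q action moment.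
Proof.
split; [exact: action_quasitorus|exact: action_smooth|exact: action_symplectic|].
exact: action_moment.
Qed.

End Action.

(** * Orbifolds *)

Section Orbifold.
Context {R : realType} {d n : nat} (v : 'I_n -> 'cV[R]_d) (l : 'I_n -> R)
  (Q : set 'cV[R]_d).
Hypothesis D : quasi_data v l Q.
Hypothesis Qlattice : lattice Q.
Local Notation N := (torus_subgroup v Q).
Local Notation X := (reduced_space v l N).
Local Notation cls := (@orbit_class R d n v l N).
Implicit Types (nu : vertex_index v l).

(** Cramer's rule bounds the denominators of the elements of the lattice [Q] in
    the basis of elements of [Q] given by a vertex. *)
Lemma lattice_denominator nu : exists2 K : nat, (0 < K)%N &
  forall b, Q (vmx nu *m b) -> forall k, K%:R * b k 0 \is a Num.int.
Proof.
have [w [_ QE]] := Qlattice.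
have mulz (p : 'I_d -> int) : \sum_r w r *~ p r = (\matrix_(i, r) w r i 0) *m (\col_r (p r)%:~R).
  apply/colP => i; rewrite summxE mxE; apply: eq_bigr => r _.
  by rewrite -scaler_int !mxE mulrC.
have Qv k : exists p : 'I_d -> int, v (enumI nu k) = \sum_r w r *~ p r.
  by have := qd_gen D (enumI nu k); rewrite QE.
have [p pE] := choice Qv.
pose W : 'M[R]_d := \matrix_(i, r) w r i 0.
pose A : 'M[int]_d := \matrix_(r, k) p k r.
pose AR : 'M[R]_d := map_mx intr A.
have vE : vmx nu = W *m AR.
  apply/matrixP => i k; have /colP/(_ i) := pE k; rewrite mulz mxE => e.
  by rewrite mxE e [RHS]mxE; apply: eq_bigr => r _; rewrite !mxE.
have := qd_basis D nu; rewrite vE unitmx_mul => /andP[Wu Au].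
have detE : \det AR = (\det A)%:~R by rewrite det_map_mx.
have det0 : \det A != 0.
  apply: contraTneq Au => dA; rewrite unitmxE detE dA.
  by rewrite unitr0.
exists `|\det A|%N; first by rewrite absz_gt0.
move=> b; rewrite QE => -[q]; rewrite mulz -mulmxA => /(can_inj (mulKmx Wu)) bE k.
have int_adj : (\det AR *: b) k 0 \is a Num.int.
  have -> : \det AR *: b = \adj AR *m (AR *m b) by rewrite mulmxA mul_adj_mx mul_scalar_mx.
  rewrite bE mxE; apply: rpred_sum => i _.
  by rewrite -map_mx_adj !mxE -intrM intr_int.
move: int_adj; rewrite mxE detE.
have [->|->] : ((`|\det A|%N)%:R : R) = (\det A)%:~R \/ ((`|\det A|%N)%:R : R) = - (\det A)%:~R.
  by case: (\det A) => m; [left|right; rewrite NegzE mulrNz opprK].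
  by [].
by rewrite mulNr rpredN.
Qed.

Lemma chart_grp_finite_cover nu : exists (I : finType) (phi : I -> 'rV[R]_(d + d) -> 'rV[R]_(d + d)),
  chart_grp N nu `<=` range phi.
Proof.
have [K K0 Kint] := lattice_denominator nu.
exists {ffun 'I_d -> 'I_K}, (fun g : {ffun 'I_d -> 'I_K} => rot (\col_(k < d) ((g k : nat)%:R / K%:R))).
move=> gam /(chart_grp_basisP D)[b Qb ->].
have KR : (K%:R : R) != 0 by rewrite pnatr_eq0 -lt0n.
have bP k : exists r : 'I_K, (r : nat)%:R / K%:R - b k 0 \is a Num.int.
  have /intrP[m mE] := Kint b Qb k.
  have K0' : K%:Z != 0 by rewrite -[K%:Z == 0]/(K == 0%N) -lt0n.
  have rK : (`|(m %% K%:Z)%Z|%N < K)%N.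
    by rewrite -ltz_nat gez0_abs ?modz_ge0// ltz_pmod.
  exists (Ordinal rK) => /=.
  have -> : (`|(m %% K%:Z)%Z|%N)%:R = ((m %% K%:Z)%Z)%:~R :> R.
    by rewrite -[in RHS](gez0_abs (modz_ge0 m K0')).
  have bE : b k 0 = m%:~R / K%:R by rewrite -mE mulrC mulKf.
  have dE : m%:~R = (m %/ K%:Z)%Z%:~R * K%:R + (m %% K%:Z)%Z%:~R :> R.
    by rewrite {1}(divz_eq m K%:Z) intrD intrM.
  rewrite bE -mulrBl dE opprD addrCA subrr addr0.
  by rewrite mulNr mulfK// rpredN intr_int.
have [r rP] := choice bP.
exists [ffun k => r k] => //; apply/funext => z; rewrite !rotE; congr (torus_act _ z).
by apply/torus_expP => k; rewrite mxE ffunE.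
Qed.

Lemma chart_grp_finite nu : finite_set (chart_grp N nu).
Proof.
have [I [phi sub]] := chart_grp_finite_cover nu.
by apply: sub_finite_set sub _; apply: finite_image; exact: finite_finset.
Qed.

Lemma chart_par_open nu (A : set 'rV[R]_(d + d)) : open A -> A `<=` chart_dom nu ->
  open (chart_par N nu @` A).
Proof.
move=> oA Ad; have [_ parE _ oP] := chart_is_chart D nu.
apply/(oP _ _).2; first by move=> _ [x /Ad xd <-]; exists x.
rewrite (_ : _ `&` _ = \bigcup_(b in [set b | Q (vmx nu *m b)]) (rot (- b) @^-1` A)).
  by apply: bigcup_open => b _; apply: open_comp => // x _; exact: rot_continuous.
apply/seteqP; split=> [x [/= xd [a Aa ax]]|x [b Qb Ax]].
  have [gam /(chart_grp_basisP D)[b Qb ->] ->] := (parE a x (Ad a Aa) xd).1 ax.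
  by exists b; [exact: Qb|rewrite /preimage /= rotK].
have xd : chart_dom nu x by apply/(chart_dom_rot nu (- b) x); exact: Ad.
split; [exact: xd|exists (rot (- b) x); first exact: Ax].
apply/(parE _ _ (Ad _ Ax) xd); exists (rot b); last by rewrite rotNK.
by apply/(chart_grp_basisP D); exists b.
Qed.

Lemma moment_continuous (nu0 : vertex_index v l) : continuous (@moment R d n v l Q nu0).
Proof.
apply/continuousP => A oA; apply/open_clsP/open_set_typeP.
pose f (y : 'rV[R]_(n + n)) := chart_mu nu0 (restr nu0 y).
exists (setT `&` f @^-1` A).
  suff fC : Ck 0 setT f by exact: (open_preimage openT fC oA).
  apply: (Ck_mx openT) => i r; rewrite ord1.
  exact: (Ck_chart_mu_coord openT nu0 r (zCk_restr nu0 (zCk_id 0 setT))).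
rewrite setTI; apply/seteqP; split=> z; rewrite /= /f;
  have /levelP[mu muE] := set_valP z;
  by rewrite (moment_cls D nu0 muE) (restr_mu (qd_basis D nu0) muE).
Qed.

(** Points with different moments are separated by the moment map; points with the
    same moment lie in a common chart, where a finite group acts. *)
Lemma reduced_space_hausdorff : hausdorff_space X.
Proof.
rewrite open_hausdorff => p q pq.
have [nu [x [xd xp]]] := charts_cover D p.
have [mpq|mpq] := eqVneq (moment nu p) (moment nu q); last first.
  have : hausdorff_space 'rV[R]_d by exact: norm_hausdorff.
  rewrite open_hausdorff.
  move=> /(_ _ _ mpq)[[A B] [/= /set_mem pA /set_mem qB] [oA oB /eqP AB]].
  have /continuousP mc := @moment_continuous nu.
  exists (moment nu @^-1` A, moment nu @^-1` B); first by split; exact/mem_set.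
  split; [exact: mc|exact: mc|apply/eqP].
  by rewrite /= -preimage_setI AB preimage_set0.
have [y yd yq] : exists2 y, chart_dom nu y & chart_par N nu y = q.
  have [w wq] := cls_surj q; have [z zE zp] := par_cls D xd.
  have /levelP[mu muE] := set_valP w; have /levelP[mu' muE'] := set_valP z.
  have me : mu = mu'.
    by rewrite -(moment_cls D nu muE) -(moment_cls D nu muE') -zp xp -wq.
  have := (chart_imageP D nu w).2; rewrite -wq; apply=> j jI.
  have -> : sqabs (val w) j = sqabs (val z) j.
    by apply: (addIr (l j)); rewrite muE muE' me.
  by apply: (chart_imageP D nu z).1 => //; rewrite -zp; exists x.
have [_ parE _ _] := chart_is_chart D nu.
have [I [phi sub]] := chart_grp_finite_cover nu.
have sep gam : chart_grp N nu gam ->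
    nbhs (x, y) [set xy : 'rV[R]_(d + d) * 'rV[R]_(d + d) | xy.1 <> gam xy.2].
  move=> Gg; have /(chart_grp_basisP D)[b _ gE] := Gg.
  pose f (xy : 'rV[R]_(d + d) * 'rV[R]_(d + d)) := xy.1 - rot b xy.2.
  have fc : {for (x, y), continuous f}.
    apply: continuousB; first exact: continuous_fst.
    by apply: continuous_comp; [exact: continuous_snd|exact: rot_continuous].
  have f0 : f (x, y) != 0.
    rewrite subr_eq0; apply: contraNneq pq => xE; rewrite -xp -yq; apply/eqP/esym.
    by apply/(parE y x yd xd); exists gam => //; rewrite gE.
  have : nbhs (x, y) (f @^-1` [set z | z != 0]).
    apply: fc; apply: open_nbhs_nbhs; split=> //.
    rewrite (_ : mkset _ = ~` [set 0]); last by apply/seteqP; split=> z /= /eqP.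
    apply: closed_openC; apply: accessible_closed_set1.
    by apply: hausdorff_accessible; exact: norm_hausdorff.
  by apply: filterS => -[x' y'] /=; rewrite /f /= gE subr_eq0 => /eqP.
have : nbhs (x, y) [set xy : 'rV[R]_(d + d) * 'rV[R]_(d + d) |
    forall i : I, chart_grp N nu (phi i) -> xy.1 <> phi i xy.2].
  have FF : Filter (nbhs (x, y)) by exact: nbhs_filter.
  apply: (@filter_forall _ I _ _ FF) => i; have [Gi|nGi] := pselect (chart_grp N nu (phi i)).
    by apply: filterS (sep _ Gi) => xy h _.
  by apply: filterS (filterT : nbhs (x, y) setT) => xy _ /nGi.
move=> [[A B] [/= nA nB] AB].
pose A' := A° `&` chart_dom nu; pose B' := B° `&` chart_dom nu.
have oA' : open A' by apply: openI; [exact: open_interior|exact: chart_dom_open].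
have oB' : open B' by apply: openI; [exact: open_interior|exact: chart_dom_open].
exists (chart_par N nu @` A', chart_par N nu @` B').
  by split; apply/mem_set; [exists x|exists y].
split.
- by apply: chart_par_open => // z [].
- by apply: chart_par_open => // z [].
- apply/eqP/seteqP; split=> // _ [[a [/interior_subset Aa ad] <-] [b [/interior_subset Bb bd] /= ab]].
  have [gam Gg aE] := (parE b a bd ad).1 ab.
  have [i _ iE] := sub _ Gg.
  by apply: (AB (a, b) (conj Aa Bb) i); rewrite iE.
Qed.

Lemma reduced_space_orbifold : is_orbifold X.
Proof.
have [qX _ _] := reduced_space_symplectic D.
by split; [exact: qX|exact: reduced_space_hausdorff|exact: chart_grp_finite].
Qed.

End Orbifold.

(** * Vertices and facets of the polytope *)

Section Polyhedra.
Context {R : realType}.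

Lemma pairingN d (mu : 'rV[R]_d) w : pairing (- mu) w = - pairing mu w.
Proof. by rewrite /pairing mulNmx mxE. Qed.

Lemma pairingB d (mu mu' : 'rV[R]_d) w : pairing (mu - mu') w = pairing mu w - pairing mu' w.
Proof. by rewrite pairingD pairingN. Qed.

Lemma pairing_sum d (I : Type) (r : seq I) (P : pred I) (F : I -> 'rV[R]_d) w :
  pairing (\sum_(i <- r | P i) F i) w = \sum_(i <- r | P i) pairing (F i) w.
Proof. by rewrite /pairing mulmx_suml summxE. Qed.

Lemma pairing_sumr d (I : Type) (r : seq I) (P : pred I) (mu : 'rV[R]_d) (F : I -> 'cV[R]_d) :
  pairing mu (\sum_(i <- r | P i) F i) = \sum_(i <- r | P i) pairing mu (F i).
Proof. by rewrite /pairing mulmx_sumr summxE. Qed.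

Lemma pairingZr d (mu : 'rV[R]_d) c w : pairing mu (c *: w) = c * pairing mu w.
Proof. by rewrite /pairing -scalemxAr mxE. Qed.

Section Polyhedron.
Context {d n : nat} (v : 'I_n -> 'cV[R]_d) (l : 'I_n -> R).
Local Notation P := (polyhedron v l).
Implicit Types (mu u : 'rV[R]_d).

Definition active mu : {set 'I_n} := [set j | pairing mu (v j) == l j]%SET.

Lemma polyhedron_convex mu mu' (t : R) : 0 <= t <= 1 -> P mu -> P mu' ->
  P ((1 - t) *: mu + t *: mu').
Proof.
move=> /andP[t0 t1] Pmu Pmu' j; rewrite pairingD !pairingZ.
rewrite (_ : l j = (1 - t) * l j + t * l j); last by ring.
by rewrite lerD// ler_wpM2l// subr_ge0.
Qed.

(** The ray stops at the first constraint hyperplane that it meets from inside. *)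
Lemma ray_exit mu u : P mu -> (exists j, pairing u (v j) < 0) ->
  exists t, [/\ 0 <= t, P (mu + t *: u) &
    exists j, pairing u (v j) < 0 /\ pairing (mu + t *: u) (v j) = l j].
Proof.
move=> Pmu [j0 j0u].
pose F j := (pairing mu (v j) - l j) / (- pairing u (v j)).
case: (@arg_minP _ _ _ j0 (fun j => pairing u (v j) < 0) F j0u) => j ju jmin.
exists (F j); split.
- by rewrite divr_ge0 ?subr_ge0// oppr_ge0 ltW.
- move=> i; rewrite pairingD pairingZ.
  have [ui|ui] := ltP (pairing u (v i)) 0; last first.
    by rewrite ler_wpDr ?Pmu// mulr_ge0// divr_ge0 ?subr_ge0// oppr_ge0 ltW.
  have := jmin i ui; rewrite {2}/F ler_pdivlMr ?oppr_gt0//.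
  by rewrite mulrN => h; lra.
- exists j; split=> //; rewrite pairingD pairingZ /F invrN mulrN mulNr divfK ?lt_eqF//.
  by rewrite opprB addrC subrK.
Qed.

(** The constraints that are not active are finitely many and strict. *)
Lemma small_step mu u : P mu -> (forall j, j \in active mu -> pairing u (v j) = 0) ->
  exists2 t, 0 < t & P (mu + t *: u) /\ P (mu - t *: u).
Proof.
move=> Pmu u0.
pose f (j : 'I_n) (t : R) := (pairing mu (v j) - l j) - `|t| * `|pairing u (v j)|.
have : nbhs (0 : R) [set t | forall j, j \notin active mu -> 0 < f j t].
  have oU : open (setT `&` [set t | forall j, j \notin active mu -> 0 < f j t]).
    apply: open_gt0 => [|j t _]; first exact: openT.
    apply: continuousB; first exact: cst_continuous.
    apply: continuousM; last exact: cst_continuous.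
    exact: norm_continuous.
  apply: filterS (open_nbhs_nbhs (conj oU _)); first by move=> t [].
  split=> // j; rewrite inE /f normr0 mul0r subr0 subr_gt0 => jI.
  by rewrite lt_neqAle eq_sym jI /=; exact: Pmu.
move=> /nbhs_ballP[e /= e0 eb].
have e2 : 0 < e / 2 by rewrite divr_gt0.
have ballE : ball (0 : R) e (e / 2).
  by rewrite /ball/= sub0r normrN gtr0_norm// ltr_pdivrMr// ltr_pMr// ltr1n.
have fE := eb _ ballE.
exists (e / 2) => //; split=> j; rewrite pairingD ?pairingN pairingZ;
    case: (boolP (j \in active mu)) => ja.
- by rewrite u0// mulr0 addr0; exact: Pmu.
- have := fE j ja; rewrite /f (gtr0_norm e2).
  have := ler_norm (- (e / 2 * pairing u (v j))); rewrite normrN normrM (gtr0_norm e2).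
  by lra.
- by rewrite u0// mulr0 oppr0 addr0; exact: Pmu.
- have := fE j ja; rewrite /f (gtr0_norm e2).
  have := ler_norm (e / 2 * pairing u (v j)); rewrite normrM (gtr0_norm e2).
  by lra.
Qed.

Lemma vertex_in nu : vertex P nu -> P nu.
Proof.
by move=> [w [c [_ e]]]; have : [set nu] nu by []; rewrite e => -[].
Qed.

(** Otherwise the vertex would be the midpoint of a segment in the polyhedron, on
    which the linear form defining the vertex would be constant. *)
Lemma vertex_active nu u : vertex P nu -> (forall j, j \in active nu -> pairing u (v j) = 0) -> u = 0.
Proof.
move=> vnu u0; have Pnu := vertex_in vnu.
have [t t0 [Pp Pm]] := small_step Pnu u0.
move: vnu => [w [c [Pc e]]].
have nuc : pairing nu w = c by have : [set nu] nu by []; rewrite e => -[].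
have := Pc _ Pp; have := Pc _ Pm; rewrite /= pairingB pairingD pairingZ nuc => h1 h2.
have tu0 : t * pairing u w = 0 by lra.
have : [set nu] (nu + t *: u) by rewrite e; split=> //=; rewrite pairingD pairingZ nuc tu0 addr0.
move=> /= nuE; have /eqP : t *: u = 0 by apply: (addrI nu); rewrite addr0.
by rewrite scaler_eq0 (gt_eqF t0) => /eqP.
Qed.

(** The sum of the active constraints is minimal at [mu] only. *)
Lemma active_vertex mu : P mu -> (forall u, (forall j, j \in active mu -> pairing u (v j) = 0) -> u = 0) ->
  vertex P mu.
Proof.
move=> Pmu indep; exists (\sum_(j in active mu) v j), (\sum_(j in active mu) l j); split.
  by move=> mu' Pmu'; rewrite /= pairing_sumr; apply: ler_sum => j _; exact: Pmu'.
apply/seteqP; split=> [_ ->|mu' [Pmu' /= mu'E]].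
  split=> //=; rewrite pairing_sumr; apply: eq_bigr => j; rewrite inE => /eqP; exact.
apply/subr0_eq/indep => j jA; rewrite pairingB.
have : \sum_(j in active mu) (pairing mu' (v j) - l j) == 0.
  by rewrite sumrB -pairing_sumr mu'E subrr.
rewrite psumr_eq0 => [/allP/(_ j (mem_index_enum j))|i _]; last by rewrite subr_ge0; exact: Pmu'.
by rewrite jA /= => /eqP h; move: jA; rewrite inE => /eqP ->.
Qed.

(** Maximize the number of active constraints: if the maximal ones had a common
    nonzero solution, a ray along it would, by boundedness, run into another one. *)
Lemma vertex_above mu : bounded_set P -> P mu ->
  exists2 nu, vertex P nu & active mu \subset active nu.
Proof.
move=> bP Pmu.
pose ok k := `[< exists2 nu, P nu & active mu \subset active nu /\ #|active nu| = k >].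
have ok0 : exists k, ok k by exists #|active mu|; apply/asboolP; exists mu.
have okn k : ok k -> (k <= n)%N.
  by move=> /asboolP[nu _ [_ <-]]; have := max_card (mem (active nu)); rewrite card_ord.
case: (ex_maxnP ok0 okn) => k /asboolP[nu Pnu [sub nuk]] kmax.
exists nu => //; apply: active_vertex => // u u0; apply: contrapT => un0.
have /ray_exit : exists j, pairing u (v j) < 0.
  apply: contrapT => /forallNP nneg.
  have Pray t : 0 <= t -> P (nu + t *: u).
    move=> t0 j; rewrite pairingD pairingZ ler_wpDr ?Pnu// mulr_ge0//.
    by rewrite leNgt; apply/negP/nneg.
  have [M [Mr MP]] := bP.
  have u1 : 0 < `|u| by rewrite normr_gt0; apply/eqP.
  pose K := `|M| + 1; pose t := (K + 1 + `|nu|) / `|u|.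
  have K0 : 0 <= K by rewrite addr_ge0.
  have t0 : 0 <= t by rewrite divr_ge0// !addr_ge0.
  have MK : M < K by rewrite (le_lt_trans (ler_norm M))// ltrDl.
  have : `|nu + t *: u| <= K := MP K MK _ (Pray t t0).
  rewrite leNgt => /negP; apply.
  have tuE : `|t *: u| = K + 1 + `|nu| by rewrite normrZ ger0_norm// divfK// gt_eqF.
  have := ler_normB (nu + t *: u) nu; rewrite [nu + _]addrC addrK tuE.
  move=> h; rewrite -(ltrD2r `|nu|); apply: lt_le_trans h.
  by rewrite ltrD2r ltrDl.
move=> /(_ nu Pnu)[t [t0 Pt [j [ju jt]]]].
have sub' : active nu \subset active (nu + t *: u).
  apply/fintype.subsetP => i iA; rewrite inE pairingD pairingZ u0// mulr0 addr0.
  by move: iA; rewrite inE.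
have jn : j \notin active nu by apply/negP => jA; move: ju; rewrite u0// ltxx.
have : (#|active nu| < #|active (nu + t *: u)|)%N.
  apply: proper_card; apply/fintype.properP; split=> //; exists j => //.
  by rewrite inE jt.
rewrite nuk ltnNge kmax//; apply/asboolP; exists (nu + t *: u) => //; split=> //.
exact: fintype.subset_trans sub sub'.
Qed.

End Polyhedron.

End Polyhedra.

(** * The quotient data of a polytope *)

Section SimplePolyhedron.
Context {R : realType} {d n : nat} (v : 'I_n -> 'cV[R]_d) (l : 'I_n -> R).
Local Notation P := (polyhedron v l).

(** The enumeration of a vertex index exhausts the active constraints, which have no
    common zero at a vertex. *)
Lemma vertex_basis (nu : vertex_index v l) : vmx nu \in unitmx.
Proof.
rewrite -row_free_unit -kermx_eq0; apply/eqP/row_matrixP => i; rewrite row0.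
apply: (vertex_active (vtxP nu)) => j; rewrite inE => /eqP jnu.
have /inIP[k <-] : inI nu j by apply/inI_active.
by rewrite -mulmx_vmx -row_mul mulmx_ker row0 mxE.
Qed.

Lemma vertex_index_ex nu : vertex P nu -> #|active v l nu| = d ->
  exists i : vertex_index v l, vtx i = nu.
Proof.
move=> vnu cd; pose s := enum (active v l nu).
have ss : size s = d by rewrite -cardE.
have s_sorted : sorted ltn (map val s).
  apply: (subseq_sorted ltn_trans (s2 := map val (enum 'I_n))).
    by apply: map_subseq; rewrite enumT; exact: filter_subseq.
  by rewrite val_enum_ord iota_ltn_sorted.
have sn (k : 'I_d) : (k < size s)%N by rewrite ss.
case: (pickP (fun j : 'I_n => true)) => [j0 _|n0]; last first.
  have d0 (k : 'I_d) : False.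
    by have := sn k; case: s {ss s_sorted sn} => [//|j ? _]; have := n0 j.
  have eI (k : 'I_d) : 'I_n by case: (d0 k).
  have e1 : {homo eI : i j / (i < j)%N} by move=> i; case: (d0 i).
  have e2 : forall j, (exists k, eI k = j) <-> pairing nu (v j) = l j by move=> j; have := n0 j.
  by exists (VertexIndex vnu e1 e2).
pose eI (k : 'I_d) := nth j0 s k.
have e1 : {homo eI : i j / (i < j)%N}.
  move=> i j ij; rewrite /eI -!(nth_map j0 0%N val) ?sn//.
  by apply: (sorted_ltn_nth ltn_trans) => //; rewrite inE size_map sn.
have e2 : forall j, (exists k, eI k = j) <-> pairing nu (v j) = l j.
  move=> j; have -> : pairing nu (v j) = l j <-> j \in s.
    by rewrite mem_enum inE; split=> /eqP.
  split=> [[k <-]|js]; first exact: mem_nth.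
  have jd : (index j s < d)%N by rewrite -ss index_mem.
  by exists (Ordinal jd); rewrite /eI /= nth_index.
by exists (VertexIndex vnu e1 e2).
Qed.

Lemma polyhedron_cover : bounded_set P -> (forall nu, vertex P nu -> #|active v l nu| = d) ->
  forall mu, P mu -> exists nu : vertex_index v l, forall j, pairing mu (v j) = l j -> inI nu j.
Proof.
move=> bP cd mu Pmu; have [nu vnu /fintype.subsetP sub] := vertex_above bP Pmu.
have [i iE] := vertex_index_ex vnu (cd nu vnu); exists i => j jmu.
apply/inI_active; rewrite iE.
have : j \in active v l nu by apply: sub; rewrite inE jmu.
by rewrite inE => /eqP.
Qed.

End SimplePolyhedron.

Section IntegerSpan.
Context {R : realType} {d n : nat} (v : 'I_n -> 'cV[R]_d).

Lemma zspan_lincomb (m : 'I_n -> int) : \sum_j v j *~ m j = lincomb v (\col_j (m j)%:~R).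
Proof. by apply: eq_bigr => j _; rewrite mxE scaler_int. Qed.

Lemma zspan_gen j : zspan v (v j).
Proof.
exists (fun i => (i == j)%:Z); rewrite (bigD1 j)//= eqxx big1 ?addr0// => i /negbTE ->.
by rewrite mulr0z.
Qed.

Lemma zspan_sub x y : zspan v x -> zspan v y -> zspan v (x - y).
Proof.
move=> [a ->] [b ->]; exists (fun j => a j - b j).
by rewrite -sumrB; apply: eq_bigr => j _; rewrite mulrzBr.
Qed.

Lemma zspan0 : zspan v 0.
Proof. by exists (fun=> 0); rewrite big1// => j _; rewrite mulr0z. Qed.

Lemma zspan_countable : countable (zspan v).
Proof.
pose f (m : {ffun 'I_n -> int}) : 'cV[R]_d := \sum_j v j *~ m j.
apply: (@sub_countable _ _ _ (range f)).
  apply: subset_card_le => x [m ->]; exists [ffun j => m j] => //.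
  by apply: eq_bigr => j _; rewrite ffunE.
by apply: card_le_trans (card_image_le _ _) _; exact: countableP.
Qed.

(** Integer coefficients have trivial exponential, so [exp (Rel v)] already
    contains the exponentials of the coefficients of the elements of [Q]. *)
Lemma torus_exp_rel : torus_exp @` Rel v = torus_subgroup v (zspan v).
Proof.
apply/seteqP; split=> t [a]; first by move=> /= va <-; exists a; rewrite //= va; exact: zspan0.
move=> [m mE] <-; exists (a - \col_j (m j)%:~R).
  by rewrite /Rel /= lincombB mE zspan_lincomb subrr.
by apply/torus_expP => j; rewrite !mxE addrAC subrr add0r rpredN intr_int.
Qed.

End IntegerSpan.

Lemma increasing_inj h n (e : 'I_h -> 'I_n) : {homo e : i j / (i < j)%N} -> injective e.
Proof.
move=> e_incr i j ij; apply/val_inj/eqP; case: ltngtP => // /e_incr; first by rewrite ij ltnn.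
by rewrite ij ltnn.
Qed.

Section Polytope.
Context {R : realType}.

Lemma facet_support d (P F : set 'rV[R]_d) : affine_dim P d -> facet P F ->
  exists w c, [/\ w <> 0, P `<=` [set mu | c <= pairing mu w],
    F = P `&` [set mu | pairing mu w = c] & F !=set0].
Proof.
move=> [[p [pP pI]] _] [[w [c [Pc FE]]] [k [kd [[q [qF _]] Fmax]]]].
exists w, c; split=> //; last by exists (q ord0).
move=> w0; have PF : P `<=` F.
  have := qF ord0; rewrite FE w0 => -[_ /= e0] mu Pmu; split=> //.
  by rewrite /= -e0 /pairing !mulmx0.
by subst d; apply: (Fmax p) => // i; exact/PF.
Qed.

Section Datum.
Context {d n h : nat} (e : 'I_h -> 'I_n) (P : set 'rV[R]_d) (Q : set 'cV[R]_d)
  (v : 'I_n -> 'cV[R]_d) (l : 'I_n -> R).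
Hypotheses (e_incr : {homo e : i j / (i < j)%N})
  (datum : prato_datum P Q (fun j => v (e j))) (PE : P = polyhedron v l)
  (strict : forall j, j \notin codom e -> P `<=` [set mu | l j < pairing mu (v j)]).
Implicit Types (mu nu : 'rV[R]_d).

(** A proper face lies on one of the constraint hyperplanes, as otherwise an
    average of its points would be interior. *)
Lemma face_active (F : set 'rV[R]_d) w c : w <> 0 -> P `<=` [set mu | c <= pairing mu w] ->
  F = P `&` [set mu | pairing mu w = c] -> F !=set0 ->
  exists i, F `<=` [set mu | pairing mu (v i) = l i].
Proof.
move=> w0 Pc FE [p0 Fp0]; apply: contrapT => /forallNP no.
have FP mu : F mu -> P mu by rewrite FE => -[].
have /choice[p pP] : forall i, exists mu, F mu /\ l i < pairing mu (v i).
  move=> i; apply: contrapT => /forallNP h'; apply: (no i) => mu Fmu /=.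
  have lmu : l i <= pairing mu (v i) by have := FP _ Fmu; rewrite PE; exact.
  apply/eqP; rewrite eq_le lmu andbT leNgt; apply/negP => lt; exact: (h' mu).
pose m := (n.+1%:R)^-1 *: (p0 + \sum_i p i).
have n0 : 0 < (n.+1%:R : R) by rewrite ltr0n.
have mE x : pairing m x = (n.+1%:R)^-1 * (pairing p0 x + \sum_i pairing (p i) x).
  by rewrite pairingZ pairingD pairing_sum.
have mi i : l i < pairing m (v i).
  rewrite mE mulrC ltr_pdivlMr// mulrC mulr_natl mulrS.
  apply: ler_ltD; first by have := FP _ Fp0; rewrite PE; exact.
  rewrite -[X in _ *+ X](card_ord n) -sumr_const [ltLHS](bigD1 i)//= [ltRHS](bigD1 i)//=.
  apply: ltr_leD; first exact: (pP i).2.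
  by apply: ler_sum => j _; have := FP _ (pP j).1; rewrite PE; exact.
have mc : pairing m w = c.
  have Fc mu : F mu -> pairing mu w = c by rewrite FE => -[].
  rewrite mE (Fc _ Fp0) (eq_bigr (fun=> c)) => [|i _]; last exact: Fc (pP i).1.
  by rewrite sumr_const card_ord -mulrS -[c *+ _]mulr_natl mulKf// gt_eqF.
have Pm : polyhedron v l m by move=> i; exact: ltW.
have w_active : forall j, j \in active v l m -> pairing w^T (v j) = 0.
  by move=> j; rewrite inE => /eqP jm; have := mi j; rewrite jm ltxx.
have [t t0 [_]] := small_step Pm w_active.
rewrite -PE => /Pc /=; rewrite pairingB mc pairingZ.
have ww : 0 < pairing w^T w.
  have wwE : pairing w^T w = \sum_i w i 0 ^+ 2.
    by rewrite /pairing mxE; apply: eq_bigr => i _; rewrite mxE expr2.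
  rewrite lt_neqAle eq_sym wwE sumr_ge0 ?andbT => [|i _]; last exact: sqr_ge0.
  apply/eqP => /eqP; rewrite psumr_eq0 => [/allP z|i _]; last exact: sqr_ge0.
  apply: w0; apply/colP => i; have := z i (mem_index_enum i).
  by rewrite sqrf_eq0 mxE => /eqP.
by rewrite leNgt gtrBl mulr_gt0.
Qed.

Lemma ray_scale (w : 'cV[R]_d) (t : R) : 0 < t -> ray (t *: w) = ray w.
Proof.
move=> t0; apply/seteqP; split=> x [s s0 ->].
  by exists (s * t); rewrite ?scalerA// mulr_ge0// ltW.
by exists (s / t); rewrite ?scalerA ?divfK ?gt_eqF// divr_ge0// ltW.
Qed.

Lemma ray_pos (w x : 'cV[R]_d) : ray w x -> x <> 0 -> exists2 t, 0 < t & x = t *: w.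
Proof.
move=> [t t0 xE] x0; exists t => //; rewrite lt_neqAle t0 andbT eq_sym.
by apply: contra_notN x0 => /eqP z; rewrite xE z scale0r.
Qed.

Definition facet_of (j : 'I_h) : set 'rV[R]_d :=
  P `&` [set mu | pairing mu (v (e j)) = l (e j)].

(** A facet is cut out by one of the given constraints; its normal vector is then
    in the normal cone of the facet, and the bijection between facets and rays
    identifies the constraint. *)
Lemma facetE F j : facet P F -> normal_cone P F = ray (v (e j)) -> F = facet_of j.
Proof.
have [[[_ _ Pd] _] _ _ has_facet uniq_facet] := datum.
have coneI F' w c : P `<=` [set mu | c <= pairing mu w] -> F' `<=` [set mu | pairing mu w = c] ->
    normal_cone P F' w.
  by move=> Pc Fc mu mu' /Fc /= -> /Pc.
have support F' j' : facet P F' -> normal_cone P F' = ray (v (e j')) ->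
    exists2 s, 0 < s & exists c, [/\ s *: v (e j') <> 0, P `<=` [set mu | c <= pairing mu (s *: v (e j'))],
    F' = P `&` [set mu | pairing mu (s *: v (e j')) = c] & F' !=set0].
  move=> fF cF; have [w [c [w0 Pc FE F0]]] := facet_support Pd fF.
  have : normal_cone P F' w by apply: (coneI _ _ c) => //; rewrite FE => mu [].
  rewrite cF => /ray_pos/(_ w0)[s s0 sE]; exists s => //; exists c.
  by rewrite -sE.
move=> fF cF; have [s s0 [c [w0 Pc FE F0]]] := support F j fF cF.
have [i Fi] := face_active w0 Pc FE F0.
have [i' ii] : exists i', i = e i'.
  case: (boolP (i \in codom e)) => [/codomP//|/strict Pi].
  have [mu Fmu] := F0; have : P mu by move: Fmu; rewrite FE => -[].
  by move=> /Pi /=; rewrite (Fi _ Fmu) ltxx.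
have vi0 : v (e i') <> 0.
  have [F' fF' cF'] := has_facet i'; have [s' s0' [c' [w0' _ _ _]]] := support F' i' fF' cF'.
  by move=> z; apply: w0'; rewrite z scaler0.
have : normal_cone P F (v (e i')).
  by rewrite -ii; apply: (coneI _ _ (l i)) => // mu; rewrite PE; exact.
rewrite cF => /ray_pos/(_ vi0)[t t0 tE].
have ij : i' = j.
  have [j0 [_ j0u]] := uniq_facet F fF.
  have ei : j0 = i' by apply: j0u; rewrite cF /= tE (ray_scale _ t0).
  by rewrite -ei; apply: j0u; rewrite cF.
rewrite ii ij in Fi; rewrite /facet_of; apply/seteqP; split=> mu.
  by move=> Fmu; split; [move: Fmu; rewrite FE => -[]|exact: Fi].
move=> [Pmu /= muE]; rewrite FE; split=> //=.
have [mu0 Fmu0] := F0; have := Fi _ Fmu0; move: Fmu0; rewrite FE => -[_ /= <-] mu0E.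
by rewrite !pairingZr muE mu0E.
Qed.

Lemma facet_of_facet j : facet P (facet_of j) /\ normal_cone P (facet_of j) = ray (v (e j)).
Proof.
have [_ _ _ has_facet _] := datum; have [F fF cF] := has_facet j.
by rewrite -(facetE fF cF).
Qed.

Lemma facet_of_inj : injective facet_of.
Proof.
move=> i j ij; have [_ _ _ _ uniq_facet] := datum.
have [fi ci] := facet_of_facet i; have [fj cj] := facet_of_facet j.
have [k [_ ku]] := uniq_facet _ fi.
by rewrite -(ku i ci); apply: ku; rewrite ij.
Qed.

(** Facets correspond to facet vectors, so simplicity counts the active ones. *)
Lemma vertex_card nu : vertex P nu -> #|[set j | pairing nu (v (e j)) == l (e j)]%SET| = d.
Proof.
move=> vnu; have [[_ simple] _ _ _ uniq_facet] := datum.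
have Pnu : P nu by rewrite PE; apply: vertex_in; rewrite -PE.
have := simple nu vnu.
have -> : [set F | facet P F /\ F nu] =
    facet_of @` [set j | j \in [set j | pairing nu (v (e j)) == l (e j)]%SET].
  apply/seteqP; split=> [F [fF Fnu]|_ [j /= jA <-]]; last first.
    split; first exact: (facet_of_facet j).1.
    by split=> //=; move: jA; rewrite inE => /eqP.
  have [j [cj _]] := uniq_facet F fF; have FE := facetE fF cj.
  exists j => //=; rewrite inE; apply/eqP.
  by move: Fnu; rewrite FE => -[].
set A := [set j | _]%SET.
have AE : [set j | j \in A] = range (fun k : 'I_#|A| => enum_val k).
  apply/seteqP; split=> [j jA|_ [k _ <-]]; last exact: enum_valP.
  by exists (enum_rank_in jA j) => //; rewrite enum_rankK_in.
have c1 : (facet_of @` [set j | j \in A] #= [set j | j \in A])%card.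
  by apply: inj_card_eq => i j _ _; exact: facet_of_inj.
have c2 : ([set j | j \in A] #= [set: 'I_#|A|])%card.
  by rewrite AE; apply: inj_card_eq => i j _ _; exact: enum_val_inj.
move=> c0; apply/card_eq_II.
rewrite card_eq_sym in c1; rewrite card_eq_sym in c2.
exact: card_eq_trans card_II (card_eq_trans c2 (card_eq_trans c1 c0)).
Qed.

Lemma active_card nu : vertex P nu -> #|active v l nu| = d.
Proof.
move=> vnu; apply: etrans (vertex_card vnu); rewrite -(card_imset _ (increasing_inj e_incr)); apply: eq_card => j.
rewrite inE; apply/eqP/imsetP => [jnu|[i iA ->]]; last by move: iA; rewrite inE => /eqP.
case: (boolP (j \in codom e)) => [/codomP[i ji]|/strict Pj].
  by exists i => //; rewrite inE -ji jnu.
have Pnu : P nu by rewrite PE; apply: vertex_in; rewrite -PE.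
by have := Pj _ Pnu; rewrite /= jnu ltxx.
Qed.

Lemma polytope_point : exists mu, P mu.
Proof.
by have [[[_ _ [[p [pP _]] _]] _] _ _ _ _] := datum; exists (p ord0).
Qed.

(** A segment that starts in the polytope leaves it through the hyperplane of a
    facet, since the other constraints are strict on the polytope. *)
Lemma facets_polyhedron : P = polyhedron (fun j => v (e j)) (fun j => l (e j)).
Proof.
apply/seteqP; split=> [mu|mu mu_e]; first by rewrite PE => Pmu j; exact: Pmu.
have [p Pp] := polytope_point; apply: contrapT => nP.
have Pp' : polyhedron v l p by rewrite -PE.
have [j ju] : exists j, pairing (mu - p) (v j) < 0.
  apply: contrapT => /forallNP nneg; apply: nP; rewrite PE => j.
  rewrite -(subrK p mu) pairingD ler_wpDl// leNgt; exact/negP/nneg.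
have [t [t0 Pt [i [iu it]]]] := ray_exit Pp' (ex_intro _ j ju).
have [t1|t1] := leP t 1; last first.
  apply: nP; rewrite PE.
  have tI : 0 <= t^-1 <= 1 by rewrite invr_ge0 t0 invf_le1 ?ltW// (lt_trans ltr01).
  have := polyhedron_convex tI Pp' Pt.
  rewrite scalerDr scalerA mulVf ?gt_eqF ?(lt_trans ltr01 t1)// scale1r addrA.
  by rewrite -scalerDl subrK scale1r addrC subrK.
case: (boolP (i \in codom e)) => [/codomP[k ik]|/strict Pi]; last first.
  by have := Pi (p + t *: (mu - p)); rewrite /= it ltxx PE => /(_ Pt).
have := mu_e k; rewrite -ik; move: iu it; rewrite pairingB pairingD pairingZ pairingB.
move=> h1 h2 h3.
have t1' : t = 1.
  apply: le_anti; rewrite t1 /= -subr_ge0 -(nmulr_lle0 _ h1).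
  by rewrite mulrBl mul1r; lra.
by apply: nP; rewrite PE; move: Pt; rewrite t1' scale1r addrC subrK.
Qed.

Lemma quasi_data_full : zspan v = Q -> quasi_data v l Q.
Proof.
have [[[_ bP _] _] _ _ _ _] := datum; move=> QE; split.
- by rewrite -QE; exact: zspan0.
- by rewrite -QE; exact: zspan_sub.
- by move=> j; rewrite -QE; exact: zspan_gen.
- by rewrite -QE; exact: zspan_countable.
- exact: vertex_basis.
- by apply: polyhedron_cover => [|nu]; rewrite -PE //; exact: active_card.
Qed.

Lemma quasi_data_facets : quasi_data (fun j => v (e j)) (fun j => l (e j)) Q.
Proof.
have [[[_ bP _] _] [k [w [_ QE]]] Qv _ _] := datum; split=> //.
- by rewrite QE; exact: zspan0.
- by rewrite QE; exact: zspan_sub.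
- by rewrite QE; exact: zspan_countable.
- exact: vertex_basis.
- by apply: polyhedron_cover => [|nu]; rewrite -facets_polyhedron //; exact: vertex_card.
Qed.

End Datum.

End Polytope.

(** * Comparison with the reduction for the facet vectors *)

Section Comparison.
Context {R : realType} {d n h : nat} (e : 'I_h -> 'I_n)
  (v : 'I_n -> 'cV[R]_d) (l : 'I_n -> R) (Q : set 'cV[R]_d).
Local Notation v' := (fun j => v (e j)).
Local Notation l' := (fun j => l (e j)).
Hypotheses (e_incr : {homo e : i j / (i < j)%N})
  (D : quasi_data v l Q) (D' : quasi_data v' l' Q)
  (polyE : polyhedron v l = polyhedron v' l')
  (slack : forall j, j \notin codom e -> forall mu, polyhedron v l mu -> l j < pairing mu (v j)).
Local Notation N := (torus_subgroup v Q).
Local Notation N' := (torus_subgroup v' Q).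
Local Notation X := (reduced_space v l N).
Local Notation X' := (reduced_space v' l' N').
Implicit Types (nu : vertex_index v l) (rho : vertex_index v' l') (z : 'rV[R]_(d + d)).

Let e_inj : injective e := increasing_inj e_incr.

Lemma active_codom nu j : pairing (vtx nu) (v j) = l j -> exists i, e i = j.
Proof.
case: (boolP (j \in codom e)) => [/codomP[i ->]|jn jnu]; first by exists i.
by have := slack jn (vertex_in (vtxP nu)); rewrite jnu ltxx.
Qed.

(** The strict constraints are not active at the vertices, so the two descriptions
    of the polytope have the same vertices and the same active constraints. *)
Definition same_vertex nu rho : Prop :=
  vtx nu = vtx rho /\ forall k, e (enumI rho k) = enumI nu k.

Lemma same_vertex_down nu : exists rho, same_vertex nu rho.
Proof.
have /choice[f fE] : forall k, exists i, e i = enumI nu k.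
  by move=> k; apply: active_codom; apply/enumIP; exists k.
have vnu : vertex (polyhedron v' l') (vtx nu) by rewrite -polyE; exact: vtxP.
have f_incr : {homo f : i j / (i < j)%N}.
  move=> i j /(@enumI_incr _ _ _ _ _ nu); rewrite -!fE.
  case: (ltngtP (f i) (f j)) => // [/e_incr|/val_inj ->]; last by rewrite ltnn.
  by move=> h1 h2; have := ltn_trans h1 h2; rewrite ltnn.
have fP j : (exists k, f k = j) <-> pairing (vtx nu) (v' j) = l' j.
  split=> [[k <-]|/enumIP[k kj]]; first by rewrite /= fE; apply/enumIP; exists k.
  by exists k; apply: e_inj; rewrite fE.
by exists (VertexIndex vnu f_incr fP).
Qed.

Lemma same_vertex_up rho : exists nu, same_vertex nu rho.
Proof.
have vnu : vertex (polyhedron v l) (vtx rho) by rewrite polyE; exact: vtxP.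
have incr : {homo (fun k => e (enumI rho k)) : i j / (i < j)%N}.
  by move=> i j /(@enumI_incr _ _ _ _ _ rho)/e_incr.
have eP j : (exists k, e (enumI rho k) = j) <-> pairing (vtx rho) (v j) = l j.
  split=> [[k <-]|jnu]; first by apply/(enumIP rho); exists k.
  case: (boolP (j \in codom e)) => [/codomP[i ij]|jn]; last first.
    by have := slack jn (vertex_in vnu); rewrite jnu ltxx.
  move: jnu; rewrite ij => /(enumIP rho)[k <-].
  by exists k.
by exists (VertexIndex vnu incr eP).
Qed.

Section SameVertex.
Context {nu : vertex_index v l} {rho : vertex_index v' l'}.
Hypothesis same : same_vertex nu rho.

Lemma same_inI i : inI nu (e i) = inI rho i.
Proof.
apply/inIP/inIP => -[k kE]; exists k; last by rewrite -same.2 kE.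
by apply: e_inj; rewrite same.2.
Qed.

Lemma same_notin j : j \notin codom e -> ~~ inI nu j.
Proof.
by apply: contra => /inIP[k <-]; rewrite -same.2; exact: codom_f.
Qed.

Lemma same_vmx : vmx nu = vmx rho.
Proof. by apply/matrixP => r k; rewrite !mxE same.2. Qed.

Lemma same_coords xi : coords nu xi = coords rho xi.
Proof. by rewrite /coords same_vmx. Qed.

Lemma same_mu z : chart_mu nu z = chart_mu rho z.
Proof.
congr (_ *m invmx _); last exact: same_vmx.
by apply/rowP => k; rewrite !mxE same.2.
Qed.

Lemma same_dom z : chart_dom nu z <-> chart_dom rho z.
Proof.
split=> /chart_domP zd; apply/chart_domP => j jI.
  by rewrite -same_mu; apply: zd; rewrite same_inI.
case: (boolP (j \in codom e)) => [/codomP[i ij]|jn].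
  by rewrite ij same_mu; apply: zd; rewrite -same_inI -ij.
apply: slack => //; rewrite polyE same_mu => i.
case: (boolP (inI rho i)) => [/inIP[k <-]|iI]; last exact: ltW (zd i iI).
by rewrite (chart_mu_in (qd_basis D' rho)) lerDr sqabs_ge0.
Qed.

(** The chart of the larger reduction only adds coordinates to the section. *)
Lemma same_section z i : re (chart_section rho z) i = re (chart_section nu z) (e i) /\
  im (chart_section rho z) i = im (chart_section nu z) (e i).
Proof.
case: (boolP (inI rho i)) => [/inIP[k <-]|iI].
  by rewrite same.2 !re_section_in !im_section_in.
have eI : ~~ inI nu (e i) by rewrite same_inI.
by rewrite !re_section_out// !im_section_out// same_mu.
Qed.

End SameVertex.

Definition extend (b : 'cV[R]_h) : 'cV[R]_n :=
  \col_j (if [pick i | e i == j] is Some i then b i 0 else 0).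

Lemma extend_in b i : extend b (e i) 0 = b i 0.
Proof.
rewrite mxE; case: pickP => [i' /eqP/e_inj->//|/(_ i)].
by rewrite eqxx.
Qed.

Lemma extend_out b j : j \notin codom e -> extend b j 0 = 0.
Proof.
move=> jn; rewrite mxE; case: pickP => // i /eqP ij.
by move: jn; rewrite -ij codom_f.
Qed.

Lemma lincomb_extend b : lincomb v (extend b) = lincomb v' b.
Proof.
rewrite /lincomb (bigID (mem (e @: 'I_h)))/= [X in _ + X]big1 ?addr0; last first.
  move=> j jn; rewrite extend_out ?scale0r//.
  by apply: contra jn => /codomP[i ->]; exact: imset_f.
rewrite big_imset => [|i j _ _ /e_inj//]; apply: eq_bigr => i _.
by rewrite extend_in.
Qed.

(** A coefficient off the facets is an integer as soon as its rotation relates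
    two points whose coordinate there is positive, hence it contributes an
    element of [Q]. Conversely, the coordinates off the facets are functions of
    [mu], which is determined by the moduli of the coordinates of the facets. *)
Lemma same_par nu1 rho1 nu2 rho2 z1 z2 : same_vertex nu1 rho1 -> same_vertex nu2 rho2 ->
  chart_dom nu1 z1 -> chart_dom nu2 z2 ->
  chart_par N nu1 z1 = chart_par N nu2 z2 <-> chart_par N' rho1 z1 = chart_par N' rho2 z2.
Proof.
move=> s1 s2 d1 d2.
have d1' := (same_dom s1 z1).1 d1; have d2' := (same_dom s2 z2).1 d2.
have [_ pos1] := section_slice (qd_basis D nu1) d1.
have [_ pos2] := section_slice (qd_basis D nu2) d2.
split=> [/(parP D d1 d2)[a [Qa aE]]|/(parP D' d1' d2')[b [Qb bE]]].
  apply/(parP D' d1' d2'); pose b : 'cV[R]_h := \col_i a (e i) 0; exists b; split.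
    rewrite -lincomb_extend -[extend b](subKr a) lincombB; apply: (qd_sub D) => //.
    apply: (Q_int D) => j; rewrite !mxE.
    case: pickP => [i /eqP <-|jn]; first by rewrite mxE subrr rpred0.
    have {}jn : j \notin codom e by apply/codomP => -[i ij]; have := jn i; rewrite ij eqxx.
    have [p1 q1] := pos1 j (same_notin s1 jn); have [p2 q2] := pos2 j (same_notin s2 jn).
    by rewrite subr0; rewrite aE in p2 q2; exact: rot_pos_int p1 q1 p2 q2.
  apply: zcoord_ext => i; have [r1 i1] := same_section s1 z1 i;
    have [r2 i2] := same_section s2 z2 i.
    by rewrite re_rot r1 i1 r2 aE re_rot mxE.
  by rewrite im_rot r1 i1 i2 aE im_rot mxE.
apply/(parP D d1 d2); exists (extend b); rewrite lincomb_extend; split=> //.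
have muE : chart_mu nu1 z1 = chart_mu nu2 z2.
  rewrite (same_mu s1) (same_mu s2); apply: (pairing_inj (qd_basis D' rho1)) => k.
  rewrite -(section_sqabs (qd_basis D' rho1) _ d1') -(section_sqabs (qd_basis D' rho2) _ d2').
  by rewrite bE sqabs_rot.
have extend_int j : j \notin codom e -> extend b j 0 \is a Num.int.
  by move=> jn; rewrite extend_out ?rpred0.
apply: zcoord_ext => j; case: (boolP (j \in codom e)) => [/codomP[i ->]|jn].
- have [r1 i1] := same_section s1 z1 i; have [r2 i2] := same_section s2 z2 i.
  by rewrite re_rot extend_in -r1 -i1 -r2 bE re_rot.
- have [-> _] := rot_int_coord (chart_section nu1 z1) (extend_int j jn).
  by rewrite (re_section_out _ (same_notin s1 jn)) (re_section_out _ (same_notin s2 jn)) muE.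
- have [r1 i1] := same_section s1 z1 i; have [r2 i2] := same_section s2 z2 i.
  by rewrite im_rot extend_in -r1 -i1 -i2 bE im_rot.
- have [_ ->] := rot_int_coord (chart_section nu1 z1) (extend_int j jn).
  by rewrite (im_section_out _ (same_notin s1 jn)) (im_section_out _ (same_notin s2 jn)).
Qed.

Lemma id_smooth (U : set 'rV[R]_(d + d)) : open U -> smooth_on U id.
Proof. by move=> oU; apply/smooth_onP => k; exact: (zCk_Ck oU (zCk_id k U)). Qed.

(** The symplectomorphism is the identity in corresponding charts. *)
Lemma comparison_map : exists2 F : X -> X', symplectomorphism F &
  forall nu rho z, same_vertex nu rho -> chart_dom nu z ->
    F (chart_par N nu z) = chart_par N' rho z.
Proof.
have /choice[F FE] : forall p : X, exists p' : X', forall nu rho z, same_vertex nu rho ->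
    chart_dom nu z -> chart_par N nu z = p -> chart_par N' rho z = p'.
  move=> p; have [nu [z [zd zp]]] := charts_cover D p; have [rho s] := same_vertex_down nu.
  exists (chart_par N' rho z) => nu2 rho2 z2 s2 d2 z2p.
  by apply/(same_par s2 s d2 zd); rewrite z2p.
have /choice[G GE] : forall p' : X', exists p : X, forall nu rho z, same_vertex nu rho ->
    chart_dom nu z -> chart_par N' rho z = p' -> chart_par N nu z = p.
  move=> p; have [rho [z [zd' zp]]] := charts_cover D' p; have [nu s] := same_vertex_up rho.
  have zd := (same_dom s z).2 zd'.
  exists (chart_par N nu z) => nu2 rho2 z2 s2 d2 z2p.
  by apply/(same_par s2 s d2 zd); rewrite z2p.
have Fpar nu rho z : same_vertex nu rho -> chart_dom nu z ->
    F (chart_par N nu z) = chart_par N' rho z.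
  by move=> s zd; rewrite -(FE _ nu rho z s zd erefl).
have Gpar nu rho z : same_vertex nu rho -> chart_dom nu z ->
    G (chart_par N' rho z) = chart_par N nu z.
  by move=> s zd; rewrite -(GE _ nu rho z s zd erefl).
exists F => //; split.
- move=> nu z zd; have [rho s] := same_vertex_down nu.
  have oU := @chart_dom_open _ _ _ v l nu.
  exists rho, (chart_dom nu), id; split; first exact: zd.
  split=> //; first exact: id_smooth.
  by move=> x xd; split; [exact: (same_dom s x).1 xd|exact: esym (Fpar nu rho x s xd)].
- move=> nu rho2 O f [oO Od fs fP] x Ox u1 u2; have [rho s] := same_vertex_down nu.
  rewrite [LHS](chart_form_std u1 u2 (Od x Ox)).
  rewrite [RHS](chart_form_std _ _ (fP x Ox).1).
  apply: (@lift_pullback _ _ _ _ _ _ D' rho rho2 O f oO) => // y Oy.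
    exact: (same_dom s y).1 (Od y Oy).
  by have [fd fE] := fP y Oy; split=> //; rewrite [LHS]fE; exact: Fpar s (Od y Oy).
- exists G.
    move=> rho z zd'; have [nu s] := same_vertex_up rho.
    have oU := @chart_dom_open _ _ _ v' l' rho.
    exists nu, (chart_dom rho), id; split; first exact: zd'.
    split=> //; first exact: id_smooth.
    move=> x xd; have xd' := (same_dom s x).2 xd.
    by split; [exact: xd'|exact: esym (Gpar nu rho x s xd')].
  split=> p.
    have [nu [z [zd <-]]] := charts_cover D p; have [rho s] := same_vertex_down nu.
    by rewrite (Fpar nu rho z s zd); exact: Gpar.
  have [rho [z [zd' <-]]] := charts_cover D' p; have [nu s] := same_vertex_up rho.
  have zd := (same_dom s z).2 zd'.
  by rewrite (Gpar nu rho z s zd); exact: Fpar.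
Qed.

Lemma comparison (nu0 : vertex_index v l) (nu0' : vertex_index v' l') :
  exists2 F : X -> X', symplectomorphism F &
    forall xi p, F (@action R d n v l Q nu0 xi p) = @action R d h v' l' Q nu0' xi (F p).
Proof.
have [F Fsym Fpar] := comparison_map; exists F => // xi p.
have [nu [z [zd <-]]] := charts_cover D p; have [rho s] := same_vertex_down nu.
have zd' := (same_dom s z).1 zd.
have rd := (chart_dom_rot nu (coords nu xi) z).2 zd.
rewrite (action_par D nu0 xi zd) (Fpar nu rho z s zd) (action_par D' nu0' xi zd').
by rewrite (Fpar nu rho _ s rd) (same_coords s).
Qed.

End Comparison.

Theorem proposition4p3 (R : realType) (d h n : nat) (hn : (h <= n)%N)
  (P : set 'rV[R]_d) (Q : set 'cV[R]_d)
  (v : 'I_n -> 'cV[R]_d) (l : 'I_n -> R)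
  (datum : prato_datum P Q (fun j : 'I_h => v (widen_ord hn j)))
  (PE : P = polyhedron v l)
  (span_v : zspan v = Q)
  (strict : forall j : 'I_n, (h <= j)%N ->
     P `<=` [set mu | l j < pairing mu (v j)]) :
  let M := reduction v l in
  let M' := prato_quasifold Q (fun j : 'I_h => v (widen_ord hn j))
              (fun j : 'I_h => l (widen_ord hn j)) in
  [/\ is_symplectic_quasifold M,
      is_symplectic_quasifold M',
      lattice Q -> is_orbifold M' &
      exists (act : 'cV[R]_d -> M -> M) (act' : 'cV[R]_d -> M' -> M'),
        [/\ induced_action act /\ induced_action act',
            effective_action Q act,
            exists2 Phi : M -> 'rV[R]_d,
              hamiltonian_action Q act Phi & range Phi = P,
            quasitorus_action Q act' &
            exists2 F : M -> M', symplectomorphism F &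
              forall xi x, F (act xi x) = act' xi (F x)]].
Proof.
pose e := widen_ord hn.
have e_incr : {homo e : i j / (i < j)%N} by [].
have slack (j : 'I_n) : j \notin codom e -> P `<=` [set mu | l j < pairing mu (v j)].
  move=> jn; apply: strict; rewrite leqNgt; apply: contra jn => jh.
  by apply/codomP; exists (Ordinal jh); exact: val_inj.
have D : quasi_data v l Q by exact: (@quasi_data_full R d n h e P Q v l e_incr datum PE slack span_v).
have D' := @quasi_data_facets R d n h e P Q v l datum PE slack.
have polyE : polyhedron v l = polyhedron (fun j => v (e j)) (fun j => l (e j)).
  by rewrite -PE; exact: (@facets_polyhedron R d n h e P Q v l datum PE slack).
have slack' (j : 'I_n) : j \notin codom e -> forall mu, polyhedron v l mu -> l j < pairing mu (v j).
  by move=> jn mu; rewrite -PE; exact: slack.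
have [mu Pmu] := @polytope_point R d n h e P Q v datum.
have Pmu1 : polyhedron v l mu by rewrite -PE.
have Pmu2 : polyhedron (fun j => v (e j)) (fun j => l (e j)) mu by rewrite -polyE.
have [nu _] := qd_cover D Pmu1; have [rho _] := qd_cover D' Pmu2.
rewrite /reduction /prato_quasifold torus_exp_rel span_v; split.
- exact: (reduced_space_symplectic D).
- exact: (reduced_space_symplectic D').
- exact: (reduced_space_orbifold D').
- exists (@action R d n v l Q nu), (@action R d h _ _ Q rho); split.
  + by split; [exact: (action_induced D nu)|exact: (action_induced D' rho)].
  + exact: (@action_effective R d n v l Q D nu).
  + exists (@moment R d n v l Q nu); first exact: (action_hamiltonian D nu).
    by rewrite PE; exact: (moment_range D nu).
  + exact: (action_quasitorus D' rho).
  + exact: (comparison e_incr D D' polyE slack' nu rho).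
Qed.
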